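(* Let ${\cal N}: {\cal B}({\cal H}_A)\to{\cal B}({\cal H}_B)$ be a quantum channel with Stinespring isometry $U:{\cal H}_A\to{\cal H}_B\otimes{\cal H}_C$ (finite dimensions). For every input state $\rho$ on ${\cal H}_A$: (i) if $S(A)\le S(B)$ then $C_A^\rightarrow({\cal N})\ge S(A)$, and in general $C_A^\rightarrow({\cal N})\ge \tfrac12 I(A:B)$; (ii) for any input states $\rho$ with $S(B)<S(C)$ and $\rho'$ with $S(B')<S(A')$, $$C_A^\rightarrow({\cal N}) \ge \frac{S(C)-S(B)+\frac{S(B)}{S(A')-S(B')}S(A')}{1+\frac{S(B)}{S(A')-S(B')}};$$ (iii) in particular, if a single input state $\rho=\rho'$ satisfies $S(B)<S(C)$ and $S(B)<S(A)$, then $$C_A^\rightarrow({\cal N}) \ge \Bigl[1-\tfrac{S(B)}{S(A)}\Bigr]S(C)+\tfrac{S(B)}{S(A)}S(B).$$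
   Context: All logarithms are base 2; $S$ is von Neumann entropy. The channel is ${\cal N}(X)=\tr_C(UXU^* )$, and its complementary channel is $\overline{{\cal N}}(X)=\tr_B(UXU^* )$; the output system $C$ (the ''environment'') is held by a helper Charlie, $B$ by the receiver Bob. Let ${\cal S}=U{\cal H}_A\subset{\cal H}_B\otimes{\cal H}_C$. A classical code of blocklength $n$ is a family $(\varphi_i,M_i)_{i=1}^N$ of pure states $\ket{\varphi_i}\in{\cal S}^{\otimes n}$ and a POVM $(M_i)_{i=1}^N$ on ${\cal H}_B^{\otimes n}\otimes{\cal H}_C^{\otimes n}$; it has error $\epsilon$ if $\tr(\varphi_i M_i)\ge1-\epsilon$ for all $i$. It is environment-assisted if the POVM is implementable by one-way LOCC from Charlie ($C^n$) to Bob ($B^n$). $N_A^\rightarrow(n,\epsilon)$ is the largest $N$ of such a code, and the (pessimistic) environment-assisted classical capacity is $C_A^\rightarrow({\cal N})=\inf_{\epsilon>0}\liminf_{n\to\infty}\frac1n\log N_A^\rightarrow(n,\epsilon)$. For an input state $\rho$, let $\phi$ be a purification of $\rho$ on ${\cal H}_A\otimes{\cal H}_A$ and $\ket{\psi}_{ABC}=(\1\otimes U)\ket{\phi}$; write $S(A)=S(\rho)$, $S(B)=S({\cal N}(\rho))$, $S(C)=S(\overline{{\cal N}}(\rho))$, and $I(A:B)=S(A)+S(B)-S(C)$. For a second input state $\rho'$ the corresponding quantities are denoted $S(A'),S(B'),S(C')$. *)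

(* Defs.v *)
From HB Require Import structures.
From mathcomp Require Import all_boot all_order all_algebra.
From mathcomp Require Import all_classical all_reals all_analysis.
From mathcomp Require Import complex.
Set Implicit Arguments. Unset Strict Implicit. Unset Printing Implicit Defensive.
Import Order.TTheory GRing.Theory Num.Theory.
Local Open Scope ring_scope.
Local Open Scope classical_set_scope.

(* Finite-dimensional Hilbert spaces are C^I for finite index types I,
   with C = R[i]; an operator from C^J to C^I is a function I -> J -> C
   (its matrix in the standard bases). *)
Section Quantum.
Variable R : realType.
Local Notation C := R[i].

Definition vec (I : finType) := I -> C.
Definition op (I J : finType) := I -> J -> C.

Definition applyop (I J : finType) (A : op I J) (v : vec J) : vec I :=
  fun i => \sum_(j : J) A i j * v j.

Definition inner (I : finType) (u v : vec I) : C :=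
  \sum_(i : I) (u i)^* * v i.

Definition idop (I : finType) : op I I := fun i j => (i == j)%:R.

(* positive semidefinite: <v|Av> >= 0 for every v (order of C: real and >= 0) *)
Definition psd (I : finType) (A : op I I) : Prop :=
  forall v : vec I, 0 <= inner v (applyop A v).

Definition trace (I : finType) (A : op I I) : C := \sum_(i : I) A i i.

Definition is_state (I : finType) (rho : op I I) : Prop :=
  psd rho /\ trace rho = 1.

Definition is_unit_vec (I : finType) (v : vec I) : Prop := inner v v = 1.

Definition is_isometry (I J : finType) (V : op I J) : Prop :=
  forall j j' : J, \sum_(i : I) (V i j)^* * V i j' = idop j j'.

Definition is_povm (I : finType) (N : nat) (M : 'I_N -> op I I) : Prop :=
  (forall k, psd (M k)) /\ (forall x y, \sum_(k < N) M k x y = idop x y).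

Definition spectrum_of (I : finType) (rho : op I I) (lam : {ffun I -> R}) : Prop :=
  exists V : op I I, is_isometry V /\
    forall x y, rho x y = \sum_(k : I) V x k * ((lam k)%:C)%C * (V y k)^*.

Definition spec (I : finType) (rho : op I I) : {ffun I -> R} :=
  xget [ffun => 0] [set lam | spectrum_of rho lam].

Definition log2 (x : R) : R := ln x / ln 2.

Definition xlog2 (x : R) : R := if x == 0 then 0 else x * log2 x.

Definition entropy (I : finType) (rho : op I I) : R :=
  - \sum_(i : I) xlog2 (spec rho i).

(* Stinespring isometry U : H_A -> H_B (x) H_C, indices of H_B (x) H_C are pairs *)
Variables (A B E : finType).

(* channel N(X) = tr_C (U X U^* ) *)
Definition chan (U : op (B * E)%type A) (X : op A A) : op B B :=
  fun b b' => \sum_(c : E) \sum_(a : A) \sum_(a' : A)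
                U (b, c) a * X a a' * (U (b', c) a')^*.

(* complementary channel  tr_B (U X U^* ) *)
Definition chanc (U : op (B * E)%type A) (X : op A A) : op E E :=
  fun c c' => \sum_(b : B) \sum_(a : A) \sum_(a' : A)
                U (b, c) a * X a a' * (U (b, c') a')^*.

(* n-fold tensor powers: index set of H^{(x)n} is {ffun 'I_n -> I} *)
Definition tpow (n : nat) (I : finType) := {ffun 'I_n -> I}.

(* U^{(x)n} : H_A^{(x)n} -> H_B^{(x)n} (x) H_C^{(x)n}  (systems regrouped) *)
Definition Utens (U : op (B * E)%type A) (n : nat) :
    op (tpow n B * tpow n E)%type (tpow n A) :=
  fun bc a => \prod_(k < n) U (bc.1 k, bc.2 k) (a k).

(* one-way LOCC POVM from Charlie (C^n) to Bob (B^n): Charlie performs a POVM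
   (E_k), communicates k, Bob performs a POVM (F^k_i) depending on k;
   M_i = sum_k F^k_i (x) E_k *)
Definition one_way_LOCC (n N : nat)
    (M : 'I_N -> op (tpow n B * tpow n E)%type (tpow n B * tpow n E)%type) : Prop :=
  exists (K : nat) (Ech : 'I_K -> op (tpow n E) (tpow n E))
         (F : 'I_K -> 'I_N -> op (tpow n B) (tpow n B)),
    is_povm Ech /\ (forall k, is_povm (F k)) /\
    forall i x y, M i x y = \sum_(k < K) F k i x.1 y.1 * Ech k x.2 y.2.

Definition EA_code (U : op (B * E)%type A) (n N : nat) (eps : R) : Prop :=
  exists (phi : 'I_N -> vec (tpow n B * tpow n E)%type)
         (M : 'I_N -> op (tpow n B * tpow n E)%type (tpow n B * tpow n E)%type),
    (forall i, exists psi : vec (tpow n A),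
        is_unit_vec psi /\ phi i = applyop (@Utens U n) psi) /\
    is_povm M /\ one_way_LOCC M /\
    forall i, ((1 - eps)%:C)%C <= inner (phi i) (applyop (M i) (phi i)).

Local Open Scope ereal_scope.

Definition NA (U : op (B * E)%type A) (n : nat) (eps : R) : \bar R :=
  ereal_sup [set (N%:R)%:E | N in [set N : nat | EA_code U n N eps]].

Definition elog2 (x : \bar R) : \bar R :=
  match x with
  | r%:E => (log2 r)%:E
  | +oo => +oo
  | -oo => -oo
  end.

Definition capacity_EA (U : op (B * E)%type A) : \bar R :=
  ereal_inf [set limn_einf (fun n : nat => ((n%:R)^-1)%:E * elog2 (NA U n eps))
            | eps in [set eps : R | (0 < eps)%R]].

End Quantum.

(* Main.v *)
Require Import Defs.
From HB Require Import structures.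
From mathcomp Require Import all_boot all_order all_algebra.
From mathcomp Require Import all_classical all_reals all_analysis.
From mathcomp Require Import complex.
From mathcomp Require Import zify ring lra.
Set Implicit Arguments. Unset Strict Implicit. Unset Printing Implicit Defensive.
Import Order.TTheory GRing.Theory Num.Theory.
Local Open Scope ring_scope.

(* Codewords are superpositions of eigenvectors of the input with independent
   uniform phases, and Charlie measures in random-phase vectors as well, so that
   only second and fourth moments of the phases enter.  If Bob's unnormalised
   post-measurement vectors have Gram matrix [G], the measurement along their
   Loewdin orthogonalisation has amplitudes [(sqrt G) i i >= 3/2 G i i - 1/2
   sum_j |G i j|^2], whose expectation involves only the purities of the
   marginals.  On typical sequences this gives the rate [min (S(A), S(B))], which
   by subadditivity is at least [I(A:B) / 2].

   For (ii) the [n] uses are split.  On the first block, coded at rate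
   [S(C) - S(B)], Charlie identifies the message alone, again by Loewdin
   orthogonalisation, and is left with a standard entangled state of entropy
   [S(B)] per letter shared with Bob.  On the second block this entanglement adds
   to Bob's entropy, and the first argument gives the rate [S(A')] there when the
   block lengths are in the ratio [1 : S(B) / (S(A') - S(B'))].  (iii) is the case
   [rho' = rho]. *)

(** * Complex numbers and vectors *)

(** Charlie's measurement vectors are flat in the eigenbasis of his marginal. Each outcome leaves
    Bob with pure states, so rank-one effects suffice for him, and these states have nearly constant
    norm. The last point is essential: the bound [3/2 x - 1/2 x^2] is close to 1 only if the
    diagonal Gram entries have second moment close to 1. The subtracted diagonal of the fourth
    moment is therefore kept to the end; dropping it would leave the purity of Charlie's marginal,
    which need not be small. For two different codewords the fourth moment yields two terms. Their
    overlap survives Charlie's measurement and costs the purity of the input; the fluctuation caused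
    by that measurement costs the purity of Bob's marginal. Shared entanglement multiplies only the
    second term, by its largest squared Schmidt coefficient. This is why (ii) can relax the
    constraint by Bob's entropy but not the one by [S(A')]. Random coding controls the error
    averaged over messages, whereas codes are judged by their worst message; half of the messages
    are given up to pass from one to the other. *)

Local Notation "x %:C" := (real_complex _ x) : ring_scope.

Section ComplexBasics.
Variable R : realType.
Local Notation C := R[i].
Implicit Types (x y : R) (z w : C).

Definition sqn (z : C) : R := complex.Re z ^+ 2 + complex.Im z ^+ 2.

Lemma conj_def z : z^* = (complex.Re z -i* complex.Im z)%C.
Proof. by case: z. Qed.

Lemma ReD z w : complex.Re (z + w) = complex.Re z + complex.Re w.
Proof. by case: z; case: w. Qed.

Lemma ReN z : complex.Re (- z) = - complex.Re z.
Proof. by case: z. Qed.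

Lemma cRe_conj z : complex.Re z^* = complex.Re z.
Proof. by case: z. Qed.

Lemma Re_rc x : complex.Re x%:C = x. Proof. by []. Qed.

Lemma ReZ x z : complex.Re (x%:C * z) = x * complex.Re z.
Proof. by case: z => a b /=; rewrite mul0r subr0. Qed.

Lemma Re_sum (I : finType) (P : pred I) (F : I -> C) :
  complex.Re (\sum_(i | P i) F i) = \sum_(i | P i) complex.Re (F i).
Proof. by apply: (big_morph _ ReD). Qed.

Lemma conj_rc x : (x%:C)^* = x%:C :> C.
Proof. by rewrite conj_def /= oppr0. Qed.

Lemma rc_inj x y : x%:C = y%:C :> C -> x = y.
Proof. by case. Qed.

Lemma rc_sum (I : finType) (P : pred I) (F : I -> R) :
  (\sum_(i | P i) F i)%:C = \sum_(i | P i) (F i)%:C :> C.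
Proof. by rewrite rmorph_sum. Qed.

Lemma conj_sum (I : finType) (P : pred I) (F : I -> C) :
  (\sum_(i | P i) F i)^* = \sum_(i | P i) (F i)^*.
Proof. by rewrite rmorph_sum. Qed.

Lemma sqnE z : (sqn z)%:C = z^* * z.
Proof.
rewrite conj_def /sqn; case: z => a b /=; apply/eqP; rewrite eq_complex /=.
by apply/andP; split; apply/eqP; ring.
Qed.

Lemma sqnE' z : (sqn z)%:C = z * z^*.
Proof. by rewrite sqnE mulrC. Qed.

Lemma sqn_Re z : sqn z = complex.Re (z^* * z).
Proof. by rewrite -sqnE. Qed.

Lemma sqnM z w : sqn (z * w) = sqn z * sqn w.
Proof. by apply: rc_inj; rewrite rmorphM /= !sqnE rmorphM /=; ring. Qed.

Lemma sqn_conj z : sqn z^* = sqn z.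
Proof. by rewrite /sqn conj_def /= sqrrN. Qed.

Lemma sqnN z : sqn (- z) = sqn z.
Proof. by rewrite /sqn; case: z => a b /=; rewrite !sqrrN. Qed.

Lemma sqn_ge0 z : 0 <= sqn z.
Proof. by rewrite addr_ge0 ?sqr_ge0. Qed.

Lemma sqn_rc x : sqn x%:C = x ^+ 2.
Proof. by rewrite /sqn /= expr0n /= addr0. Qed.

Lemma sqn0 : sqn 0 = 0. Proof. by rewrite /sqn /= expr0n /= addr0. Qed.

Lemma sqn1 : sqn 1 = 1. Proof. by rewrite /sqn /= expr0n expr1n /= addr0. Qed.

Lemma sqn_eq0 z : sqn z = 0 -> z = 0.
Proof.
move/eqP; rewrite /sqn paddr_eq0 ?sqr_ge0// !sqrf_eq0 => /andP[a b].
by apply/eqP; rewrite eq_complex a b.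
Qed.

Lemma Re_sq_le z : complex.Re z ^+ 2 <= sqn z.
Proof. by rewrite /sqn lerDl sqr_ge0. Qed.

Lemma sqnD z w : sqn (z + w) = sqn z + sqn w + 2 * complex.Re (z^* * w).
Proof. rewrite /sqn conj_def; case: z => a b; case: w => c d /=; ring. Qed.

Lemma sqnB z w : sqn (z - w) = sqn z + sqn w - 2 * complex.Re (z^* * w).
Proof. rewrite sqnD sqnN mulrN ReN; ring. Qed.

Lemma ge0_rc z : 0 <= z -> z = (complex.Re z)%:C.
Proof. by case: z => a b; rewrite lecE /= => /andP[/eqP -> _]. Qed.

End ComplexBasics.

Section HilbertSpace.
Variable R : realType.
Local Notation C := R[i].

Definition nrm (I : finType) (v : vec R I) : R := \sum_i sqn (v i).

Lemma innerE (I : finType) (v : vec R I) : inner v v = (nrm v)%:C.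
Proof. by rewrite /inner /nrm rc_sum; apply: eq_bigr => i _; rewrite sqnE. Qed.

Lemma nrm_ge0 (I : finType) (v : vec R I) : 0 <= nrm v.
Proof. by apply: sumr_ge0 => i _; exact: sqn_ge0. Qed.

Lemma unit_nrm (I : finType) (v : vec R I) : is_unit_vec v <-> nrm v = 1.
Proof.
rewrite /is_unit_vec innerE; split=> [|->//].
by rewrite -[X in _ = X]/((1 : R)%:C) => /rc_inj.
Qed.

Lemma inner_conj (I : finType) (u v : vec R I) : (inner u v)^* = inner v u.
Proof.
by rewrite /inner conj_sum; apply: eq_bigr => i _; rewrite rmorphM /= conjCK mulrC.
Qed.

(* With [f] orthogonal; the terms with [q j = 0] vanish since [x / 0 = 0]. *)
Lemma bessel (J I : finType) (f : J -> vec R I) (q : J -> R) (h : vec R I) :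
  (forall j k, inner (f j) (f k) = (q j)%:C *+ (j == k)) ->
  \sum_j sqn (inner (f j) h) / q j <= nrm h.
Proof.
move=> ortho; pose a j := inner (f j) h * ((q j)^-1)%:C.
(* [w] is the orthogonal projection of [h] onto the span of the [f j]; as [<w, h> = |w|^2], the
   bound is [|w - h|^2 >= 0]. *)
pose w : vec R I := fun i => \sum_j a j * f j i.
have hw : inner w h = (\sum_j sqn (inner (f j) h) / q j)%:C.
  rewrite /inner /w rc_sum.
  transitivity (\sum_i \sum_j ((a j)^* * ((f j i)^* * h i))).
    apply: eq_bigr => i _; rewrite conj_sum mulr_suml; apply: eq_bigr => j _.
    by rewrite rmorphM /= mulrA.
  rewrite exchange_big; apply: eq_bigr => j _; rewrite -mulr_sumr.
  rewrite -/(inner (f j) h) /a rmorphM /= conj_rc rmorphM /= sqnE; ring.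
have ww : nrm w = \sum_j sqn (inner (f j) h) / q j.
  apply: rc_inj; rewrite -innerE {2}/w.
  transitivity (\sum_j a j * inner w (f j)).
    rewrite /inner; under eq_bigr do rewrite mulr_sumr.
    rewrite exchange_big; apply: eq_bigr => j _ /=; rewrite mulr_sumr.
    by apply: eq_bigr => i _; rewrite mulrCA.
  rewrite rc_sum; apply: eq_bigr => j _.
  have -> : inner w (f j) = (a j)^* * (q j)%:C.
    rewrite /inner /w.
    transitivity (\sum_k (a k)^* * inner (f k) (f j)).
      under eq_bigr do rewrite conj_sum mulr_suml.
      rewrite exchange_big; apply: eq_bigr => k _; rewrite mulr_sumr.
      by apply: eq_bigr => i _; rewrite rmorphM /= mulrA.
    rewrite (bigD1 j) //= ortho eqxx mulr1n big1 ?addr0// => k kj.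
    by rewrite ortho (negbTE kj) mulr0n mulr0.
  rewrite /a mulrA [_ * (_)^*]mulrC -sqnE sqnM sqn_rc -rmorphM /=; congr (_%:C).
  have [->|q0] := eqVneq (q j) 0; first by rewrite invr0 !mulr0.
  by field.
have : 0 <= \sum_i sqn (w i - h i) by apply: sumr_ge0 => i _; exact: sqn_ge0.
under eq_bigr do rewrite sqnB.
rewrite sumrB big_split /= -mulr_sumr -Re_sum -/(inner w h) hw Re_rc.
by rewrite -/(nrm w) -/(nrm h) ww; lra.
Qed.

Lemma cauchy_schwarz (I : finType) (u v : vec R I) :
  sqn (inner u v) <= nrm u * nrm v.
Proof.
have [u0|u0] := eqVneq (nrm u) 0.
  suff -> : inner u v = 0 by rewrite sqn0 u0 mul0r.
  rewrite /inner big1// => i _; suff -> : u i = 0 by rewrite rmorph0 mul0r.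
  apply: sqn_eq0; move/eqP: u0; rewrite /nrm psumr_eq0; last by move=> *; exact: sqn_ge0.
  by move/allP => /(_ i); rewrite mem_index_enum => /(_ isT)/eqP.
have up : 0 < nrm u by rewrite lt_neqAle eq_sym u0 nrm_ge0.
have := @bessel unit I (fun=> u) (fun=> nrm u) v.
rewrite (big_pred1 tt) /=; last by case.
move=> /(_ _)/wrap[]; first by case=> -[]; rewrite innerE.
by rewrite ler_pdivrMr// mulrC.
Qed.

(* [tr ((F^* F)^2) = tr ((F F^* )^2)] for the matrix [F s c]. *)
Lemma gram_swap (S I : finType) (F : S -> vec R I) :
  \sum_s \sum_s' sqn (inner (F s) (F s')) =
  \sum_c \sum_c' sqn (\sum_s F s c * (F s c')^*).
Proof.
apply: rc_inj; rewrite !rc_sum; under eq_bigr do rewrite rc_sum.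
under [RHS]eq_bigr do rewrite rc_sum.
transitivity (\sum_s \sum_s' \sum_c \sum_c' F s c * (F s c')^* * (F s' c)^* * F s' c').
  apply: eq_bigr => s _; apply: eq_bigr => s' _; rewrite sqnE /inner.
  rewrite conj_sum mulr_suml; apply: eq_bigr => c _; rewrite mulr_sumr.
  by apply: eq_bigr => c' _; rewrite rmorphM /= conjCK; ring.
transitivity (\sum_c \sum_c' \sum_s \sum_s' F s c * (F s c')^* * (F s' c)^* * F s' c').
  under eq_bigr do rewrite exchange_big /=.
  rewrite exchange_big; apply: eq_bigr => c _ /=.
  under eq_bigr do rewrite exchange_big /=.
  by rewrite exchange_big.
apply: eq_bigr => c _; apply: eq_bigr => c' _; rewrite sqnE' conj_sum mulr_suml.
apply: eq_bigr => s _; rewrite mulr_sumr; apply: eq_bigr => s' _.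
by rewrite rmorphM /= conjCK; ring.
Qed.

End HilbertSpace.

(** * Averages over random phases *)

Section Average.
Variables (K : numFieldType) (T : finType).
Implicit Types F G : T -> K.

Definition avg (F : T -> K) : K := (#|T|%:R)^-1 * \sum_t F t.

Lemma avgD F G : avg (fun t => F t + G t) = avg F + avg G.
Proof. by rewrite /avg big_split mulrDr. Qed.

Lemma avgN F : avg (fun t => - F t) = - avg F.
Proof. by rewrite /avg sumrN mulrN. Qed.

Lemma avgB F G : avg (fun t => F t - G t) = avg F - avg G.
Proof. by rewrite avgD avgN. Qed.

Lemma avgZ (a : K) F : avg (fun t => a * F t) = a * avg F.
Proof. by rewrite /avg -mulr_sumr mulrCA. Qed.

Lemma avgZr (a : K) F : avg (fun t => F t * a) = avg F * a.
Proof. by rewrite /avg -mulr_suml mulrA. Qed.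

Lemma avg_sum (I : finType) (P : pred I) (F : I -> T -> K) :
  avg (fun t => \sum_(i | P i) F i t) = \sum_(i | P i) avg (F i).
Proof. by rewrite /avg exchange_big mulr_sumr. Qed.

Lemma eq_avg F G : F =1 G -> avg F = avg G.
Proof. by move=> e; rewrite /avg (eq_bigr G). Qed.

Lemma ler_avg F G : (forall t, F t <= G t) -> avg F <= avg G.
Proof.
by move=> h; rewrite /avg ler_wpM2l ?invr_ge0 ?ler0n// ler_sum.
Qed.

Lemma avg_ge0 F : (forall t, 0 <= F t) -> 0 <= avg F.
Proof. by move=> h; rewrite mulr_ge0 ?invr_ge0 ?ler0n// sumr_ge0. Qed.

Lemma avg_const (a : K) : (0 < #|T|)%N -> avg (fun=> a) = a.
Proof.
move=> T0; rewrite /avg sumr_const -[a *+ _]mulr_natl mulrA mulVf ?mul1r//.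
by rewrite pnatr_eq0 -lt0n.
Qed.

End Average.

(** The probabilistic method: some choice of phases is at least as good as the mean. *)
Lemma avg_exists (R : realFieldType) (T : finType) (F : T -> R) (b : R) :
  (0 < #|T|)%N -> avg F <= b -> exists t, F t <= b.
Proof.
move=> T0 h; apply/existsP; rewrite -[X in is_true X]negbK negb_exists.
apply/negP => /forallP h2; move: h; apply/negP; rewrite -ltNge.
rewrite -[X in X < _](avg_const b T0) /avg ltr_pM2l ?invr_gt0 ?ltr0n//.
have /card_gt0P[t0 _] := T0.
rewrite (bigD1 t0)//= [X in _ < X](bigD1 t0)//= ltr_leD//.
  by rewrite ltNge h2.
by apply: ler_sum => t _; rewrite leNgt; apply/negP => /ltW; apply/negP; rewrite h2.
Qed.

Section Phases.
Variable R : realType.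
Local Notation C := R[i].

Lemma rc_avg (T : finType) (F : T -> R) : (avg F)%:C = avg (fun t => (F t)%:C) :> C.
Proof. by rewrite /avg rmorphM /= rc_sum fmorphV rmorph_nat. Qed.

Lemma Re_avg (T : finType) (F : T -> C) : complex.Re (avg F) = avg (fun t => complex.Re (F t)).
Proof.
by rewrite /avg -Re_sum -ReZ fmorphV rmorph_nat.
Qed.

Variable X : finType.

(* Independent uniform fourth roots of unity: [w ^+ 2] has mean zero, which
   signs would not give. *)
Definition phases := {ffun X -> 'I_4}.

Definition phase (t : phases) (x : X) : C := ('i%C : C) ^+ t x.

Lemma phases_gt0 : (0 < #|{: phases}|)%N.
Proof. by apply/card_gt0P; exists [ffun=> ord0]. Qed.

Lemma phase_norm t x : (phase t x)^* * phase t x = 1.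
Proof.
rewrite /phase rmorphXn -exprMn /=.
have -> : ('i%C : C)^* * 'i%C = 1; last by rewrite expr1n.
by rewrite conj_def; apply/eqP; rewrite eq_complex /=; apply/andP; split; apply/eqP; ring.
Qed.

Lemma phase_normr t x : phase t x * (phase t x)^* = 1.
Proof. by rewrite mulrC phase_norm. Qed.

Definition rotate (x : X) (t : phases) : phases :=
  [ffun y => if y == x then (t y + 1)%R else t y].

Definition turn (x y : X) : C := if y == x then 'i%C else 1.

Lemma phase_rotate x t y : phase (rotate x t) y = turn x y * phase t y.
Proof.
rewrite /phase /rotate /turn ffunE; case: eqP => _; last by rewrite mul1r.
rewrite -exprS; case: (t y) => -[|[|[|[|//]]]] k //=.
have i2 : ('i%C : C) ^+ 2 = -1 by exact: sqr_i.
by rewrite (exprM _ 2 2) i2 sqrrN expr1n expr0.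
Qed.

Lemma avg_rotate (K : numFieldType) x (F : phases -> K) :
  avg (F \o rotate x) = avg F.
Proof.
rewrite /avg; congr (_ * _); rewrite [RHS](reindex (rotate x)) //=.
exists (fun t : phases => [ffun y => if y == x then (t y - 1)%R else t y]) => t _;
  apply/ffunP => y; rewrite !ffunE; case: eqP => // _.
  by rewrite addrK.
by rewrite subrK.
Qed.

(** Turning one phase preserves the uniform measure, so [avg F = k * avg F]. *)
Lemma avg_turn0 x (F : phases -> C) (k : C) : k != 1 ->
  (forall t, F (rotate x t) = k * F t) -> avg F = 0.
Proof.
move=> k1 h; have : avg F = k * avg F.
  by rewrite -{1}(avg_rotate x) -avgZ; exact: eq_avg.
move/eqP; rewrite -subr_eq0 -{1}[avg F]mul1r -mulrBl mulf_eq0 subr_eq0 eq_sym.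
by rewrite (negbTE k1) => /eqP.
Qed.

Let i1 : ('i%C : C) != 1.
Proof. by rewrite eq_complex /= eq_sym oner_eq0. Qed.
Let i1c : (('i%C : C))^* != 1.
Proof. by rewrite eq_complex /= eq_sym oner_eq0. Qed.
Let i2c : (('i%C : C))^* * ('i%C)^* != 1.
Proof.
rewrite conj_def eq_complex /= !mul0r add0r; apply/nandP; left.
by apply/eqP; lra.
Qed.

Lemma avg_phase2 x y : avg (fun t => (phase t x)^* * phase t y) = (x == y)%:R.
Proof.
have [->|xy] := eqVneq x y.
  by under eq_avg do rewrite phase_norm; rewrite avg_const ?phases_gt0.
apply: (@avg_turn0 x _ _ i1c) => t.
by rewrite !phase_rotate /turn eqxx eq_sym (negbTE xy) mul1r rmorphM /= mulrA.
Qed.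

(** Each conjugated phase must meet an unconjugated one. There are two such pairings, and the last
    term removes the double count when all four indices agree. *)
Lemma avg_phase4 x y z w :
  avg (fun t => (phase t x)^* * phase t y * phase t z * (phase t w)^*) =
  (((x == y) && (z == w))%:R + ((x == z) && (y == w))%:R
   - [&& x == y, z == w & x == z]%:R).
Proof.
have [xy|xy] := eqVneq x y; have [zw|zw] := eqVneq z w => /=.
- subst y w; under eq_avg do rewrite phase_norm mul1r phase_normr.
  by rewrite avg_const ?phases_gt0// andbb addrK.
- subst y; have -> : (x == z) && (x == w) = false.
    by apply/negP => /andP[/eqP xz /eqP xw]; move: zw; rewrite -xz -xw eqxx.
  rewrite !addr0 subr0; apply: (@avg_turn0 z _ _ i1) => t.
  rewrite !phase_rotate /turn !eqxx [w == z]eq_sym (negbTE zw) mul1r.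
  case: eqP => _; rewrite ?mul1r; last by ring.
  rewrite rmorphM /=.
  have -> : (('i%C:C)^* * (phase t x)^* * ('i%C * phase t x) * ('i%C * phase t z) * (phase t w)^*) =
     (('i%C:C)^* * 'i%C) * ('i%C * ((phase t x)^* * phase t x * phase t z * (phase t w)^*)) by ring.
  suff -> : ('i%C : C)^* * 'i%C = 1 by rewrite mul1r.
  by rewrite -sqnE /sqn /= expr0n expr1n /= add0r.
- subst w; have [xz|xz] := eqVneq x z.
    subst z; rewrite eq_sym (negbTE xy) /= subr0 addr0.
    apply: (@avg_turn0 y _ _ i1) => t.
    rewrite !phase_rotate /turn !eqxx (negbTE xy) !mul1r.
    by ring.
  rewrite /= subr0 addr0; apply: (@avg_turn0 x _ _ i1c) => t.
  rewrite !phase_rotate /turn eqxx eq_sym (negbTE xy) eq_sym (negbTE xz) !mul1r rmorphM /=.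
  by ring.
- rewrite subr0 add0r; have [xz|xz] /= := eqVneq x z.
    subst z; have [yw|yw] := eqVneq y w.
      subst w; rewrite (eq_avg (G := fun=> 1)) ?avg_const ?phases_gt0// => t.
      by rewrite [X in X * _]mulrAC phase_norm mul1r phase_normr.
    apply: (@avg_turn0 y _ _ i1) => t.
    rewrite !phase_rotate /turn eqxx (negbTE xy) [w == y]eq_sym (negbTE yw) !mul1r.
    by ring.
  (* Two conjugated phases coincide here: the turn multiplies by the square of the conjugate of [i],
     which is [-1]. *)
  have [xw|xw] := eqVneq x w.
    subst w; apply: (@avg_turn0 x _ _ i2c) => t.
    rewrite !phase_rotate /turn eqxx eq_sym (negbTE xy) eq_sym (negbTE xz) !mul1r !rmorphM /=.
    by ring.
  apply: (@avg_turn0 x _ _ i1c) => t.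
  rewrite !phase_rotate /turn eqxx eq_sym (negbTE xy) eq_sym (negbTE xz) eq_sym (negbTE xw) !mul1r !rmorphM /=.
  by ring.
Qed.

Lemma avg_phase_prod (a b : X -> C) :
  avg (fun t => (\sum_x phase t x * a x)^* * (\sum_y phase t y * b y)) =
  \sum_x (a x)^* * b x.
Proof.
transitivity (\sum_x \sum_y ((a x)^* * b y) * avg (fun t => (phase t x)^* * phase t y)).
  under [RHS]eq_bigr do under eq_bigr do rewrite -avgZ.
  under [RHS]eq_bigr do rewrite -avg_sum.
  rewrite -avg_sum; apply: eq_avg => t; rewrite conj_sum mulr_suml.
  apply: eq_bigr => x _; rewrite mulr_sumr; apply: eq_bigr => y _.
  by rewrite rmorphM /=; ring.
apply: eq_bigr => x _; rewrite (bigD1 x)//= avg_phase2 eqxx mulr1 big1 ?addr0// => y yx.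
by rewrite avg_phase2 eq_sym (negbTE yx) mulr0.
Qed.

Lemma avg_phase_sqn (a : X -> C) :
  avg (fun t => sqn (\sum_x phase t x * a x)) = \sum_x sqn (a x).
Proof.
apply: rc_inj; rewrite rc_avg rc_sum; under eq_avg do rewrite sqnE.
by rewrite avg_phase_prod; apply: eq_bigr => x _; rewrite sqnE.
Qed.

Lemma avg_phase_sqnC (a : X -> C) :
  avg (fun t => sqn (\sum_x (phase t x)^* * a x)) = \sum_x sqn (a x).
Proof.
under eq_avg => t.
  rewrite -sqn_conj conj_sum; under eq_bigr do rewrite rmorphM /= conjCK.
  over.
by rewrite avg_phase_sqn; apply: eq_bigr => x _; rewrite sqn_conj.
Qed.

(** The three terms of [avg_phase4] become the squared trace, the squared Hilbert-Schmidt norm and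
    its diagonal part. *)
Lemma avg_phase_quad (M : X -> X -> C) :
  avg (fun t => sqn (\sum_x \sum_y (phase t x)^* * phase t y * M x y)) =
  sqn (\sum_x M x x) + \sum_x \sum_y sqn (M x y) - \sum_x sqn (M x x).
Proof.
apply: rc_inj; rewrite rc_avg rmorphB rmorphD /= !rc_sum sqnE'.
under [X in _ + X - _]eq_bigr do rewrite rc_sum.
transitivity (\sum_x \sum_y \sum_z \sum_w (M x y * (M z w)^*) *
   (((x == y) && (z == w))%:R + ((x == z) && (y == w))%:R
   - [&& x == y, z == w & x == z]%:R)).
  under [RHS]eq_bigr do under eq_bigr do under eq_bigr do under eq_bigr do
    rewrite -avg_phase4 -avgZ.
  under [RHS]eq_bigr do under eq_bigr do under eq_bigr do rewrite -avg_sum.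
  under [RHS]eq_bigr do under eq_bigr do rewrite -avg_sum.
  under [RHS]eq_bigr do rewrite -avg_sum.
  rewrite -avg_sum; apply: eq_avg => t; rewrite sqnE' mulr_suml.
  apply: eq_bigr => x _; rewrite mulr_suml; apply: eq_bigr => y _.
  rewrite conj_sum mulr_sumr; apply: eq_bigr => z _.
  rewrite conj_sum mulr_sumr; apply: eq_bigr => w _.
  by rewrite !rmorphM /= conjCK; ring.
have pick1 (a : X) (F : X -> C) : \sum_x F x * (a == x)%:R = F a.
  rewrite (bigD1 a)//= eqxx mulr1 big1 ?addr0// => x xa.
  by rewrite eq_sym (negbTE xa) mulr0.
transitivity (\sum_x \sum_y \sum_z \sum_w
   (M x y * (M z w)^* * (z == w)%:R * (x == y)%:R
    + M x y * (M z w)^* * (y == w)%:R * (x == z)%:R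
    - M x y * (M z w)^* * (z == w)%:R * (x == z)%:R * (x == y)%:R)).
  do 4 (apply: eq_bigr => ? _); rewrite !mulrDr mulrN -!mulnb !natrM; ring.
under [LHS]eq_bigr do under eq_bigr do under eq_bigr do rewrite sumrB big_split /=.
under [LHS]eq_bigr do under eq_bigr do rewrite sumrB big_split /=.
under [LHS]eq_bigr do rewrite sumrB big_split /=.
rewrite sumrB big_split /=; congr (_ + _ - _).
- transitivity (\sum_x \sum_z M x x * (M z z)^*).
    apply: eq_bigr => x _; rewrite exchange_big; apply: eq_bigr => z _ /=.
    under eq_bigr do rewrite -mulr_suml pick1.
    by rewrite pick1.
  by rewrite conj_sum mulr_suml; apply: eq_bigr => x _; rewrite mulr_sumr.
- apply: eq_bigr => x _; apply: eq_bigr => y _.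
  under eq_bigr do rewrite -mulr_suml pick1.
  by rewrite pick1 sqnE'.
- apply: eq_bigr => x _.
  under eq_bigr do under eq_bigr do rewrite -!mulr_suml pick1.
  under eq_bigr do rewrite -mulr_suml pick1.
  by rewrite pick1 sqnE'.
Qed.

Lemma avg_phase_quad_le (M : X -> X -> C) :
  avg (fun t => sqn (\sum_x \sum_y (phase t x)^* * phase t y * M x y)) <=
  sqn (\sum_x M x x) + \sum_x \sum_y sqn (M x y).
Proof.
by rewrite avg_phase_quad gerBl sumr_ge0// => x _; exact: sqn_ge0.
Qed.

End Phases.

(** * Spectral theorem and Loewdin orthogonalisation *)

Section Spectral.
Variable R : realType.
Local Notation C := R[i].

Lemma sum_deltaC (K : pzSemiRingType) (I : finType) (i : I) (F : I -> K) :
  \sum_k (k == i)%:R * F k = F i.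
Proof.
rewrite (bigD1 i)//= eqxx mul1r big1 ?addr0// => k ki.
by rewrite (negbTE ki) mul0r.
Qed.

Lemma sum_delta (K : pzSemiRingType) (I : finType) (i : I) (F : I -> K) :
  \sum_k (i == k)%:R * F k = F i.
Proof. by under eq_bigr do rewrite eq_sym; exact: sum_deltaC. Qed.

Lemma psdP (I : finType) (A : op R I I) :
  psd A <-> forall v, inner v (applyop A v) = (complex.Re (inner v (applyop A v)))%:C
     /\ 0 <= complex.Re (inner v (applyop A v)).
Proof.
split=> h v; last by have [-> ?] := h v; rewrite ler0c.
have h0 := h v; split; first exact: ge0_rc.
by rewrite -ler0c -(ge0_rc h0).
Qed.

Lemma quad_form (I : finType) (A : op R I I) (v : vec R I) :
  inner v (applyop A v) = \sum_i \sum_j (v i)^* * A i j * v j.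
Proof.
by apply: eq_bigr => i _; rewrite mulr_sumr; apply: eq_bigr => j _; rewrite mulrA.
Qed.

(** Polarisation: the form is real at four vectors supported on [i] and [j], which forces the two
    entries to be conjugate. *)
Lemma psd_hermitian (I : finType) (A : op R I I) : psd A ->
  forall i j, A i j = (A j i)^*.
Proof.
move=> pA i j; pose v (x y : C) : vec R I := fun k => (k == i)%:R * x + (k == j)%:R * y.
have Q x y : inner (v x y) (applyop A (v x y)) =
    x^* * A i i * x + x^* * A i j * y + y^* * A j i * x + y^* * A j j * y.
  have app k : applyop A (v x y) k = A k i * x + A k j * y.
    rewrite /applyop /v.
    under eq_bigr => l _ do rewrite mulrDr !(mulrCA (A k l)).
    by rewrite big_split /= !sum_deltaC.
  rewrite /inner; under eq_bigr => k _ do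
    rewrite /v rmorphD !rmorphM /= !rmorph_nat app mulrDl -!mulrA.
  by rewrite big_split /= !sum_deltaC; ring.
have H x y : complex.Im (x^* * A i i * x + x^* * A i j * y + y^* * A j i * x + y^* * A j j * y) = 0.
  by rewrite -Q; have /psdP/(_ (v x y))[-> _] := pA.
have := H 1 0; have := H 0 1; have := H 1 1; have := H 1 'i%C.
rewrite !conj_def; case: (A i i) => a1 a2; case: (A i j) => b1 b2.
case: (A j i) => c1 c2; case: (A j j) => d1 d2 /=.
move=> h1 h2 h3 h4; apply/eqP; rewrite eq_complex /=; apply/andP.
by split; apply/eqP; lra.
Qed.

Lemma sum_enum_val (K : nmodType) (I : finType) (F : I -> K) :
  \sum_(k < #|I|) F (enum_val k) = \sum_x F x.
Proof.
by rewrite [RHS](reindex (@enum_val I I)) //; exact/onW_bij/enum_val_bij.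
Qed.

Definition mxop (I J : finType) (A : op R I J) : 'M[C]_(#|I|, #|J|) :=
  \matrix_(i, j) A (enum_val i) (enum_val j).

(** For a square matrix a left inverse is a right inverse. *)
Lemma isometry_adjoint (I : finType) (V : op R I I) : is_isometry V ->
  forall x y, \sum_k V x k * (V y k)^* = (x == y)%:R.
Proof.
move=> iV x y; pose M := mxop V; pose N : 'M[C]_#|I| := \matrix_(i, j) (M j i)^*.
have NM : N *m M = 1%:M.
  apply/matrixP => i j; rewrite !mxE.
  under eq_bigr do rewrite !mxE.
  rewrite (sum_enum_val (fun k => (V k (enum_val i))^* * V k (enum_val j))) iV.
  by rewrite /idop (inj_eq enum_val_inj).
have /matrixP/(_ (enum_rank x) (enum_rank y)) := mulmx1C NM.
rewrite !mxE; under eq_bigr do rewrite !mxE !enum_rankK.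
by rewrite (sum_enum_val (fun k => V x k * (V y k)^*)) (inj_eq enum_rank_inj).
Qed.

Lemma psd_spectral (I : finType) (A : op R I I) : psd A ->
  exists (V : op R I I) (lam : {ffun I -> R}), [/\ is_isometry V, forall k, 0 <= lam k
   & forall x y, A x y = \sum_k V x k * (lam k)%:C * (V y k)^*].
Proof.
move=> pA; pose M := mxop A.
have hM : M \is hermsymmx.
  apply/is_hermitianmxP; rewrite expr0 scale1r; apply/matrixP => i j.
  by rewrite !mxE; exact: psd_hermitian.
have uP := spectral_unitarymx M; set P := spectralmx M in uP.
have dec : M = invmx P *m diag_mx (spectral_diag M) *m P.
  exact/orthomx_spectralP/hermitian_normalmx.
have sreal := hermitian_spectral_diag_real hM.
pose V : op R I I := fun x k => (P (enum_rank k) (enum_rank x))^*.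
pose lam : {ffun I -> R} := [ffun k => complex.Re (spectral_diag M 0 (enum_rank k))].
have iV : is_isometry V.
  move=> j j'; rewrite /V /idop.
  have /matrixP/(_ (enum_rank j) (enum_rank j')) := unitarymxP uP.
  rewrite !mxE (inj_eq enum_rank_inj) => <-.
  rewrite -(sum_enum_val (fun i => (P (enum_rank j) (enum_rank i))^*^* *
      (P (enum_rank j') (enum_rank i))^*)).
  by apply: eq_bigr => k _; rewrite conjCK enum_valK !mxE.
have decV x y : A x y = \sum_k V x k * (lam k)%:C * (V y k)^*.
  have : A x y = M (enum_rank x) (enum_rank y) by rewrite mxE !enum_rankK.
  rewrite dec invmx_unitary// !mxE => ->.
  rewrite -[RHS]sum_enum_val; apply: eq_bigr => k _; rewrite /V conjCK ffunE enum_valK.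
  rewrite mxE; congr (_ * _); rewrite (bigD1 k) //= big1 ?addr0 => [|l lk]; last first.
    by rewrite !mxE (negbTE lk) mulr0n mulr0.
  rewrite !mxE eqxx mulr1n; congr (_ * _).
  have : spectral_diag M 0 k \is Num.real by exact: (mxOverP sreal).
  by move/RRe_real => ->.
(* [lam k] is the value of the form at the [k]-th eigenvector, hence nonnegative. *)
exists V, lam; split=> // k.
have /psdP/(_ (fun x => V x k))[_] := pA.
suff -> : inner (V^~ k) (applyop A (V^~ k)) = (lam k)%:C by [].
have -> : applyop A (V^~ k) = fun x => (lam k)%:C * V x k.
  apply/boolp.funext => x; rewrite /applyop.
  under eq_bigr do rewrite decV mulr_suml.
  rewrite exchange_big /=.
  transitivity (\sum_l (l == k)%:R * (V x l * (lam l)%:C)).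
    apply: eq_bigr => l _; under eq_bigr do rewrite -mulrA.
    by rewrite -mulr_sumr iV /idop mulrC.
  by rewrite sum_deltaC mulrC.
rewrite /inner; under eq_bigr do rewrite mulrCA.
by rewrite -mulr_sumr iV /idop eqxx mulr1.
Qed.

(** [spec] is a choice with a default value; the existence of a decomposition excludes the
    default. *)
Lemma psd_spectrum (I : finType) (A : op R I I) : psd A ->
  spectrum_of A (spec A).
Proof.
move=> /psd_spectral[V [lam [iV _ dec]]].
rewrite /spec; case: xgetP => [l -> //|/(_ lam)[]].
by exists V.
Qed.

Lemma nrm_isometry (I J : finType) (V : op R I J) (v : vec R J) :
  is_isometry V -> nrm (applyop V v) = nrm v.
Proof.
move=> iV; apply: rc_inj; rewrite -!innerE /inner /applyop.
transitivity (\sum_j \sum_k (v j)^* * v k * \sum_i (V i j)^* * V i k).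
  under [RHS]eq_bigr do under eq_bigr do rewrite mulr_sumr.
  under [RHS]eq_bigr do rewrite exchange_big.
  rewrite [RHS]exchange_big; apply: eq_bigr => i _ /=.
  rewrite conj_sum mulr_suml; apply: eq_bigr => j _.
  rewrite mulr_sumr; apply: eq_bigr => k _; rewrite rmorphM /=; ring.
apply: eq_bigr => j _; under eq_bigr do rewrite iV /idop mulrC.
by rewrite sum_delta.
Qed.

(** The adjoint of [W] is a contraction; equivalently, the rank-one operators on the columns of [W]
    sum to at most the identity, so they extend to a measurement. *)
Definition coisometric (Z J : finType) (W : op R Z J) :=
  forall v : vec R Z, nrm (fun j => \sum_z (W z j)^* * v z) <= nrm v.

(* Loewdin orthogonalisation: [W] is the partial isometry [c (c^* c)^(-1/2)], so
   that [W^* c] is the square root of the Gram matrix, which is estimated by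
   [sqrt x >= 3 x / 2 - x^2 / 2]. *)
Lemma lowdin (Z J : finType) (c : J -> vec R Z) :
  exists W : op R Z J, [/\ coisometric W,
    forall z, (forall j, c j z = 0) -> forall j, W z j = 0 &
    forall j, 3 / 2 * nrm (c j) - 2^-1 * (\sum_k sqn (inner (c j) (c k))) <=
      complex.Re (\sum_z (W z j)^* * c j z)].
Proof.
pose G : op R J J := fun j k => inner (c j) (c k).
have pG : psd G.
  move=> v; rewrite quad_form.
  suff -> : \sum_i \sum_j (v i)^* * G i j * v j = (nrm (fun z => \sum_j v j * c j z))%:C.
    by rewrite ler0c nrm_ge0.
  rewrite -innerE /inner /G.
  under eq_bigr do under eq_bigr do rewrite /inner mulrAC mulr_sumr.
  under eq_bigr do rewrite exchange_big.
  rewrite exchange_big; apply: eq_bigr => z _ /=; rewrite conj_sum mulr_suml.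
  apply: eq_bigr => i _; rewrite mulr_sumr; apply: eq_bigr => j _.
  by rewrite rmorphM /=; ring.
have [V [lam [iV lam0 dec]]] := psd_spectral pG.
have iV' := isometry_adjoint iV.
(* Combining the [c j] along eigenvectors of the Gram matrix makes them orthogonal, with squared
   norms [lam k]. *)
pose f k : vec R Z := fun z => \sum_j V j k * c j z.
have cf j z : c j z = \sum_l (V j l)^* * f l z.
  rewrite /f; under eq_bigr do rewrite mulr_sumr.
  rewrite exchange_big /=.
  transitivity (\sum_i (i == j)%:R * c i z); first by rewrite sum_deltaC.
  apply: eq_bigr => i _; rewrite -iV' mulr_suml.
  by apply: eq_bigr => l _; ring.
have ff k l : inner (f k) (f l) = (lam k)%:C *+ (k == l).
  transitivity (\sum_i \sum_j (V i k)^* * G i j * V j l).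
    rewrite /inner /G; under [RHS]eq_bigr do under eq_bigr do rewrite /inner mulrAC mulr_sumr.
    under [RHS]eq_bigr do rewrite exchange_big.
    rewrite [RHS]exchange_big; apply: eq_bigr => z _ /=; rewrite conj_sum mulr_suml.
    apply: eq_bigr => i _; rewrite mulr_sumr; apply: eq_bigr => j _.
    by rewrite rmorphM /=; ring.
  transitivity (\sum_m (k == m)%:R * ((lam m)%:C * (m == l)%:R)).
    have e m : (k == m)%:R * ((lam m)%:C * (m == l)%:R) =
        (\sum_i (V i k)^* * V i m) * (lam m)%:C * (\sum_i (V i m)^* * V i l).
      by rewrite !iV mulrA.
    under [RHS]eq_bigr do rewrite e mulr_suml mulr_suml.
    rewrite [RHS]exchange_big; apply: eq_bigr => i _ /=.
    under [RHS]eq_bigr do rewrite mulr_sumr.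
    rewrite [RHS]exchange_big; apply: eq_bigr => j _ /=.
    by rewrite dec mulr_sumr mulr_suml; apply: eq_bigr => m _; ring.
  by rewrite sum_delta mulr_natr.
(* Since [0^-1 = 0], this inverts the square root on the support of the Gram matrix only. *)
pose s k : R := (Num.sqrt (lam k))^-1.
have s2 k : s k ^+ 2 = (lam k)^-1 by rewrite /s exprVn sqr_sqrtr.
pose W : op R Z J := fun z j => \sum_k (s k)%:C * (V j k)^* * f k z.
have adj j (v : vec R Z) : \sum_z (W z j)^* * v z = \sum_k V j k * ((s k)%:C * inner (f k) v).
  rewrite /W; under eq_bigr do rewrite conj_sum mulr_suml.
  rewrite exchange_big; apply: eq_bigr => k _ /=; rewrite !mulr_sumr.
  by apply: eq_bigr => z _; rewrite !rmorphM /= conjCK conj_rc; ring.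
exists W; split=> [v|z cz0 j|j].
  under eq_fun do rewrite adj.
  rewrite -/(applyop V (fun k => (s k)%:C * inner (f k) v)) nrm_isometry//.
  apply: le_trans (bessel v ff); rewrite le_eqVlt; apply/orP; left; apply/eqP.
  by apply: eq_bigr => k _; rewrite sqnM sqn_rc s2 mulrC.
  rewrite /W big1// => k _; rewrite /f big1 ?mulr0// => i _.
  by rewrite cz0 mulr0.
have fc k : inner (f k) (c j) = (V j k)^* * (lam k)%:C.
  have -> : inner (f k) (c j) = \sum_l (V j l)^* * inner (f k) (f l).
    rewrite /inner; under [RHS]eq_bigr do rewrite mulr_sumr.
    rewrite exchange_big; apply: eq_bigr => z _ /=; rewrite cf mulr_sumr.
    by apply: eq_bigr => l _; ring.
  under eq_bigr do rewrite ff -mulr_natr mulrA mulrC.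
  by rewrite sum_delta.
have -> : complex.Re (\sum_z (W z j)^* * c j z) = \sum_k sqn (V j k) * Num.sqrt (lam k).
  rewrite adj -[RHS]Re_rc rc_sum; congr complex.Re; apply: eq_bigr => k _.
  rewrite fc rmorphM /= sqnE.
  have -> : (Num.sqrt (lam k))%:C = (s k)%:C * (lam k)%:C :> C.
    rewrite -rmorphM /=; congr (_%:C); rewrite /s -{3}(sqr_sqrtr (lam0 k)).
    have [->|h] := eqVneq (Num.sqrt (lam k)) 0; first by rewrite expr2 !mulr0.
    by rewrite expr2 mulKf.
  by ring.
have -> : nrm (c j) = \sum_k sqn (V j k) * lam k.
  apply: rc_inj; rewrite -innerE -/(G j j) dec rc_sum; apply: eq_bigr => k _.
  by rewrite rmorphM /= sqnE; ring.
have -> : \sum_k sqn (inner (c j) (c k)) = \sum_k sqn (V j k) * lam k ^+ 2.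
  transitivity (nrm (applyop V (fun l => (V j l)^* * (lam l)%:C))).
    rewrite /nrm; apply: eq_bigr => k _; rewrite -/(G j k) dec -sqn_conj conj_sum /applyop.
    by congr sqn; apply: eq_bigr => l _; rewrite !rmorphM /= conjCK conj_rc; ring.
  rewrite nrm_isometry//; apply: eq_bigr => k _.
  by rewrite sqnM sqn_conj sqn_rc.
rewrite !mulr_sumr -sumrB; apply: ler_sum => k _.
have sq0 := sqn_ge0 (V j k).
have := sqrtr_ge0 (lam k); have := sqr_sqrtr (lam0 k).
move: (Num.sqrt (lam k)) => r <- r0.
(* [r - 3/2 r^2 + 1/2 r^4] is one half of this product. *)
have : 0 <= r * ((r - 1) ^+ 2 * (r + 2)).
  by rewrite mulr_ge0// mulr_ge0 ?sqr_ge0//; lra.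
move=> h; have := mulr_ge0 sq0 h.
by rewrite -subr_ge0 => h2; rewrite -subr_ge0; nra.
Qed.

End Spectral.

(** * Tripartite pure states *)

Section Tripartite.
Variable R : realType.
Local Notation C := R[i].

Lemma sum_pair (K : nmodType) (A B : finType) (G : A * B -> K) :
  \sum_c G c = \sum_a \sum_b G (a, b).
Proof. by rewrite pair_bigA; apply: eq_bigr => -[]. Qed.

Lemma inner_pair (A B : finType) (u v : vec R (A * B)%type) :
  inner u v = \sum_a \sum_b (u (a, b))^* * v (a, b).
Proof. exact: sum_pair. Qed.

Lemma nrm_pair (A B : finType) (u : vec R (A * B)%type) :
  nrm u = \sum_a \sum_b sqn (u (a, b)).
Proof. exact: sum_pair. Qed.

(* A tripartite pure state, written in bases diagonalising its three marginals. *)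
Definition tripartite (X Y Z : finType) (T : X -> Y -> Z -> C)
    (p : X -> R) (q : Y -> R) (r : Z -> R) : Prop :=
  [/\ forall x x', inner (fun c : Y * Z => T x c.1 c.2) (fun c => T x' c.1 c.2)
        = (p x)%:C *+ (x == x'),
      forall y y', inner (fun c : X * Z => T c.1 y c.2) (fun c => T c.1 y' c.2)
        = (q y)%:C *+ (y == y'),
      forall z z', inner (fun c : X * Y => T c.1 c.2 z) (fun c => T c.1 c.2 z')
        = (r z)%:C *+ (z == z')
    & \sum_x p x = 1].

Section Theory.
Variables (X Y Z : finType) (T : X -> Y -> Z -> C) (p : X -> R) (q : Y -> R) (r : Z -> R).
Hypothesis tT : tripartite T p q r.

Lemma tri_p x : p x = \sum_y \sum_z sqn (T x y z).
Proof.
have [h _ _ _] := tT; apply: rc_inj; have := h x x; rewrite eqxx mulr1n => <-.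
by rewrite innerE /nrm pair_bigA.
Qed.

Lemma tri_q y : q y = \sum_x \sum_z sqn (T x y z).
Proof.
have [_ h _ _] := tT; apply: rc_inj; have := h y y; rewrite eqxx mulr1n => <-.
by rewrite innerE /nrm pair_bigA.
Qed.

Lemma tri_r z : r z = \sum_x \sum_y sqn (T x y z).
Proof.
have [_ _ h _] := tT; apply: rc_inj; have := h z z; rewrite eqxx mulr1n => <-.
by rewrite innerE /nrm pair_bigA.
Qed.

Lemma tri_p_ge0 x : 0 <= p x.
Proof. by rewrite tri_p; do 2 (apply: sumr_ge0 => ? _); exact: sqn_ge0. Qed.
Lemma tri_q_ge0 y : 0 <= q y.
Proof. by rewrite tri_q; do 2 (apply: sumr_ge0 => ? _); exact: sqn_ge0. Qed.
Lemma tri_r_ge0 z : 0 <= r z.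
Proof. by rewrite tri_r; do 2 (apply: sumr_ge0 => ? _); exact: sqn_ge0. Qed.

Lemma tri_sum_p : \sum_x p x = 1. Proof. by case: tT. Qed.

Lemma tri_total : \sum_x \sum_y \sum_z sqn (T x y z) = 1.
Proof. by rewrite -tri_sum_p; apply: eq_bigr => x _; rewrite tri_p. Qed.

Lemma tri_sum_q : \sum_y q y = 1.
Proof.
rewrite -tri_total exchange_big; apply: eq_bigr => y _; exact: tri_q.
Qed.

Lemma tri_sum_r : \sum_z r z = 1.
Proof.
rewrite -tri_total; under [RHS]eq_bigr do rewrite exchange_big.
rewrite exchange_big; apply: eq_bigr => z _; exact: tri_r.
Qed.

Lemma tri_q0 y : q y = 0 -> forall x z, T x y z = 0.
Proof.
rewrite tri_q => /eqP; rewrite psumr_eq0 => [/allP h x z|x _]; last first.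
  by apply: sumr_ge0 => ? _; exact: sqn_ge0.
have := h x; rewrite mem_index_enum => /(_ isT); rewrite psumr_eq0 => [/allP h2|? _]; last exact: sqn_ge0.
by have := h2 z; rewrite mem_index_enum => /(_ isT)/eqP/sqn_eq0.
Qed.

End Theory.

Lemma tripartite_rot (X Y Z : finType) (T : X -> Y -> Z -> C) p q r :
  tripartite T p q r -> tripartite (fun y z x => T x y z) q r p.
Proof.
move=> tT; have [hp hq hr _] := tT; split.
- move=> y y'; rewrite -hq !inner_pair.
  by rewrite exchange_big.
- move=> z z'; rewrite -hr !inner_pair.
  by rewrite exchange_big.
- by move=> x x'; rewrite -hp.
- exact: tri_sum_q tT.
Qed.

End Tripartite.

(** * Random codes identified by Charlie *)

(** Extends a sum over the phases of one message to all phases, so that averages over the whole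
    phase vector apply. *)
Lemma sum_block (K : pzSemiRingType) (X : finType) N (m : 'I_N) (w : ('I_N * X)%type -> K) (F : X -> K) :
  \sum_x w (m, x) * F x = \sum_a w a * ((a.1 == m)%:R * F a.2).
Proof.
transitivity (\sum_m' \sum_x w (m', x) * ((m' == m)%:R * F x)); last first.
  by rewrite (pair_bigA _ (fun m' x => w (m', x) * ((m' == m)%:R * F x))); apply: eq_bigr => -[].
rewrite [RHS](bigD1 m)//= [X in _ = _ + X]big1 ?addr0 => [|m' mm']; last first.
  by rewrite big1// => x _; rewrite (negbTE mm') mul0r mulr0.
by apply: eq_bigr => x _; rewrite eqxx mul1r.
Qed.

Lemma sum_block1 (K : pzSemiRingType) (X : finType) N (m : 'I_N) (F : X -> K) :
  \sum_(a : ('I_N * X)%type) (a.1 == m)%:R * F a.2 = \sum_x F x.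
Proof.
have := sum_block m (fun=> 1) F.
by under eq_bigr do rewrite mul1r; under [RHS]eq_bigr do rewrite mul1r; move=> <-.
Qed.

Section Codewords.
Variable R : realType.
Local Notation C := R[i].

Lemma sqr_nat_bool (K : pzSemiRingType) (b : bool) : (b%:R : K) * b%:R = b%:R.
Proof. by case: b; rewrite ?mulr1 ?mulr0. Qed.

Lemma sqn_bool (b : bool) : sqn (b%:R : C) = b%:R :> R.
Proof. by case: b; rewrite ?sqn1 ?sqn0. Qed.

Lemma conj_bool (b : bool) : (b%:R : C)^* = b%:R.
Proof. by rewrite rmorph_nat. Qed.

Variables (X Y Z : finType) (T : X -> Y -> Z -> C) (p : X -> R) (q : Y -> R) (r : Z -> R).
Hypothesis tT : tripartite T p q r.

Lemma superposition_nrm (w : X -> C) :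
  nrm (fun c : Y * Z => \sum_x w x * T x c.1 c.2) = \sum_x sqn (w x) * p x.
Proof.
apply: rc_inj; rewrite -innerE rc_sum.
have [h _ _ _] := tT.
transitivity (\sum_x \sum_x' (w x)^* * w x' *
   inner (fun c : Y * Z => T x c.1 c.2) (fun c => T x' c.1 c.2)).
  rewrite /inner; under [RHS]eq_bigr do under eq_bigr do rewrite mulr_sumr.
  under [RHS]eq_bigr do rewrite exchange_big.
  rewrite [RHS]exchange_big; apply: eq_bigr => c _ /=; rewrite conj_sum mulr_suml.
  apply: eq_bigr => x _; rewrite mulr_sumr; apply: eq_bigr => x' _.
  by rewrite rmorphM /=; ring.
apply: eq_bigr => x _; rewrite (bigD1 x)//= h eqxx mulr1n rmorphM /= sqnE.
rewrite big1 ?addr0// => x' xx'.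
by rewrite h eq_sym (negbTE xx') mulr0n mulr0.
Qed.

(** The vectors [T x] already have norm [sqrt (p x)]. Each message has its own block of phases,
    which makes the codewords independent. *)
Definition codeword (N : nat) (w : phases ('I_N * X)%type) (m : 'I_N) (y : Y) (z : Z) : C :=
  \sum_x phase R w (m, x) * T x y z.

Lemma codeword_nrm N (w : phases ('I_N * X)%type) m :
  nrm (fun c : Y * Z => codeword w m c.1 c.2) = 1.
Proof.
rewrite superposition_nrm -(tri_sum_p tT); apply: eq_bigr => x _.
by rewrite sqn_Re phase_norm mul1r.
Qed.

End Codewords.

Section Block1.
Variable R : realType.
Local Notation C := R[i].
Variables (X Y Z : finType) (T : X -> Y -> Z -> C) (p : X -> R) (q : Y -> R) (r : Z -> R).
Hypothesis tT : tripartite T p q r.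
Variables (N : nat) (TY : Y -> bool) (TZ : Z -> bool) (D rmax eta : R).
Hypothesis D0 : 0 <= D.
Hypothesis rmax0 : 0 <= rmax.
Hypothesis hD : forall y, TY y -> (q y)^-1 <= D.
Hypothesis hr : forall z, TZ z -> r z <= rmax.
Hypothesis heta : 1 - eta <= \sum_x \sum_y \sum_z (TY y)%:R * (TZ z)%:R * sqn (T x y z).

Let g y : R := (TY y)%:R * q y.
Let s y : R := (TY y)%:R * (Num.sqrt (q y))^-1.
(** Charlie's component of codeword [m] along Bob's eigenvector [y], rescaled by [q y ^ (-1/2)] and
    cut to the typical sets. On average these vectors are nearly orthonormal in [(m, y)] when
    [N * D * rmax] is small, that is, below the rate [S(C) - S(B)]. *)
Let c (w : phases ('I_N * X)%type) (k : 'I_N * Y) : vec R Z :=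
  fun z => (s k.2)%:C * ((TZ z)%:R * codeword T w k.1 k.2 z).
Let F (a : X * Y) : vec R Z := fun z => (TZ z)%:R * T a.1 a.2 z.
Let S y y' : C := \sum_x inner (F (x, y)) (F (x, y')).

Let q0 := tri_q_ge0 tT.

Let s2 y : s y ^+ 2 = (TY y)%:R * (q y)^-1.
Proof. by rewrite /s exprMn exprVn sqr_sqrtr// expr2 sqr_nat_bool. Qed.

Let g0 y : 0 <= g y.
Proof. by rewrite mulr_ge0. Qed.

Let gs y : 0 <= g y * s y ^+ 2 <= 1.
Proof.
rewrite mulr_ge0 ?g0 ?sqr_ge0//= s2 /g mulrACA sqr_nat_bool.
case: (TY y); rewrite ?mul1r ?mul0r//.
by have [->|h] := eqVneq (q y) 0; [rewrite mul0r|rewrite divff].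
Qed.

Let cE w k z : c w k z =
  \sum_a phase R w a * ((a.1 == k.1)%:R * ((s k.2)%:C * F (a.2, k.2) z)).
Proof.
rewrite /c /codeword !mulr_sumr.
rewrite -(sum_block k.1 (phase R w) (fun x => (s k.2)%:C * F (x, k.2) z)).
by apply: eq_bigr => x _; rewrite /F /=; ring.
Qed.

Let gram w k k' : inner (c w k) (c w k') =
  \sum_a \sum_b (phase R w a)^* * phase R w b *
    ((a.1 == k.1)%:R * (b.1 == k'.1)%:R * (s k.2 * s k'.2)%:C *
       inner (F (a.2, k.2)) (F (b.2, k'.2))).
Proof.
rewrite /inner; under [RHS]eq_bigr do under eq_bigr do rewrite !mulr_sumr.
under [RHS]eq_bigr do rewrite exchange_big.
rewrite [RHS]exchange_big; apply: eq_bigr => z _ /=.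
rewrite !cE conj_sum mulr_suml.
apply: eq_bigr => a _; rewrite mulr_sumr; apply: eq_bigr => b _.
by rewrite !rmorphM /= !conj_bool !conj_rc; ring.
Qed.

(** Mean overlap plus fluctuation. Different messages carry independent phases, so for them the mean
    overlap is absent. *)
Let gram_avg k k' : avg (fun w => sqn (inner (c w k) (c w k'))) <=
  (k.1 == k'.1)%:R * (s k.2 ^+ 2 * s k'.2 ^+ 2 * sqn (S k.2 k'.2)) +
  s k.2 ^+ 2 * s k'.2 ^+ 2 * \sum_x \sum_x' sqn (inner (F (x, k.2)) (F (x', k'.2))).
Proof.
under eq_avg do rewrite gram.
apply: le_trans (avg_phase_quad_le _) _; rewrite le_eqVlt; apply/orP; left; apply/eqP.
congr (_ + _).
  have -> : \sum_a ((a.1 == k.1)%:R * (a.1 == k'.1)%:R * (s k.2 * s k'.2)%:C *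
       inner (F (a.2, k.2)) (F (a.2, k'.2))) =
     (k.1 == k'.1)%:R * (s k.2 * s k'.2)%:C * S k.2 k'.2.
    move: (s k.2 * s k'.2)%:C => sg.
    have e (a : ('I_N * X)%type) :
        ((a.1 == k.1)%:R * (a.1 == k'.1)%:R : C) = (a.1 == k.1)%:R * (k.1 == k'.1)%:R.
      by case: eqP => [->|_]; rewrite ?mul0r.
    under eq_bigr do rewrite e -!mulrA.
    have /= -> := sum_block1 k.1 (fun x => (k.1 == k'.1)%:R * (sg *
       inner (F (x, k.2)) (F (x, k'.2)))); rewrite /S mulr_sumr.
    by apply: eq_bigr => x _; rewrite mulrA.
  by rewrite !sqnM sqn_bool sqn_rc exprMn mulrA.
rewrite mulr_sumr.
transitivity (\sum_a (\sum_b (a.1 == k.1)%:R * ((b.1 == k'.1)%:R *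
   (s k.2 ^+ 2 * s k'.2 ^+ 2 * sqn (inner (F (a.2, k.2)) (F (b.2, k'.2))))))).
  apply: eq_bigr => a _; apply: eq_bigr => b _.
  by rewrite !sqnM !sqn_bool sqn_rc exprMn -!mulrA.
under eq_bigr do rewrite -mulr_sumr.
have /= -> := sum_block1 k.1 (fun x => \sum_b (b.1 == k'.1)%:R *
   (s k.2 ^+ 2 * s k'.2 ^+ 2 * sqn (inner (F (x, k.2)) (F (b.2, k'.2))))).
apply: eq_bigr => x _; rewrite mulr_sumr.
exact: (sum_block1 k'.1 (fun x' => s k.2 ^+ 2 * s k'.2 ^+ 2 * sqn (inner (F (x, k.2)) (F (x', k'.2))))).
Qed.

(** Without the cutoff [TZ] the matrix [S] would be diagonal with entries [q y], and the sum would
    be 1. With it, Bessel's inequality for the orthogonal family [f] still gives at most [q y] for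
    each row. *)
Let diag_sum : \sum_y \sum_y' sqn (S y y') / q y' <= 1.
Proof.
rewrite -(tri_sum_q tT); apply: ler_sum => y _.
pose f y' : vec R (X * Z)%type := fun c => T c.1 y' c.2.
pose h : vec R (X * Z)%type := fun c => (TZ c.2)%:R * T c.1 y c.2.
have [_ ortho _ _] := tT.
apply: (@le_trans _ _ (nrm h)).
  apply: le_trans (bessel h ortho); rewrite le_eqVlt; apply/orP; left; apply/eqP.
  apply: eq_bigr => y' _; congr (_ / _); rewrite -[RHS]sqn_conj inner_conj; congr sqn.
  rewrite inner_pair /S; apply: eq_bigr => x _; apply: eq_bigr => z _.
  by rewrite /F /h /= !rmorphM /= conj_bool mulrACA sqr_nat_bool mulrA.
rewrite (tri_q tT) nrm_pair; apply: ler_sum => x _; apply: ler_sum => z _.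
by rewrite /h /= sqnM sqn_bool; case: (TZ z); rewrite ?mul1r ?mul0r ?sqn_ge0.
Qed.

(** [gram_swap] turns the sum into the purity of Charlie's truncated marginal. *)
Let swap_sum : \sum_y \sum_y' \sum_x \sum_x' sqn (inner (F (x, y)) (F (x', y'))) <= rmax.
Proof.
have -> : \sum_y \sum_y' \sum_x \sum_x' sqn (inner (F (x, y)) (F (x', y'))) =
    \sum_a \sum_b sqn (inner (F a) (F b)).
  under [LHS]eq_bigr do rewrite exchange_big.
  rewrite [LHS]exchange_big [RHS]sum_pair /=.
  apply: eq_bigr => x _; apply: eq_bigr => y _.
  by rewrite exchange_big sum_pair.
rewrite gram_swap.
have E z z' : \sum_a F a z * (F a z')^* = (TZ z)%:R * (TZ z')%:R * ((r z)%:C *+ (z == z')).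
  have [_ _ h _] := tT.
  have := h z' z; rewrite eq_sym => e.
  have -> : (r z)%:C *+ (z == z') = (r z')%:C *+ (z == z') :> C.
    by case: eqVneq => [->|].
  rewrite -e /inner mulr_sumr; apply: eq_bigr => a _.
  by rewrite /F rmorphM /= conj_bool; ring.
apply: (@le_trans _ _ (\sum_z rmax * r z)); last by rewrite -mulr_sumr (tri_sum_r tT) mulr1.
apply: ler_sum => z _; under eq_bigr do rewrite E.
rewrite (bigD1 z)//= big1 ?addr0 => [|z' zz']; last first.
  by rewrite eq_sym (negbTE zz') mulr0n mulr0 sqn0.
rewrite eqxx mulr1n sqr_nat_bool sqnM sqn_bool sqn_rc.
have r0 := tri_r_ge0 tT z.
case: (boolP (TZ z)) => [/hr rz|_]; last by rewrite mul0r mulr_ge0.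
by rewrite mul1r expr2 ler_wpM2r.
Qed.

Let nrm_avg m y : g y * avg (fun w => nrm (c w (m, y))) =
  \sum_x \sum_z (TY y)%:R * (TZ z)%:R * sqn (T x y z).
Proof.
have -> : avg (fun w => nrm (c w (m, y))) = s y ^+ 2 * \sum_x \sum_z (TZ z)%:R * sqn (T x y z).
  rewrite /nrm avg_sum exchange_big mulr_sumr; apply: eq_bigr => z _.
  under eq_avg do rewrite cE.
  rewrite avg_phase_sqn mulr_sumr /=.
  have /= <- := sum_block1 m (fun x => s y ^+ 2 * ((TZ z)%:R * sqn (T x y z))).
  by apply: eq_bigr => a _; rewrite /F !sqnM !sqn_bool sqn_rc.
rewrite mulrA; have [qy0|qy0] := eqVneq (q y) 0.
  rewrite !big1 ?mulr0// => x _; rewrite big1// => z _;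
  by rewrite (tri_q0 tT qy0) sqn0 !mulr0.
rewrite s2 /g mulrACA sqr_nat_bool divff// mulr1 mulr_sumr.
by apply: eq_bigr => x _; rewrite mulr_sumr; apply: eq_bigr => z _; rewrite mulrA.
Qed.

(** The term 1 is the mean overlap within message [m]. In the fluctuation [g y] cancels one of the
    two normalisations, and the other costs at most [D]. *)
Let gram_sum m : \sum_y g y * \sum_k avg (fun w => sqn (inner (c w (m, y)) (c w k)))
  <= 1 + N%:R * (D * rmax).
Proof.
pose b y y' := s y ^+ 2 * s y' ^+ 2 * \sum_x \sum_x' sqn (inner (F (x, y)) (F (x', y'))).
have b0 y y' : 0 <= \sum_x \sum_x' sqn (inner (F (x, y)) (F (x', y'))).
  by do 2 (apply: sumr_ge0 => ? _); exact: sqn_ge0.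
apply: (@le_trans _ _ (\sum_y g y * (\sum_y' (s y ^+ 2 * s y' ^+ 2 * sqn (S y y') + N%:R * b y y')))).
  apply: ler_sum => y _; apply: ler_wpM2l; first exact: g0.
  rewrite sum_pair exchange_big; apply: ler_sum => y' _ /=.
  apply: le_trans (ler_sum _ (fun m' _ => gram_avg (m, y) (m', y'))) _ => /=.
  rewrite big_split /= sumr_const card_ord -[_ *+ N]mulr_natl lerD2r.
  by under eq_bigr do rewrite eq_sym; rewrite sum_deltaC.
under eq_bigr do rewrite big_split mulrDr /=.
rewrite big_split lerD//=.
  apply: le_trans diag_sum; apply: ler_sum => y _; rewrite mulr_sumr; apply: ler_sum => y' _.
  have -> : g y * (s y ^+ 2 * s y' ^+ 2 * sqn (S y y')) =
     (g y * s y ^+ 2) * (s y' ^+ 2 * sqn (S y y')) by ring.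
  have /andP[h0 h1] := gs y.
  have s2' : s y' ^+ 2 * sqn (S y y') <= sqn (S y y') / q y'.
    rewrite s2 mulrC; case: (TY y'); rewrite ?mul1r// mul0r mulr0.
    by rewrite divr_ge0 ?sqn_ge0.
  apply: le_trans s2'.
  by rewrite ler_piMl// mulr_ge0 ?sqr_ge0 ?sqn_ge0.
apply: (@le_trans _ _ (\sum_y N%:R * (D * \sum_y' \sum_x \sum_x' sqn (inner (F (x, y)) (F (x', y')))))); last first.
  by rewrite -!mulr_sumr ler_wpM2l// ler_wpM2l// swap_sum.
apply: ler_sum => y _; rewrite -mulr_sumr mulrCA ler_wpM2l// !mulr_sumr; apply: ler_sum => y' _.
have -> : g y * b y y' = (g y * s y ^+ 2 * s y' ^+ 2) *
    \sum_x \sum_x' sqn (inner (F (x, y)) (F (x', y'))) by rewrite /b; ring.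
rewrite ler_wpM2r//.
have /andP[h0 h1] := gs y.
have s2' : s y' ^+ 2 <= D.
  by rewrite s2; case: (boolP (TY y')) => [/hD|_]; rewrite ?mul1r// mul0r.
by rewrite -[D]mul1r ler_pM// sqr_ge0.
Qed.

Lemma random_code_identifiable : (0 < N)%N -> exists (w : phases ('I_N * X)%type) (W : op R Z ('I_N * Y)%type),
  coisometric W /\ \sum_m nrm (fun a : (Y * ('I_N * Y))%type => \sum_z (W z a.2)^* * codeword T w m a.1 z
     - ((a.2 == (m, a.1))%:R * Num.sqrt ((TY a.1)%:R * q a.1))%:C)
   <= N%:R * (3 * eta + N%:R * D * rmax).
Proof.
move=> N0.
(* The squared distance of two vectors of norm at most 1 is at most 2 minus twice their overlap, and
   [lowdin] bounds the overlap below. The mean for each message is at most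
   [2 - 3 (1 - eta) + 1 + N D rmax]. *)
pose L w := \sum_m (2 - 2 * \sum_y g y * (3 / 2 * nrm (c w (m, y))
    - 2^-1 * \sum_k sqn (inner (c w (m, y)) (c w k)))).
have avgL : avg L <= N%:R * (3 * eta + N%:R * D * rmax).
  rewrite /L avg_sum.
  apply: (@le_trans _ _ (\sum_(m < N) (3 * eta + N%:R * D * rmax))); last first.
    by rewrite sumr_const card_ord -[_ *+ N]mulr_natl.
  apply: ler_sum => m _.
  rewrite avgB avg_const ?phases_gt0// avgZ avg_sum.
  have -> : \sum_y avg (fun w => g y * (3 / 2 * nrm (c w (m, y)) -
       2^-1 * \sum_k sqn (inner (c w (m, y)) (c w k)))) =
    3 / 2 * (\sum_y g y * avg (fun w => nrm (c w (m, y)))) -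
    2^-1 * \sum_y g y * \sum_k avg (fun w => sqn (inner (c w (m, y)) (c w k))).
    rewrite !mulr_sumr -sumrB; apply: eq_bigr => y _.
    by rewrite avgZ avgB !avgZ (avg_sum _ (fun k w => sqn (inner (c w (m, y)) (c w k)))); ring.
  have G := gram_sum m.
  have H : 1 - eta <= \sum_y g y * avg (fun w => nrm (c w (m, y))).
    under eq_bigr do rewrite nrm_avg.
    by rewrite exchange_big.
  by rewrite -[N%:R * D * rmax]mulrA; lra.
have [w hw] := avg_exists (phases_gt0 _) avgL.
have [W [W1 Wsupp Wre]] := lowdin (c w).
exists w, W; split=> //; apply: le_trans hw; apply: ler_sum => m _.
pose A y k := \sum_z (W z k)^* * codeword T w m y z.
have eA y k : sqn (A y k - ((k == (m, y))%:R * Num.sqrt (g y))%:C) =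
    sqn (A y k) + (k == (m, y))%:R * (g y - 2 * Num.sqrt (g y) * complex.Re (A y k)).
  rewrite sqnB sqn_rc [(A y k)^* * _]mulrC ReZ cRe_conj exprMn sqr_sqrtr ?g0// expr2 sqr_nat_bool.
  by ring.
rewrite nrm_pair.
under eq_bigr do under eq_bigr do rewrite /= eA.
under eq_bigr do rewrite big_split sum_deltaC /=.
rewrite big_split sumrB /=.
have h1 : \sum_y \sum_k sqn (A y k) <= 1.
  rewrite -(codeword_nrm tT w m) nrm_pair; apply: ler_sum => y _.
  exact: (W1 (codeword T w m y)).
have h2 : \sum_y g y <= 1.
  rewrite -(tri_sum_q tT); apply: ler_sum => y _.
  by rewrite /g; case: (TY y); rewrite ?mul1r// mul0r.
have h3 : \sum_y g y * (3 / 2 * nrm (c w (m, y))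
    - 2^-1 * \sum_k sqn (inner (c w (m, y)) (c w k))) <=
   \sum_y Num.sqrt (g y) * complex.Re (A y (m, y)).
  apply: ler_sum => y _.
  apply: le_trans (ler_wpM2l (g0 y) (Wre (m, y))) _.
  have -> : \sum_z (W z (m, y))^* * c w (m, y) z = (s y)%:C * A y (m, y).
    rewrite /A mulr_sumr; apply: eq_bigr => z _; rewrite /c /=.
    (* Off [TZ] every vector of [c w] vanishes, hence so does [W], and the cutoff can be removed
       from the overlap. *)
    case: (boolP (TZ z)) => [_|tz]; first by rewrite mul1r mulrCA.
    rewrite Wsupp ?rmorph0 ?mul0r ?mulr0// => j.
    by rewrite /c (negbTE tz) mul0r mulr0.
  rewrite ReZ mulrA le_eqVlt; apply/orP; left; apply/eqP; congr (_ * _).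
  rewrite /g /s; case: (TY y); rewrite ?mul1r ?mul0r ?sqrtr0//.
  rewrite -{1}(sqr_sqrtr (q0 y)).
  have [->|h] := eqVneq (Num.sqrt (q y)) 0; first by rewrite invr0 mulr0.
  by rewrite expr2 mulfK.
have -> : \sum_y 2 * Num.sqrt (g y) * complex.Re (A y (m, y)) =
   2 * \sum_y Num.sqrt (g y) * complex.Re (A y (m, y)).
  by rewrite mulr_sumr; apply: eq_bigr => y _; rewrite mulrA.
lra.
Qed.

End Block1.

(** * Random codes decoded by Bob *)

Section Block2.
Variable R : realType.
Local Notation C := R[i].

Lemma sqn_avg_le (T : finType) (F : T -> C) : (0 < #|T|)%N ->
  sqn (avg F) <= avg (fun t => sqn (F t)).
Proof.
move=> T0; have := avg_ge0 (fun t => sqn_ge0 (F t - avg F)).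
under eq_avg do rewrite sqnB.
rewrite avgB avgD avg_const// avgZ -Re_avg avgZr.
have -> : avg (fun t => (F t)^*) = (avg F)^*.
  by rewrite /avg rmorphM /= conj_sum fmorphV rmorph_nat.
by rewrite -sqn_Re; lra.
Qed.

(** [|u|^2 >= 2 Re u - 1] makes the bound linear in the amplitude; Young's inequality with weight
    [t] then absorbs [w]. *)
Lemma sqn_add_ge (z w : C) (t : R) : 0 < t ->
  2 * complex.Re z - 1 - t - sqn w / t <= sqn (z + w).
Proof.
move=> t0; have h1 := Re_sq_le (z + w); have h2 := Re_sq_le w.
have h3 : - t - sqn w / t <= 2 * complex.Re w.
  rewrite -subr_ge0.
  have -> : 2 * complex.Re w - (- t - sqn w / t) =
    ((t + complex.Re w) ^+ 2 + (sqn w - complex.Re w ^+ 2)) / t by field; lra.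
  by rewrite divr_ge0 ?(ltW t0)// addr_ge0 ?sqr_ge0// subr_ge0.
have h4 := sqr_ge0 (complex.Re (z + w) - 1); rewrite ReD in h1 h4; nra.
Qed.

Variables (X Y Z : finType) (T : X -> Y -> Z -> C) (p : X -> R) (q : Y -> R) (r : Z -> R).
Hypothesis tT : tripartite T p q r.
Variables (V : finType) (g : V -> R) (N : nat) (TX : X -> bool) (TY : Y -> bool).
Variables (pmax qmax gmax eta etag t : R).
Hypothesis g0 : forall v, 0 <= g v.
Hypothesis g1 : \sum_v g v <= 1.
Hypothesis geta : 1 - etag <= \sum_v g v.
Hypothesis ggmax : forall v, g v <= gmax.
Hypothesis gmax1 : 0 <= gmax <= 1.
Hypothesis pmax0 : 0 <= pmax.
Hypothesis qmax0 : 0 <= qmax.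
Hypothesis t0 : 0 < t.
Hypothesis hp : forall x, TX x -> p x <= pmax.
Hypothesis hq : forall y, TY y -> q y <= qmax.
Hypothesis heta : 1 - eta <= \sum_x \sum_y \sum_z (TX x && TY y)%:R * sqn (T x y z).

(* Bob's unnormalised state when Charlie, holding [\sum_v sqrt (g v) |v>|v>] with
   Bob together with his share of [phi], obtains the phase vector [th]. *)
Definition steered (phi : Y -> Z -> C) (th : phases (V * Z)%type) : vec R (V * Y)%type :=
  fun a => \sum_c (phase R th (a.1, c))^* * ((Num.sqrt (g a.1))%:C * phi a.2 c).

Let Tt x y z : C := (TX x && TY y)%:R * T x y z.
Let Tn x y z : C := (~~ (TX x && TY y))%:R * T x y z.
Let P := \sum_x \sum_y \sum_z (TX x && TY y)%:R * sqn (T x y z).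

Lemma steered_nrm (phi : Y -> Z -> C) :
  avg (fun th => nrm (steered phi th)) = (\sum_v g v) * \sum_y \sum_c sqn (phi y c).
Proof.
rewrite /nrm avg_sum sum_pair mulr_suml; apply: eq_bigr => v _.
rewrite mulr_sumr; apply: eq_bigr => y _.
transitivity (\sum_(a : V * Z) sqn ((a.1 == v)%:R * ((Num.sqrt (g v))%:C * phi y a.2))).
  rewrite -(avg_phase_sqnC (fun a => (a.1 == v)%:R * ((Num.sqrt (g v))%:C * phi y a.2))).
  apply: eq_avg => th; congr sqn; rewrite /steered /= [RHS]sum_pair.
  under [RHS]eq_bigr do under eq_bigr do rewrite /= mulrCA.
  under [RHS]eq_bigr do rewrite -mulr_sumr.
  by rewrite sum_deltaC.
rewrite sum_pair (bigD1 v)//= [X in _ + X]big1 ?addr0 => [|v' vv']; last first.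
  by rewrite big1// => c _; rewrite (negbTE vv') mul0r sqn0.
by rewrite mulr_sumr; apply: eq_bigr => c _; rewrite eqxx mul1r sqnM sqn_rc sqr_sqrtr.
Qed.

(** The cross marginal of two states on Charlie's side; its trace is their inner product. *)
Let H (phi psi : Y -> Z -> C) c c' := \sum_y (phi y c)^* * psi y c'.

(** The entanglement enters the trace through [sum g <= 1] and the Hilbert-Schmidt norm through
    [sum g^2 <= gmax], so it reduces only the second term. *)
Lemma steered_gram (phi psi : Y -> Z -> C) :
  avg (fun th => sqn (inner (steered phi th) (steered psi th))) <=
  sqn (\sum_c H phi psi c c) +
  gmax * (\sum_c \sum_c' sqn (H phi psi c c') - \sum_c sqn (H phi psi c c)).
Proof.
pose M (a b : V * Z) : C := (a.1 == b.1)%:R * (g a.1)%:C * H phi psi b.2 a.2.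
have -> : avg (fun th => sqn (inner (steered phi th) (steered psi th))) =
   avg (fun th => sqn (\sum_a \sum_b (phase R th a)^* * phase R th b * M a b)).
  apply: eq_avg => th; congr sqn.
  rewrite [RHS]sum_pair inner_pair; apply: eq_bigr => v _.
  transitivity (\sum_c' \sum_c (phase R th (v, c'))^* * phase R th (v, c) *
      ((g v)%:C * H phi psi c c')).
    have gv : (g v)%:C = (Num.sqrt (g v))%:C * (Num.sqrt (g v))%:C :> C.
      by rewrite -rmorphM /= -expr2 sqr_sqrtr.
    rewrite /H; under [RHS]eq_bigr do under eq_bigr do rewrite !mulr_sumr.
    under [RHS]eq_bigr do rewrite exchange_big /=.
    rewrite [RHS]exchange_big; apply: eq_bigr => y _ /=.
    rewrite /steered /= conj_sum mulr_suml [RHS]exchange_big; apply: eq_bigr => c _ /=.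
    rewrite mulr_sumr; apply: eq_bigr => c' _.
    by rewrite !rmorphM /= conjCK conj_rc gv; ring.
  apply: eq_bigr => c' _; rewrite [RHS]sum_pair.
  rewrite [RHS](bigD1 v)//= [X in _ = _ + X]big1 ?addr0 => [|v' vv']; last first.
    by rewrite big1// => c _; rewrite /M /= eq_sym (negbTE vv') !mul0r mulr0.
  by apply: eq_bigr => c _; rewrite /M /= eqxx mul1r.
rewrite avg_phase_quad.
have g2 : \sum_v g v ^+ 2 <= gmax.
  have /andP[gm0 _] := gmax1.
  apply: (@le_trans _ _ (gmax * \sum_v g v)); last by rewrite ler_piMr.
  by rewrite mulr_sumr; apply: ler_sum => v _; rewrite expr2 ler_wpM2r.
have S0 : 0 <= \sum_c \sum_c' sqn (H phi psi c c') - \sum_c sqn (H phi psi c c).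
  rewrite -sumrB sumr_ge0// => c _; rewrite (bigD1 c)//= addrAC subrr add0r sumr_ge0// => ? _.
  exact: sqn_ge0.
have -> : \sum_a M a a = (\sum_v g v)%:C * \sum_c H phi psi c c.
  rewrite sum_pair rc_sum mulr_suml; apply: eq_bigr => v _.
  by rewrite mulr_sumr; apply: eq_bigr => c _; rewrite /M eqxx mul1r.
have -> : \sum_a \sum_b sqn (M a b) = (\sum_v g v ^+ 2) * \sum_c \sum_c' sqn (H phi psi c c').
  rewrite sum_pair mulr_suml; apply: eq_bigr => v _.
  rewrite [in RHS]exchange_big mulr_sumr; apply: eq_bigr => c _.
  transitivity (\sum_v' (v == v')%:R * \sum_c' (g v ^+ 2 * sqn (H phi psi c' c))).
    rewrite sum_pair; apply: eq_bigr => v' _; rewrite mulr_sumr; apply: eq_bigr => c' _.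
    by rewrite /M /= !sqnM sqn_bool sqn_rc mulrA.
  by rewrite sum_delta mulr_sumr.
have -> : \sum_a sqn (M a a) = (\sum_v g v ^+ 2) * \sum_c sqn (H phi psi c c).
  rewrite sum_pair mulr_suml; apply: eq_bigr => v _.
  rewrite mulr_sumr; apply: eq_bigr => c _.
  by rewrite /M /= !sqnM sqn_bool eqxx mul1r sqn_rc.
rewrite sqnM sqn_rc -addrA -mulrBr lerD//.
  rewrite ler_piMl ?sqn_ge0// expr_le1// sumr_ge0//.
by rewrite ler_wpM2r.
Qed.

Let K x x' c c' := \sum_y (Tt x y c)^* * Tt x' y c'.

Let phi (w : phases ('I_N * X)%type) i y z := codeword Tt w i y z.
Let del (w : phases ('I_N * X)%type) i y z := codeword Tn w i y z.

Let HE w i j c c' : H (phi w i) (phi w j) c c' =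
  \sum_a \sum_b (phase R w a)^* * phase R w b * ((a.1 == i)%:R * ((b.1 == j)%:R * K a.2 b.2 c c')).
Proof.
rewrite /H /phi /codeword.
under eq_bigr do rewrite (sum_block i (phase R w)) (sum_block j (phase R w)).
rewrite /K; under [RHS]eq_bigr do under eq_bigr do rewrite !mulr_sumr.
under [RHS]eq_bigr do rewrite exchange_big /=.
rewrite [RHS]exchange_big; apply: eq_bigr => y _ /=; rewrite conj_sum mulr_suml.
apply: eq_bigr => a _; rewrite mulr_sumr; apply: eq_bigr => b _.
by rewrite !rmorphM /= conj_bool; ring.
Qed.

Let block_tr i j (F : X -> X -> C) :
  \sum_(a : ('I_N * X)%type) ((a.1 == i)%:R * ((a.1 == j)%:R * F a.2 a.2)) = (i == j)%:R * \sum_x F x x :> C.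
Proof.
have e (a : ('I_N * X)%type) : (a.1 == i)%:R * ((a.1 == j)%:R * F a.2 a.2) =
    (a.1 == i)%:R * ((i == j)%:R * F a.2 a.2).
  by case: eqP => [->|_]; rewrite ?mul0r.
under eq_bigr do rewrite e.
by have /= -> := sum_block1 i (fun x => (i == j)%:R * F x x); rewrite mulr_sumr.
Qed.

Let block_sqn (i j : 'I_N) (F : X -> X -> C) :
  \sum_(a : ('I_N * X)%type) \sum_(b : ('I_N * X)%type)
    sqn ((a.1 == i)%:R * ((b.1 == j)%:R * F a.2 b.2)) = \sum_x \sum_x' sqn (F x x').
Proof.
under eq_bigr do under eq_bigr do rewrite !sqnM !sqn_bool.
under eq_bigr do rewrite -mulr_sumr.
have /= -> := sum_block1 i (fun x => \sum_(b : ('I_N * X)%type) (b.1 == j)%:R * sqn (F x b.2)).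
by apply: eq_bigr => x _; have /= -> := sum_block1 j (fun x' => sqn (F x x')).
Qed.

Let H_avg i j c c' : avg (fun w => sqn (H (phi w i) (phi w j) c c')) <=
  (i == j)%:R * sqn (\sum_x K x x c c') + \sum_x \sum_x' sqn (K x x' c c').
Proof.
under eq_avg do rewrite HE.
apply: le_trans (avg_phase_quad_le _) _.
by rewrite (block_sqn i j (fun x x' => K x x' c c')) (block_tr i j (fun x x' => K x x' c c')) sqnM sqn_bool.
Qed.

Let trH_avg i j : avg (fun w => sqn (\sum_c H (phi w i) (phi w j) c c)) <=
  (i == j)%:R * sqn (\sum_x \sum_c K x x c c) + \sum_x \sum_x' sqn (\sum_c K x x' c c).
Proof.
have -> : avg (fun w => sqn (\sum_c H (phi w i) (phi w j) c c)) =
  avg (fun w => sqn (\sum_a \sum_b (phase R w a)^* * phase R w b *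
    ((a.1 == i)%:R * ((b.1 == j)%:R * \sum_c K a.2 b.2 c c)))).
  apply: eq_avg => w; congr sqn; under eq_bigr do rewrite HE.
  rewrite exchange_big; apply: eq_bigr => a _ /=; rewrite exchange_big.
  by apply: eq_bigr => b _ /=; rewrite !mulr_sumr.
apply: le_trans (avg_phase_quad_le _) _.
rewrite (block_tr i j (fun x x' => \sum_c K x x' c c)).
by rewrite (block_sqn i j (fun x x' => \sum_c K x x' c c)) sqnM sqn_bool.
Qed.

Let codeword_avg (T' : X -> Y -> Z -> C) i y z :
  avg (fun w : phases ('I_N * X)%type => sqn (codeword T' w i y z)) = \sum_x sqn (T' x y z).
Proof.
rewrite /codeword; under eq_avg do rewrite (sum_block i (phase R _)).
rewrite avg_phase_sqn; under eq_bigr do rewrite sqnM sqn_bool.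
by have /= -> := sum_block1 i (fun x => sqn (T' x y z)).
Qed.

Let codeword_total (T' : X -> Y -> Z -> C) i :
  \sum_y \sum_c avg (fun w : phases ('I_N * X)%type => sqn (codeword T' w i y c)) =
  \sum_x \sum_y \sum_z sqn (T' x y z).
Proof.
under eq_bigr do under eq_bigr do rewrite codeword_avg.
under eq_bigr do rewrite exchange_big.
by rewrite exchange_big.
Qed.

Let sqnTt x y z : sqn (Tt x y z) = (TX x && TY y)%:R * sqn (T x y z).
Proof. by rewrite /Tt sqnM sqn_bool. Qed.

Let sqnTn x y z : sqn (Tn x y z) = (~~ (TX x && TY y))%:R * sqn (T x y z).
Proof. by rewrite /Tn sqnM sqn_bool. Qed.

Let P_Tn : \sum_x \sum_y \sum_z sqn (Tn x y z) = 1 - P.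
Proof.
apply/eqP; rewrite eq_sym subr_eq -(tri_total tT) /P -big_split; apply/eqP/eq_bigr => x _ /=.
rewrite -big_split; apply: eq_bigr => y _ /=; rewrite -big_split; apply: eq_bigr => z _ /=.
by rewrite sqnTn; case: (TX x && TY y); rewrite /= ?mul0r ?mul1r ?add0r ?addr0.
Qed.

Let P1 : P <= 1.
Proof.
rewrite -subr_ge0 -P_Tn; do 3 (apply: sumr_ge0 => ? _); exact: sqn_ge0.
Qed.

(** The cutoff [TY] destroys the orthogonality of the [T x]. Bessel's inequality against the
    untruncated family restores the bound, at the price of the factor [p x' <= pmax] granted by
    [TX]. *)
Let tr_bound : \sum_x \sum_x' sqn (\sum_c K x x' c c) <= pmax.
Proof.
have [ortho _ _ _] := tT.
pose f x : vec R (Y * Z)%type := fun a => T x a.1 a.2.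
pose h x : vec R (Y * Z)%type := fun a => Tt x a.1 a.2.
have e x x' : \sum_c K x x' c c = (TX x')%:R * (inner (f x') (h x))^*.
  rewrite inner_conj inner_pair exchange_big mulr_sumr; apply: eq_bigr => y _.
  rewrite mulr_sumr; apply: eq_bigr => c _; rewrite /h /f /Tt /= !rmorphM /= !conj_bool.
  by case: (TX x); case: (TX x'); case: (TY y); rewrite /= ?(mul0r, mulr0, mul1r).
have le1 x x' : sqn (\sum_c K x x' c c) <= pmax * (sqn (inner (f x') (h x)) / p x').
  rewrite e sqnM sqn_bool sqn_conj.
  case: (boolP (TX x')) => [/hp le|_]; last first.
    by rewrite mul0r mulr_ge0// divr_ge0 ?sqn_ge0 ?(tri_p_ge0 tT).
  rewrite mul1r; have [px0|px0] := eqVneq (p x') 0.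
    rewrite px0 invr0 !mulr0; apply: le_trans (cauchy_schwarz _ _) _.
    suff -> : nrm (f x') = 0 by rewrite mul0r.
    by apply: rc_inj; rewrite -innerE ortho eqxx px0.
  rewrite -{1}[sqn _](mulfVK px0) mulrC ler_wpM2r// divr_ge0 ?sqn_ge0 ?(tri_p_ge0 tT)//.
apply: (@le_trans _ _ (\sum_x pmax * p x)); last by rewrite -mulr_sumr (tri_sum_p tT) mulr1.
apply: ler_sum => x _; apply: le_trans (ler_sum _ (fun x' _ => le1 x x')) _.
rewrite -mulr_sumr ler_wpM2l//; apply: le_trans (bessel (h x) ortho) _.
rewrite nrm_pair (tri_p tT); apply: ler_sum => y _; apply: ler_sum => z _.
by rewrite /h /= sqnTt; case: (_ && _); rewrite ?mul1r ?mul0r ?sqn_ge0.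
Qed.

(** Removing the cutoff [TX] only enlarges the terms; [gram_swap] then gives the purity of Bob's
    truncated marginal. *)
Let swap_bound : \sum_c \sum_c' \sum_x \sum_x' sqn (K x x' c c') <= qmax.
Proof.
pose F (a : X * Z) : vec R Y := fun y => (TY y)%:R * T a.1 y a.2.
have le1 x x' c c' : sqn (K x x' c c') <= sqn (inner (F (x, c)) (F (x', c'))).
  have -> : K x x' c c' = (TX x)%:R * (TX x')%:R * inner (F (x, c)) (F (x', c')).
    rewrite mulr_sumr; apply: eq_bigr => y _; rewrite /F /Tt /= !rmorphM /= !conj_bool.
    by case: (TX x); case: (TX x'); case: (TY y); rewrite /= ?(mul0r, mulr0, mul1r).
  by rewrite !sqnM !sqn_bool; case: (TX x); case: (TX x'); rewrite ?(mul0r, mulr0, mul1r) ?sqn_ge0.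
apply: (@le_trans _ _ (\sum_a \sum_b sqn (inner (F a) (F b)))).
  under eq_bigr do rewrite exchange_big.
  rewrite exchange_big [leRHS]sum_pair; apply: ler_sum => x _ /=; apply: ler_sum => c _.
  rewrite exchange_big sum_pair; apply: ler_sum => x' _; apply: ler_sum => c' _ /=.
  exact: le1.
rewrite gram_swap.
have E y y' : \sum_a F a y * (F a y')^* = (TY y)%:R * (TY y')%:R * ((q y)%:C *+ (y == y')).
  have [_ h _ _] := tT.
  have := h y' y; rewrite eq_sym => e.
  have -> : (q y)%:C *+ (y == y') = (q y')%:C *+ (y == y') :> C.
    by case: eqVneq => [->|].
  rewrite -e /inner mulr_sumr; apply: eq_bigr => a _.
  by rewrite /F rmorphM /= conj_bool; ring.
apply: (@le_trans _ _ (\sum_y qmax * q y)); last by rewrite -mulr_sumr (tri_sum_q tT) mulr1.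
apply: ler_sum => y _; under eq_bigr do rewrite E.
rewrite (bigD1 y)//= big1 ?addr0 => [|y' yy']; last first.
  by rewrite eq_sym (negbTE yy') mulr0n mulr0 sqn0.
rewrite eqxx mulr1n sqr_nat_bool sqnM sqn_bool sqn_rc.
have r0 := tri_q_ge0 tT y.
case: (boolP (TY y)) => [/hq rz|_]; last by rewrite mul0r mulr_ge0.
by rewrite mul1r expr2 ler_wpM2r.
Qed.

Let rho c c' := \sum_x K x x c c'.

(* [rho] differs from a diagonal matrix by a positive one of trace at most [eta]. *)
Let offdiag : \sum_c \sum_c' sqn (rho c c') - \sum_c sqn (rho c c) <= eta ^+ 2.
Proof.
pose n c : vec R (X * Y)%type := fun a => Tn a.1 a.2 c.
have e c c' : c' != c -> sqn (rho c c') <= nrm (n c) * nrm (n c').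
  move=> cc'; suff -> : rho c c' = - inner (n c) (n c') by rewrite sqnN cauchy_schwarz.
  have [_ _ h _] := tT; have := h c c'; rewrite eq_sym (negbTE cc') mulr0n.
  move=> e0; apply/eqP; rewrite -addr_eq0 -e0 !inner_pair -big_split; apply/eqP/eq_bigr => x _ /=.
  rewrite -big_split; apply: eq_bigr => y _; rewrite /n /Tt /Tn /= !rmorphM /= !conj_bool.
  by case: (TX x && TY y); rewrite /= ?(mul0r, mul1r, mulr0, add0r, addr0).
have sn : \sum_c nrm (n c) = 1 - P.
  rewrite -P_Tn; under [RHS]eq_bigr do rewrite exchange_big.
  rewrite [RHS]exchange_big; apply: eq_bigr => c _; exact: nrm_pair.
apply: (@le_trans _ _ ((1 - P) ^+ 2)); last first.
  by rewrite ler_sqr ?nnegrE ?subr_ge0//; move: heta P1; rewrite -/P; lra.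
rewrite expr2 -{1}sn mulr_suml -sumrB; apply: ler_sum => c _.
rewrite -sn mulr_sumr (bigD1 c)//= addrAC subrr add0r [leRHS](bigD1 c)//=.
rewrite -[leLHS]add0r lerD ?mulr_ge0 ?nrm_ge0// ler_sum// => c' cc'.
exact: e.
Qed.

Let phi_nrm_le w i : \sum_y \sum_c sqn (phi w i y c) <= 1.
Proof.
apply: (@le_trans _ _ (nrm (fun a : Y * Z => \sum_x (phase R w (i, x) * (TX x)%:R) * T x a.1 a.2))).
  rewrite nrm_pair; apply: ler_sum => y _; apply: ler_sum => z _ /=.
  have -> : phi w i y z = (TY y)%:R * \sum_x (phase R w (i, x) * (TX x)%:R) * T x y z.
    rewrite mulr_sumr; apply: eq_bigr => x _; rewrite /Tt.
    by case: (TX x); case: (TY y); rewrite /= ?(mul0r, mulr0, mul1r, mulr1).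
  by rewrite sqnM sqn_bool; case: (TY y); rewrite ?mul1r ?mul0r ?sqn_ge0.
rewrite (superposition_nrm tT) -(tri_sum_p tT); apply: ler_sum => x _.
rewrite sqnM sqn_bool [sqn _]sqn_Re phase_norm mul1r.
by case: (TX x); rewrite ?mul1r ?mul0r// (tri_p_ge0 tT).
Qed.

Let gram_bound i j : avg (fun w => sqn (\sum_c H (phi w i) (phi w j) c c) +
  gmax * (\sum_c \sum_c' sqn (H (phi w i) (phi w j) c c') - \sum_c sqn (H (phi w i) (phi w j) c c)))
  <= (i == j)%:R * (1 + gmax * eta ^+ 2) + (pmax + gmax * qmax).
Proof.
have /andP[gm0 _] := gmax1.
rewrite avgD avgZ avgB avg_sum (avg_sum _ (fun c w => sqn (H (phi w i) (phi w j) c c))).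
under [X in gmax * (X - _)]eq_bigr do rewrite avg_sum.
set A := avg _; set B := \sum_c \sum_c' _; set D := \sum_c avg _.
have D0 : 0 <= D by apply: sumr_ge0 => c _; apply: avg_ge0 => w; exact: sqn_ge0.
have hB : B <= (i == j)%:R * (\sum_c \sum_c' sqn (rho c c')) + qmax.
  apply: (@le_trans _ _ (\sum_c \sum_c' ((i == j)%:R * sqn (rho c c') + \sum_x \sum_x' sqn (K x x' c c')))).
    by apply: ler_sum => c _; apply: ler_sum => c' _; exact: H_avg.
  under eq_bigr do rewrite big_split -mulr_sumr.
  by rewrite big_split -mulr_sumr lerD2l swap_bound.
have [ij|ij] := eqVneq i j; last first.
  rewrite (negbTE ij) mul0r add0r in hB; rewrite mul0r add0r lerD//.
    apply: le_trans (trH_avg i j) _.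
    by rewrite (negbTE ij) mul0r add0r tr_bound.
  by rewrite ler_wpM2l//; lra.
subst j; rewrite eqxx !mul1r in hB *.
have hA : A <= 1.
  rewrite -(avg_const (1 : R) (phases_gt0 ('I_N * X)%type)); apply: ler_avg => w.
  have -> : \sum_c H (phi w i) (phi w i) c c = (\sum_y \sum_c sqn (phi w i y c))%:C.
    rewrite exchange_big rc_sum; apply: eq_bigr => c _; rewrite rc_sum; apply: eq_bigr => y _.
    by rewrite sqnE.
  rewrite sqn_rc expr_le1// ?phi_nrm_le//.
  by do 2 (apply: sumr_ge0 => ? _); exact: sqn_ge0.
have hD : \sum_c sqn (rho c c) <= D.
  apply: ler_sum => c _; apply: le_trans (sqn_avg_le _ (phases_gt0 _)).
  rewrite le_eqVlt; apply/orP; left; apply/eqP; congr sqn.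
  have -> : avg (fun w => H (phi w i) (phi w i) c c) = (\sum_y \sum_x sqn (Tt x y c))%:C.
    under [X in X%:C]eq_bigr do rewrite -(codeword_avg Tt i).
    rewrite -avg_sum rc_avg; apply: eq_avg => w; rewrite rc_sum; apply: eq_bigr => y _.
    by rewrite sqnE.
  rewrite exchange_big rc_sum; apply: eq_bigr => x _; rewrite rc_sum; apply: eq_bigr => y _.
  by rewrite sqnE.
have hO := offdiag.
have hh : gmax * (B - D) <= gmax * eta ^+ 2 + gmax * qmax.
  by rewrite -mulrDr; apply: ler_wpM2l => //; lra.
have pm := pmax0; lra.
Qed.

Lemma random_code_decodable : (0 < N)%N ->
  exists (w : phases ('I_N * X)%type) (W : phases (V * Z)%type -> op R (V * Y)%type 'I_N),
  (forall th, coisometric (W th)) /\ \sum_i (1 - avg (fun th =>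
      sqn (\sum_a (W th a i)^* * steered (codeword T w i) th a)))
   <= N%:R * (3 * etag + 3 * eta + gmax * eta ^+ 2 + N%:R * (pmax + gmax * qmax) + t + eta / t).
Proof.
move=> N0.
pose B w i j := sqn (\sum_c H (phi w i) (phi w j) c c) +
  gmax * (\sum_c \sum_c' sqn (H (phi w i) (phi w j) c c') - \sum_c sqn (H (phi w i) (phi w j) c c)).
(* Twice the bound of [lowdin] is inserted into [sqn_add_ge]; in the mean the leading terms cancel
   as [2 - 3 + 1]. *)
pose L w := \sum_i (2 - 3 * ((\sum_v g v) * \sum_y \sum_c sqn (phi w i y c)) + \sum_j B w i j
    + t + (\sum_v g v) * (\sum_y \sum_c sqn (del w i y c)) / t).
have [w hw] : exists w, L w <= N%:R * (3 * etag + 3 * eta + gmax * eta ^+ 2 +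
    N%:R * (pmax + gmax * qmax) + t + eta / t).
  apply: (avg_exists (phases_gt0 _)); rewrite avg_sum.
  apply: (@le_trans _ _ (\sum_(i < N) (3 * etag + 3 * eta + gmax * eta ^+ 2 +
    N%:R * (pmax + gmax * qmax) + t + eta / t))); last first.
    by rewrite sumr_const card_ord -[_ *+ N]mulr_natl.
  apply: ler_sum => i _; rewrite !avgD avgN !avg_const ?phases_gt0// avgZr !avgZ avg_sum.
  rewrite (avg_sum _ (fun j w => B w i j)).
  rewrite (avg_sum _ (fun y w => \sum_c sqn (del w i y c))).
  under [X in 3 * (_ * X)]eq_bigr do rewrite avg_sum.
  under [X in _ * X / t]eq_bigr do rewrite avg_sum.
  have -> : \sum_y \sum_c avg (fun w => sqn (phi w i y c)) = P.
    rewrite codeword_total; apply: eq_bigr => x _; apply: eq_bigr => y _; apply: eq_bigr => z _.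
    exact: sqnTt.
  have -> : \sum_y \sum_c avg (fun w => sqn (del w i y c)) = 1 - P.
    by rewrite codeword_total P_Tn.
  have hB : \sum_j avg (fun w => B w i j) <= 1 + gmax * eta ^+ 2 + N%:R * (pmax + gmax * qmax).
    apply: le_trans (ler_sum _ (fun j _ => gram_bound i j)) _.
    by rewrite big_split /= sum_delta sumr_const card_ord -[_ *+ N]mulr_natl.
  set G := \sum_v g v.
  have hG : 0 <= (1 - G) * (1 - P) by rewrite mulr_ge0// subr_ge0// P1.
  have hP : 1 - eta <= P by exact: heta.
  have hGe : 1 - etag <= G by exact: geta.
  have hG1 : G <= 1 by exact: g1.
  have hG0 : 0 <= G by apply: sumr_ge0.
  have hGP : G * (1 - P) / t <= eta / t.
    rewrite ler_pM2r ?invr_gt0//; apply: (@le_trans _ _ (1 * eta)); last by rewrite mul1r.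
    by rewrite ler_pM// ?subr_ge0 ?P1//; lra.
  have hGP2 : G * P = (1 - G) * (1 - P) + G + P - 1 by ring.
  by rewrite hGP2; lra.
(* The decoder is built from the truncated codewords, while the full ones are sent. The remainder
   [del] enters as the second summand of [sqn_add_ge]. *)
pose c th i := steered (phi w i) th.
have hW th := lowdin (c th).
have [W hW'] := boolp.choice hW.
exists w, W; split=> [th|]; first by have [] := hW' th.
apply: le_trans hw; apply: ler_sum => i _.
pose dl th := steered (del w i) th.
have zE th : \sum_a (W th a i)^* * steered (codeword T w i) th a =
    \sum_a (W th a i)^* * c th i a + \sum_a (W th a i)^* * dl th a.
  rewrite -big_split; apply: eq_bigr => a _; rewrite /= -mulrDr; congr (_ * _).
  rewrite /c /dl /steered -big_split; apply: eq_bigr => z _.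
  rewrite /= -mulrDr; congr (_ * _); rewrite -mulrDr; congr (_ * _).
  rewrite /phi /del /codeword -big_split; apply: eq_bigr => x _.
  by rewrite /= -mulrDr -mulrDl; case: (_ && _); rewrite /= ?addr0 ?add0r mul1r.
have pt th : 3 * nrm (c th i) - \sum_j sqn (inner (c th i) (c th j)) - 1 - t - nrm (dl th) / t <=
    sqn (\sum_a (W th a i)^* * steered (codeword T w i) th a).
  rewrite zE; apply: le_trans (sqn_add_ge _ _ t0).
  have [cW _ /(_ i) h] := hW' th.
  have hd : sqn (\sum_a (W th a i)^* * dl th a) / t <= nrm (dl th) / t.
    rewrite ler_pM2r ?invr_gt0//; apply: le_trans (cW (dl th)).
    rewrite /nrm (bigD1 i)//= lerDl sumr_ge0// => j _; exact: sqn_ge0.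
  lra.
have := ler_avg pt.
rewrite !avgB !avg_const ?phases_gt0// avgZ avgZr !steered_nrm (avg_sum _ (fun j th => sqn (inner (c th i) (c th j)))).
have hB : \sum_j avg (fun th => sqn (inner (c th i) (c th j))) <= \sum_j B w i j.
  by apply: ler_sum => j _; exact: steered_gram.
by move=> h; rewrite -/(del w i); lra.
Qed.

End Block2.

(** * Quadratic forms and measurements *)

Section QuadraticForms.
Variable R : realType.
Local Notation C := R[i].

Definition qform (I : finType) (A : op R I I) (v : vec R I) : R :=
  complex.Re (inner v (applyop A v)).

Lemma psd_qform (I : finType) (A : op R I I) : psd A <->
  forall v, inner v (applyop A v) = (qform A v)%:C /\ 0 <= qform A v.
Proof. exact: psdP. Qed.

Lemma qform_ge0 (I : finType) (A : op R I I) v : psd A -> 0 <= qform A v.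
Proof. by move=> /psd_qform/(_ v)[]. Qed.

Lemma applyop_sum (K I J : finType) (A : K -> op R I J) (v : vec R J) i :
  applyop (fun x y => \sum_k A k x y) v i = \sum_k applyop (A k) v i.
Proof.
by rewrite /applyop exchange_big; apply: eq_bigr => j _; rewrite mulr_suml.
Qed.

Lemma inner_sum (K I J : finType) (A : K -> op R I J) (u : vec R I) (v : vec R J) :
  inner u (applyop (fun x y => \sum_k A k x y) v) = \sum_k inner u (applyop (A k) v).
Proof.
rewrite /inner exchange_big; apply: eq_bigr => i _.
by rewrite applyop_sum mulr_sumr.
Qed.

Lemma qform_sum (K I : finType) (A : K -> op R I I) (v : vec R I) :
  qform (fun x y => \sum_k A k x y) v = \sum_k qform (A k) v.
Proof. by rewrite /qform inner_sum Re_sum. Qed.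

Lemma inner_addop (I : finType) (A B : op R I I) (u v : vec R I) :
  inner u (applyop (fun x y => A x y + B x y) v) =
  inner u (applyop A v) + inner u (applyop B v).
Proof.
rewrite /inner -big_split; apply: eq_bigr => i _; rewrite /= -mulrDr; congr (_ * _).
by rewrite /applyop -big_split; apply: eq_bigr => j _; rewrite mulrDl.
Qed.

Lemma qform_add (I : finType) (A B : op R I I) v :
  qform (fun x y => A x y + B x y) v = qform A v + qform B v.
Proof. by rewrite /qform inner_addop ReD. Qed.

Lemma psd_sum (K I : finType) (P : pred K) (A : K -> op R I I) :
  (forall k, P k -> psd (A k)) -> psd (fun x y => \sum_(k | P k) A k x y).
Proof.
move=> h v.
have -> : inner v (applyop (fun x y => \sum_(k | P k) A k x y) v) =
  \sum_(k | P k) inner v (applyop (A k) v).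
  rewrite /inner /applyop exchange_big; apply: eq_bigr => i _ /=.
  under eq_bigr do rewrite mulr_suml.
  by rewrite exchange_big mulr_sumr.
by apply: sumr_ge0 => k Pk; exact: h.
Qed.

Lemma psd_add (I : finType) (A B : op R I I) :
  psd A -> psd B -> psd (fun x y => A x y + B x y).
Proof. by move=> a b v; rewrite inner_addop addr_ge0 ?a ?b. Qed.

Lemma psd_scale (I : finType) (A : op R I I) (b : bool) :
  psd A -> psd (fun x y => b%:R * A x y).
Proof.
move=> pA v; have -> : (fun x y => b%:R * A x y) = if b then A else fun _ _ => 0.
  by case: b; do 2 (apply/boolp.funext => ?); rewrite ?mul1r ?mul0r.
case: b; first exact: pA.
rewrite /inner big1// => i _; rewrite /applyop big1 ?mulr0// => j _.
by rewrite mul0r.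
Qed.

Lemma qform_id (I : finType) (v : vec R I) : qform (@idop R I) v = nrm v.
Proof.
rewrite /qform; have -> : applyop (@idop R I) v = v.
  by apply/boolp.funext => i; rewrite /applyop /idop sum_delta.
by rewrite innerE.
Qed.

Lemma psd_idop (I : finType) : psd (@idop R I).
Proof.
move=> v; have -> : applyop (@idop R I) v = v.
  by apply/boolp.funext => i; rewrite /applyop /idop sum_delta.
by rewrite innerE ler0c nrm_ge0.
Qed.

Definition rank1 (I : finType) (e : vec R I) : op R I I := fun x y => e x * (e y)^*.

Lemma inner_rank1 (I : finType) (e v : vec R I) :
  inner v (applyop (rank1 e) v) = (sqn (inner e v))%:C.
Proof.
rewrite sqnE quad_form inner_conj /inner mulr_suml.
apply: eq_bigr => x _; rewrite mulr_sumr; apply: eq_bigr => y _.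
by rewrite /rank1; ring.
Qed.

Lemma qform_rank1 (I : finType) (e v : vec R I) : qform (rank1 e) v = sqn (inner e v).
Proof. by rewrite /qform inner_rank1. Qed.

Lemma psd_rank1 (I : finType) (e : vec R I) : psd (rank1 e).
Proof. by move=> v; rewrite inner_rank1 ler0c sqn_ge0. Qed.

(** The difference of the two sides is the form at [t v + (1 + t) w], divided by [t (1 + t)]. *)
Lemma qform_perturb (I : finType) (A : op R I I) (v w : vec R I) (t : R) :
  psd A -> 0 < t -> qform A v / (1 + t) - qform A w / t <= qform A (fun i => v i + w i).
Proof.
move=> pA t0.
pose cr := complex.Re (inner v (applyop A w) + inner w (applyop A v)).
have E (x y : R) : qform A (fun i => x%:C * v i + y%:C * w i) =
    x ^+ 2 * qform A v + y ^+ 2 * qform A w + x * y * cr.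
  rewrite /qform /cr -!ReZ -!ReD; congr complex.Re.
  rewrite !quad_form.
  have qf u z : inner u (applyop A z) = \sum_i \sum_j (u i)^* * A i j * z j.
    by apply: eq_bigr => i _; rewrite mulr_sumr; apply: eq_bigr => j _; rewrite mulrA.
  rewrite !qf mulrDr !mulr_sumr -!big_split; apply: eq_bigr => i _ /=.
  rewrite !mulr_sumr -!big_split; apply: eq_bigr => j _ /=.
  by rewrite rmorphD !rmorphM /= !conj_rc; ring.
have h1 := E 1 1; have h2 := E t (1 + t).
have -> : qform A (fun i => v i + w i) = qform A v + qform A w + cr.
  rewrite -[RHS](_ : qform A (fun i => 1%:C * v i + 1%:C * w i) = _).
    by congr qform; apply/boolp.funext => i; rewrite !mul1r.
  by rewrite h1; ring.
have := qform_ge0 (fun i => t%:C * v i + (1 + t)%:C * w i) pA; rewrite h2 => h3.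
rewrite -subr_ge0.
have -> : qform A v + qform A w + cr - (qform A v / (1 + t) - qform A w / t) =
  (t ^+ 2 * qform A v + (1 + t) ^+ 2 * qform A w + t * (1 + t) * cr) / (t * (1 + t)).
  by field; apply/andP; split; lra.
by rewrite divr_ge0// mulr_ge0//; lra.
Qed.

Definition povm (I K : finType) (M : K -> op R I I) : Prop :=
  (forall k, psd (M k)) /\ (forall x y, \sum_k M k x y = idop R x y).

Lemma povm_sum_qform (I K : finType) (M : K -> op R I I) v :
  povm M -> \sum_k qform (M k) v = nrm v.
Proof.
move=> [_ h]; rewrite -qform_sum -qform_id; congr qform.
by do 2 (apply/boolp.funext => ?).
Qed.

Lemma povm_qform_le (I K : finType) (M : K -> op R I I) k v :
  povm M -> qform (M k) v <= nrm v.
Proof.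
move=> pM; rewrite -(povm_sum_qform v pM) (bigD1 k)//= lerDl sumr_ge0// => j _.
by apply: qform_ge0; case: pM.
Qed.

(** The defect from the identity is positive by contractivity and is assigned to the outcome
    [k0]. *)
Lemma coisometric_povm (I K : finType) (W : op R I K) (k0 : K) : coisometric W ->
  exists M : K -> op R I I, povm M /\ forall k, exists Q, psd Q /\
    forall x y, M k x y = rank1 (W^~ k) x y + Q x y.
Proof.
move=> cW; pose Q : op R I I := fun x y => idop R x y - \sum_k rank1 (W^~ k) x y.
have pQ : psd Q.
  move=> v.
  have -> : inner v (applyop Q v) = inner v (applyop (@idop R I) v) -
      inner v (applyop (fun x y => \sum_k rank1 (W^~ k) x y) v).
    apply/eqP; rewrite -subr_eq0 opprB addrA subr_eq -inner_addop add0r; apply/eqP.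
    congr (inner v (applyop _ v)); do 2 (apply/boolp.funext => ?).
    by rewrite /Q subrK.
  rewrite inner_sum; under eq_bigr do rewrite inner_rank1.
  have -> : applyop (@idop R I) v = v.
    by apply/boolp.funext => i; rewrite /applyop /idop sum_delta.
  by rewrite innerE -rc_sum -rmorphB /= ler0c subr_ge0; exact: cW.
exists (fun k x y => rank1 (W^~ k) x y + (k == k0)%:R * Q x y); split.
  split=> [k|x y]; first by apply: psd_add; [exact: psd_rank1|exact: psd_scale].
  by rewrite big_split /= sum_deltaC /Q addrC subrK.
move=> k; exists (fun x y => (k == k0)%:R * Q x y); split=> //.
exact: psd_scale.
Qed.

Definition tensor_op (I J : finType) (A : op R I I) (B : op R J J) : op R (I * J)%type (I * J)%type :=
  fun x y => A x.1 y.1 * B x.2 y.2.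

Lemma inner_tensor_rank1 (I J : finType) (A : op R I I) (e : vec R J) (f : vec R (I * J)%type) :
  inner f (applyop (tensor_op A (rank1 e)) f) =
  inner (fun i => \sum_j (e j)^* * f (i, j)) (applyop A (fun i => \sum_j (e j)^* * f (i, j))).
Proof.
rewrite !quad_form sum_pair.
transitivity (\sum_i \sum_j \sum_i' \sum_j' (f (i, j))^* * (e j) * A i i' * ((e j')^* * f (i', j'))).
  apply: eq_bigr => i _; apply: eq_bigr => j _; rewrite sum_pair.
  apply: eq_bigr => i' _; apply: eq_bigr => j' _.
  by rewrite /tensor_op /rank1 /=; ring.
apply: eq_bigr => i _; rewrite exchange_big; apply: eq_bigr => i' _ /=.
rewrite conj_sum !mulr_suml; apply: eq_bigr => j _; rewrite mulr_sumr.
by apply: eq_bigr => j' _; rewrite rmorphM /= conjCK [e j * _]mulrC.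
Qed.

(** Once [B] is split into rank-one terms, contracting with one of its vectors leaves the form of
    [A]. *)
Lemma psd_tensor (I J : finType) (A : op R I I) (B : op R J J) :
  psd A -> psd B -> psd (tensor_op A B).
Proof.
move=> pA /psd_spectral[V [lam [_ lam0 dec]]] f.
pose e k : vec R J := fun j => (Num.sqrt (lam k))%:C * V j k.
have -> : tensor_op A B = fun x y => \sum_k tensor_op A (rank1 (e k)) x y.
  do 2 (apply/boolp.funext => ?); rewrite /tensor_op -mulr_sumr dec; congr (_ * _).
  apply: eq_bigr => k _; rewrite /rank1 /e rmorphM /= conj_rc.
  by rewrite -{1}(sqr_sqrtr (lam0 k)) rmorphXn /=; ring.
rewrite inner_sum; apply: sumr_ge0 => k _.
by rewrite inner_tensor_rank1; exact: pA.
Qed.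

Lemma qform_tensor_add (I J : finType) (A : op R I I) (B Q : op R J J) v :
  qform (tensor_op A (fun x y => B x y + Q x y)) v = qform (tensor_op A B) v + qform (tensor_op A Q) v.
Proof.
rewrite -qform_add; congr qform; do 2 (apply/boolp.funext => ?).
by rewrite /tensor_op mulrDr.
Qed.

End QuadraticForms.

(** * Composition of two blocks *)

Section Composition.
Variable R : realType.
Local Notation C := R[i].

Lemma qform_scale (I : finType) (A : op R I I) (x : R) (v : vec R I) :
  qform A (fun i => x%:C * v i) = x ^+ 2 * qform A v.
Proof.
rewrite /qform -ReZ !quad_form mulr_sumr; congr complex.Re; apply: eq_bigr => i _.
rewrite mulr_sumr; apply: eq_bigr => j _.
by rewrite !rmorphM /= conj_rc; ring.
Qed.

Definition distinguishable (Y Z Msg : finType) (phi : Msg -> vec R (Y * Z)%type) (f : Msg -> R) :=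
  exists (K : finType) (E : K -> op R Z Z) (F : K -> Msg -> op R Y Y),
    [/\ povm E, forall k, povm (F k) &
     forall i, f i <= \sum_k qform (tensor_op (F k i) (E k)) (phi i)].

Variables (Y1 Z1 Y2 Z2 : finType) (N1 N2 : nat) (g : Y1 -> R).
Variables (phi1 : 'I_N1 -> Y1 -> Z1 -> C) (phi2 : 'I_N2 -> Y2 -> Z2 -> C).

(* Up to the partial isometry [W], Charlie knows [m] and shares with Bob the
   state [\sum_y sqrt (g y) |y>|y>], whatever [m] is. *)
Definition identifiable (e : R) :=
  exists W : op R Z1 ('I_N1 * Y1)%type, coisometric W /\
    \sum_m nrm (fun a : (Y1 * ('I_N1 * Y1))%type => \sum_z (W z a.2)^* * phi1 m a.1 z
       - ((a.2 == (m, a.1))%:R * Num.sqrt (g a.1))%:C) <= N1%:R * e.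

(** Charlie's measurement is fixed to the uniform family of phase vectors, whence the plain average
    over [th]; Bob's may depend on the outcome. *)
Definition decodable (e : R) :=
  exists F : phases (Y1 * Z2)%type -> 'I_N2 -> op R (Y1 * Y2)%type (Y1 * Y2)%type,
    (forall th, povm (F th)) /\
    \sum_i (1 - avg (fun th => qform (F th i) (steered g (phi2 i) th))) <= N2%:R * e.

Hypothesis g0 : forall v, 0 <= g v.
Hypothesis g1 : \sum_v g v <= 1.
Hypothesis phi1_unit : forall m, \sum_y \sum_z sqn (phi1 m y z) = 1.
Hypothesis phi2_unit : forall i, \sum_y \sum_z sqn (phi2 i y z) = 1.

Definition joint_state (mi : 'I_N1 * 'I_N2) : vec R ((Y1 * Y2) * (Z1 * Z2))%type :=
  fun a => phi1 mi.1 a.1.1 a.2.1 * phi2 mi.2 a.1.2 a.2.2.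

Let Th := phases (Y1 * Z2)%type.
Let mu : R := (#|{: Th}|%:R)^-1.
Let mu0 : 0 <= mu. Proof. by rewrite invr_ge0. Qed.

(** Charlie's whole measurement: [W] turns the first block into [(m, b)], and the pair of [b] with
    the second block is measured in phase vectors, which [mu] normalises to resolve the identity. *)
Let Wc (W : op R Z1 ('I_N1 * Y1)%type) : op R (Z1 * Z2)%type ('I_N1 * Th)%type :=
  fun z k => (Num.sqrt mu)%:C * \sum_b W z.1 (k.1, b) * phase R k.2 (b, z.2).

Let WcE W m (th : Th) (v : vec R (Z1 * Z2)%type) :
  \sum_z (Wc W z (m, th))^* * v z =
  (Num.sqrt mu)%:C * \sum_a (phase R th a)^* * (\sum_z (W z (m, a.1))^* * v (z, a.2)).
Proof.
rewrite sum_pair exchange_big [in RHS]sum_pair [in RHS]exchange_big mulr_sumr.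
apply: eq_bigr => z2 _; rewrite mulr_sumr /Wc /=.
under eq_bigr do rewrite rmorphM /= conj_rc -mulrA.
rewrite -mulr_sumr -mulr_sumr; congr (_ * _).
under eq_bigr do rewrite conj_sum mulr_suml.
rewrite exchange_big; apply: eq_bigr => b _; rewrite mulr_sumr.
by apply: eq_bigr => z _; rewrite rmorphM /=; ring.
Qed.

Let sum_avg (h : Th -> R) : \sum_th mu * h th = avg h.
Proof. by rewrite /avg mulr_sumr. Qed.

Let Wc_coisometric W : coisometric W -> coisometric (Wc W).
Proof.
move=> cW v.
have -> : nrm (fun j => \sum_z (Wc W z j)^* * v z) =
    \sum_m \sum_(a : Y1 * Z2) sqn (\sum_z (W z (m, a.1))^* * v (z, a.2)).
  rewrite nrm_pair; apply: eq_bigr => m _; under eq_bigr do rewrite WcE sqnM sqn_rc sqr_sqrtr//.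
  by rewrite sum_avg avg_phase_sqnC.
under eq_bigr do rewrite sum_pair exchange_big /=.
rewrite exchange_big [leRHS]nrm_pair [leRHS]exchange_big; apply: ler_sum => z2 _ /=.
apply: le_trans (cW (fun z => v (z, z2))).
by rewrite nrm_pair.
Qed.

(** The deviation of the first block from the ideal shared state is carried along as a perturbation
    of Bob's vectors, and [qform_perturb] charges [t] plus its squared norm over [t]. *)
Lemma compose (e1 e2 t : R) (m0 : 'I_N1) : 0 < t -> identifiable e1 -> decodable e2 ->
  exists f, distinguishable joint_state f /\
    \sum_mi (1 - f mi) <= (N1 * N2)%:R * (e2 + t + e1 / t).
Proof.
move=> t0 [W [cW hW]] [F [pF hF]].
have [th0] : exists th : Th, true by exists [ffun=> ord0].
move=> _.
have [E [pE hE]] := coisometric_povm (m0, th0) (Wc_coisometric cW).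
(* Bob adopts the first message as announced by Charlie and decodes only the second. *)
pose Fb (k : 'I_N1 * Th) (mi : 'I_N1 * 'I_N2) : op R (Y1 * Y2)%type (Y1 * Y2)%type :=
  fun x y => (mi.1 == k.1)%:R * F k.2 mi.2 x y.
have pFb k : povm (Fb k).
  split=> [mi|x y]; first by apply: psd_scale; case: (pF k.2).
  rewrite sum_pair; under eq_bigr do rewrite -mulr_sumr.
  by rewrite sum_deltaC; case: (pF k.2).
pose X m (b : Y1) (k : 'I_N1 * Y1) := \sum_z (W z k)^* * phi1 m b z.
pose xi m := \sum_b \sum_b' sqn (X m b (m, b') - ((b' == b)%:R * Num.sqrt (g b))%:C).
pose f (mi : 'I_N1 * 'I_N2) : R :=
  avg (fun th => qform (F th mi.2) (steered g (phi2 mi.2) th)) - t - xi mi.1 / t.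
exists f; split.
  exists ('I_N1 * Th)%type, E, Fb; split=> // -[m i].
  pose act th : vec R (Y1 * Y2)%type := fun y =>
    \sum_(a : Y1 * Z2) (phase R th a)^* * (X m y.1 (m, a.1) * phi2 i y.2 a.2).
  apply: (@le_trans _ _ (avg (fun th => qform (F th i) (act th)))); last first.
    rewrite sum_pair (bigD1 m)//= -[leLHS]addr0 lerD//; last first.
      apply: sumr_ge0 => m' _; apply: sumr_ge0 => th _; apply: qform_ge0; apply: psd_tensor.
        by case: (pFb (m', th)).
      by case: pE.
    rewrite -sum_avg; apply: ler_sum => th _.
    have [Q [pQ hQ]] := hE (m, th).
    have -> : E (m, th) = fun x y => rank1 ((Wc W)^~ (m, th)) x y + Q x y.
      by do 2 (apply/boolp.funext => ?).
    rewrite qform_tensor_add -[leLHS]addr0 lerD//; last first.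
      by apply: qform_ge0; apply: psd_tensor => //; case: (pFb (m, th)).
    have -> : Fb (m, th) (m, i) = F th i.
      by do 2 (apply/boolp.funext => ?); rewrite /Fb /= eqxx mul1r.
    rewrite {2}/qform inner_tensor_rank1 -/(qform (F th i) _).
    have -> : (fun y => \sum_z (Wc W z (m, th))^* * joint_state (m, i) (y, z)) =
       fun y => (Num.sqrt mu)%:C * act th y.
      apply/boolp.funext => y; rewrite (WcE _ _ _ (fun z => joint_state (m, i) (y, z))).
      congr (_ * _); apply: eq_bigr => a _; congr (_ * _).
      by rewrite /X mulr_suml; apply: eq_bigr => z _; rewrite /joint_state /= mulrA.
    by rewrite qform_scale sqr_sqrtr.
  pose st th := steered g (phi2 i) th.
  pose dl th : vec R (Y1 * Y2)%type := fun y => act th y - st th y.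
  have dlE th : nrm (dl th) = \sum_b \sum_y sqn (\sum_(a : Y1 * Z2) (phase R th a)^* *
      ((X m b (m, a.1) - ((a.1 == b)%:R * Num.sqrt (g b))%:C) * phi2 i y a.2)).
    rewrite nrm_pair; apply: eq_bigr => b _; apply: eq_bigr => y _; congr sqn.
    rewrite /dl /act /st /steered /=.
    have -> : \sum_c (phase R th (b, c))^* * ((Num.sqrt (g b))%:C * phi2 i y c) =
      \sum_(a : Y1 * Z2) (phase R th a)^* * (((a.1 == b)%:R * Num.sqrt (g b))%:C * phi2 i y a.2).
      rewrite [RHS]sum_pair (bigD1 b)//= [X in _ = _ + X]big1 ?addr0 => [|b' bb'].
        by apply: eq_bigr => c _; rewrite eqxx mul1r.
      by rewrite big1// => c _; rewrite (negbTE bb') mul0r rmorph0 mul0r mulr0.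
    by rewrite -sumrB; apply: eq_bigr => a _; rewrite mulrBl mulrBr.
  (* Second moments of the phases turn the mean squared norm of the error into the deviation of the
     first block, since [phi2 i] has norm 1. *)
  have dl_avg : avg (fun th => nrm (dl th)) = xi m.
    under eq_avg do rewrite dlE.
    rewrite avg_sum; apply: eq_bigr => b _; rewrite avg_sum.
    under eq_bigr do rewrite avg_phase_sqnC.
    rewrite exchange_big sum_pair /=; apply: eq_bigr => b' _.
    under eq_bigr do under eq_bigr do rewrite sqnM.
    under eq_bigr do rewrite -mulr_sumr.
    by rewrite -mulr_sumr exchange_big phi2_unit mulr1.
  have st_avg : avg (fun th => qform (F th i) (st th)) <= 1.
    apply: (@le_trans _ _ (avg (fun th => nrm (st th)))).
      by apply: ler_avg => th; exact: povm_qform_le.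
    by rewrite steered_nrm// phi2_unit mulr1.
  have pt th : qform (F th i) (st th) / (1 + t) - nrm (dl th) / t <= qform (F th i) (act th).
    have -> : act th = fun y => st th y + dl th y.
      by apply/boolp.funext => y; rewrite /dl addrC subrK.
    apply: le_trans (qform_perturb _ _ _ t0); last by case: (pF th).
    by rewrite lerD2l lerN2 ler_pM2r ?invr_gt0// povm_qform_le.
  have := ler_avg pt; rewrite avgB !avgZr dl_avg; apply: le_trans; rewrite /f /= lerD2r.
  have st0 : 0 <= avg (fun th => qform (F th i) (st th)).
    by apply: avg_ge0 => th; apply: qform_ge0; case: (pF th).
  rewrite -/(st _); move: st_avg st0; set a := avg _ => a1 a0.
  (* [a - t <= a / (1 + t)] because [a <= 1]. *)
  rewrite ler_pdivlMr; last by lra.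
  by nra.
have xi_le : \sum_m xi m <= N1%:R * e1.
  apply: le_trans hW; apply: ler_sum => m _; rewrite nrm_pair; apply: ler_sum => b _ /=.
  rewrite sum_pair (bigD1 m)//= -[leLHS]addr0 lerD//; last first.
    by do 2 (apply: sumr_ge0 => ? _); exact: sqn_ge0.
  by apply: ler_sum => b' _; rewrite xpair_eqE eqxx.
rewrite sum_pair /f /=.
pose S := \sum_i (1 - avg (fun th => qform (F th i) (steered g (phi2 i) th))).
have -> : \sum_m \sum_i (1 - (avg (fun th => qform (F th i) (steered g (phi2 i) th)) - t - xi m / t)) =
   N1%:R * S + (N1 * N2)%:R * t +
   N2%:R * (\sum_m xi m) / t.
  transitivity (\sum_(m < N1) (S +
       N2%:R * t + N2%:R * xi m / t)).
    apply: eq_bigr => m _.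
    transitivity (\sum_i ((1 - avg (fun th => qform (F th i) (steered g (phi2 i) th))) + (t + xi m / t))).
      by apply: eq_bigr => i _; ring.
    by rewrite big_split /= sumr_const card_ord -[_ *+ N2]mulr_natl /S; ring.
  rewrite !big_split /= !sumr_const card_ord -[X in X + _ + _]mulr_natl -[X in _ + X + _]mulr_natl.
  by rewrite -mulr_suml -mulr_sumr natrM; ring.
have h1 : N1%:R * S <= (N1 * N2)%:R * e2.
  by rewrite natrM -mulrA ler_wpM2l.
have h2 : N2%:R * (\sum_m xi m) / t <= (N1 * N2)%:R * (e1 / t).
  by rewrite mulrA ler_pM2r ?invr_gt0// mulnC natrM -mulrA ler_wpM2l.
by rewrite !mulrDr; lra.
Qed.

End Composition.

(** * Expurgation and change of basis *)

Section Expurgation.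
Variable R : realType.
Local Notation C := R[i].

Lemma povm_one_way (Y Z Msg K : finType) (E : K -> op R Z Z) (F : K -> Msg -> op R Y Y) :
  povm E -> (forall k, povm (F k)) ->
  povm (fun i x y => \sum_k tensor_op (F k i) (E k) x y).
Proof.
move=> pE pF; split=> [j|x y].
  by apply: psd_sum => k _; apply: psd_tensor; [case: (pF k)|case: pE].
rewrite exchange_big /=.
under eq_bigr => k _ do rewrite /tensor_op -mulr_suml (proj2 (pF k)).
case: x y => a b [c d] /=.
by rewrite -mulr_sumr (proj2 pE) /idop -natrM mulnb xpair_eqE.
Qed.

Lemma distinguishable_le1 (Y Z Msg : finType) (phi : Msg -> vec R (Y * Z)%type) f :
  (forall i, nrm (phi i) = 1) -> distinguishable phi f -> forall i, f i <= 1.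
Proof.
move=> phi1 [K [E [F [pE pF h]]]] i; apply: le_trans (h i) _.
rewrite -qform_sum -(phi1 i).
exact: (povm_qform_le i (phi i) (povm_one_way pE pF)).
Qed.

(** The outcomes of the discarded messages are handed to [j0], which keeps the measurement
    complete. *)
Lemma merge_povm (I Msg : finType) (N : nat) (F : Msg -> op R I I) (h : 'I_N -> Msg) (j0 : 'I_N) :
  injective h -> povm F ->
  let G := fun j x y => F (h j) x y + (j == j0)%:R * \sum_(i | i \notin codom h) F i x y in
  povm G.
Proof.
move=> inj [pF sF] G; split=> [j|x y].
  by apply: psd_add => //; apply: psd_scale; apply: psd_sum.
rewrite big_split /= sum_deltaC -sF [RHS](bigID (mem (codom h))) /=; congr (_ + _).
by rewrite -big_uniq /=; [rewrite big_image|exact/injectiveP].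
Qed.

(** By Markov's inequality at most half of the messages fail with probability above [eps]. *)
Lemma expurgate (Y Z Msg : finType) (phi : Msg -> vec R (Y * Z)%type) f (eps : R) (N : nat) :
  (forall i, nrm (phi i) = 1) -> distinguishable phi f -> 0 < eps ->
  \sum_i (1 - f i) <= #|Msg|%:R * (eps / 2) -> (0 < N)%N -> (N.*2 <= #|Msg|)%N ->
  exists h : 'I_N -> Msg, distinguishable (phi \o h) (fun=> 1 - eps).
Proof.
move=> phi1 dphi eps0 hf N0 hN.
have f1 := distinguishable_le1 phi1 dphi.
pose G := [set i | 1 - eps <= f i].
have bad : #|~: G|%:R * eps <= #|Msg|%:R * (eps / 2).
  apply: le_trans hf; rewrite (bigID (mem (~: G)))/= -[leLHS]addr0 lerD//; last first.
    by rewrite sumr_ge0// => i _; rewrite subr_ge0.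
  rewrite -sum1_card natr_sum mulr_suml; apply: ler_sum => i.
  by rewrite !inE -ltNge => h; lra.
have NG : (N <= #|G|)%N.
  have hb : (#|~: G|.*2 <= #|Msg|)%N.
    rewrite -(ler_nat R) -muln2 natrM -(ler_pM2r eps0).
    by move: bad; rewrite mulrA ler_pdivlMr// => ?; lra.
  by have := cardsC G; lia.
have [i0 _] : exists i, i \in G by apply/card_gt0P; apply: leq_trans NG.
pose h (j : 'I_N) := nth i0 (enum G) j.
have lt_h (j : 'I_N) : (j < size (enum G))%N by rewrite -cardE; apply: leq_trans NG.
have inj : injective h.
  move=> j j' /eqP; rewrite nth_uniq ?enum_uniq// => /eqP; exact: val_inj.
have hG j : 1 - eps <= f (h j).
  by have := mem_nth i0 (lt_h j); rewrite mem_enum inE.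
have [K [E [F [pE pF hs]]]] := dphi.
exists h, K, E, (fun k j x y => F k (h j) x y + (j == Ordinal N0)%:R *
   \sum_(i | i \notin codom h) F k i x y); split=> //.
  by move=> k; exact: merge_povm.
move=> j; apply: le_trans (hG j) _; apply: le_trans (hs (h j)) _; apply: ler_sum => k _.
set Q : op R Y Y := fun x y => (j == Ordinal N0)%:R * \sum_(i | i \notin codom h) F k i x y.
have pQ : psd Q by apply: psd_scale; apply: psd_sum => i _; case: (pF k).
have -> : tensor_op (fun x y => F k (h j) x y + Q x y) (E k) =
   fun x y => tensor_op (F k (h j)) (E k) x y + tensor_op Q (E k) x y.
  by do 2 (apply/boolp.funext => ?); rewrite /tensor_op mulrDl.
rewrite qform_add lerDl; apply: qform_ge0; apply: psd_tensor => //.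
by case: pE.
Qed.

End Expurgation.

Section Transport.
Variable R : realType.
Local Notation C := R[i].

Definition adjointop (I J : finType) (V : op R I J) : op R J I := fun j i => (V i j)^*.

Definition unitary (I J : finType) (V : op R I J) := is_isometry V /\ is_isometry (adjointop V).

Definition conjop (I J : finType) (V : op R I J) (A : op R J J) : op R I I :=
  fun x y => \sum_a \sum_b V x a * A a b * (V y b)^*.

Lemma inner_conjop (I J : finType) (V : op R I J) (A : op R J J) (v : vec R I) :
  inner v (applyop (conjop V A) v) =
  inner (applyop (adjointop V) v) (applyop A (applyop (adjointop V) v)).
Proof.
rewrite !quad_form.
transitivity (\sum_x \sum_y \sum_a \sum_b (v x)^* * (V x a * A a b * (V y b)^*) * v y).
  apply: eq_bigr => x _; apply: eq_bigr => y _; rewrite /conjop mulr_sumr mulr_suml.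
  by apply: eq_bigr => a _; rewrite mulr_sumr mulr_suml.
transitivity (\sum_a \sum_b \sum_x \sum_y (v x)^* * (V x a * A a b * (V y b)^*) * v y).
  under eq_bigr do rewrite exchange_big /=.
  rewrite exchange_big; apply: eq_bigr => a _ /=.
  under eq_bigr do rewrite exchange_big /=.
  by rewrite exchange_big.
apply: eq_bigr => a _; apply: eq_bigr => b _.
rewrite /applyop /adjointop conj_sum !mulr_suml; apply: eq_bigr => x _; rewrite mulr_sumr.
by apply: eq_bigr => y _; rewrite rmorphM /= conjCK; ring.
Qed.

Lemma psd_conjop (I J : finType) (V : op R I J) (A : op R J J) : psd A -> psd (conjop V A).
Proof. by move=> pA v; rewrite inner_conjop; exact: pA. Qed.

Lemma povm_conjop (I J K : finType) (V : op R I J) (A : K -> op R J J) :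
  is_isometry (adjointop V) -> povm A -> povm (fun k => conjop V (A k)).
Proof.
move=> iV [pA sA]; split=> [k|x y]; first exact: psd_conjop.
rewrite /conjop exchange_big /=.
transitivity (\sum_a V x a * (V y a)^*).
  apply: eq_bigr => a _; rewrite exchange_big /=.
  transitivity (\sum_b (a == b)%:R * (V x a * (V y b)^*)); last by rewrite sum_delta.
  by apply: eq_bigr => b _; rewrite -mulr_suml -mulr_sumr sA /idop; ring.
rewrite -iV; apply: eq_bigr => a _.
by rewrite /adjointop conjCK.
Qed.

Lemma applyop_adjoint (I J : finType) (V : op R I J) (v : vec R J) :
  is_isometry V -> applyop (adjointop V) (applyop V v) = v.
Proof.
move=> iV; apply/boolp.funext => j; rewrite /applyop /adjointop.
under eq_bigr do rewrite mulr_sumr.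
rewrite exchange_big /=.
transitivity (\sum_k (j == k)%:R * v k); last by rewrite sum_delta.
apply: eq_bigr => k _; rewrite -[(j == k)%:R]/(idop R j k) -iV mulr_suml.
by apply: eq_bigr => i _; rewrite mulrA.
Qed.

Lemma tensor_isometry (I I' J J' : finType) (V : op R I I') (W : op R J J') :
  is_isometry V -> is_isometry W ->
  is_isometry (fun (x : I * J) (y : I' * J') => V x.1 y.1 * W x.2 y.2).
Proof.
move=> iV iW [i j] [i' j'].
rewrite sum_pair /=.
transitivity ((\sum_x (V x i)^* * V x i') * (\sum_y (W y j)^* * W y j')).
  rewrite mulr_suml; apply: eq_bigr => x _; rewrite mulr_sumr; apply: eq_bigr => y _.
  by rewrite rmorphM /=; ring.
by rewrite iV iW /idop -natrM mulnb xpair_eqE.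
Qed.

Lemma tensor_conjop (I I' J J' : finType) (V : op R I I') (W : op R J J') A B :
  tensor_op (conjop V A) (conjop W B) =
  conjop (fun (x : I * J) (y : I' * J') => V x.1 y.1 * W x.2 y.2) (tensor_op A B).
Proof.
apply/boolp.funext => -[x1 x2]; apply/boolp.funext => -[y1 y2].
rewrite /tensor_op /conjop /= [RHS]sum_pair mulr_suml; apply: eq_bigr => a _.
rewrite mulr_sumr; apply: eq_bigr => c _; rewrite [RHS]sum_pair mulr_suml.
apply: eq_bigr => b _; rewrite mulr_sumr; apply: eq_bigr => d _ /=.
by rewrite rmorphM /=; ring.
Qed.

(** Codes are constructed in eigenbases of the marginals. The unitaries back to the given bases are
    local to Bob and to Charlie, so one-way LOCC is preserved. *)
Lemma EA_code_transport (A B E : finType) (U : op R (B * E)%type A) (n N : nat) (eps : R)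
    (X Y Z : finType) (u : X -> Y -> Z -> C) (VX : op R (tpow n A) X)
    (VY : op R (tpow n B) Y) (VZ : op R (tpow n E) Z) (psi : 'I_N -> vec R X) :
  is_isometry VX -> unitary VY -> unitary VZ ->
  (forall x yz, \sum_a Utens U yz a * VX a x = \sum_y \sum_z VY yz.1 y * VZ yz.2 z * u x y z) ->
  (forall i, nrm (psi i) = 1) ->
  distinguishable (fun i a => \sum_x psi i x * u x a.1 a.2) (fun=> 1 - eps) ->
  EA_code U n N eps.
Proof.
move=> iX [iY iY'] [iZ iZ'] hU psi1 [K [Ec [F [pE pF hs]]]].
pose VV : op R (tpow n B * tpow n E)%type (Y * Z)%type := fun x y => VY x.1 y.1 * VZ x.2 y.2.
have iVV : is_isometry VV by exact: tensor_isometry.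
pose phi i := applyop (@Utens R A B E U n) (applyop VX (psi i)).
have phiE i : phi i = applyop VV (fun a => \sum_x psi i x * u x a.1 a.2).
  apply/boolp.funext => -[y0 z0]; rewrite /phi /applyop.
  under eq_bigr do rewrite mulr_sumr.
  under [RHS]eq_bigr do rewrite mulr_sumr.
  rewrite exchange_big [RHS]exchange_big; apply: eq_bigr => x _ /=.
  transitivity (psi i x * \sum_a Utens U (y0, z0) a * VX a x).
    by rewrite mulr_sumr; apply: eq_bigr => a _; rewrite mulrA mulrC.
  rewrite hU [RHS]sum_pair mulr_sumr; apply: eq_bigr => y _.
  by rewrite mulr_sumr; apply: eq_bigr => z _; rewrite /VV /=; ring.
pose Ec' k := conjop VZ (Ec k).
pose F' k i := conjop VY (F k i).
have pEc' : povm Ec' by exact: povm_conjop.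
have pF' k : povm (F' k) by exact: povm_conjop.
pose M i : op R (tpow n B * tpow n E)%type (tpow n B * tpow n E)%type :=
  fun x y => \sum_k tensor_op (F' k i) (Ec' k) x y.
have pM : povm M by exact: povm_one_way.
exists phi, M; split=> [i|].
  exists (applyop VX (psi i)); split=> //.
  by apply/unit_nrm; rewrite nrm_isometry.
split; first exact: pM.
split.
  exists #|K|, (fun k => Ec' (enum_val k)), (fun k => F' (enum_val k)); split.
    split=> [k|x y]; first by case: pEc'.
    by rewrite (sum_enum_val (fun k => Ec' k x y)); case: pEc'.
  split=> [k|i x y]; first exact: pF'.
  by rewrite (sum_enum_val (fun k => F' k i x.1 y.1 * Ec' k x.2 y.2)).
move=> i; have [pMi _] := pM.
have /psd_qform/(_ (phi i))[-> _] := pMi i.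
rewrite lecR qform_sum; apply: le_trans (hs i) _; rewrite le_eqVlt; apply/orP; left; apply/eqP.
apply: eq_bigr => k _; rewrite /qform /F' /Ec' tensor_conjop inner_conjop phiE.
by rewrite (applyop_adjoint _ iVV).
Qed.

End Transport.

(** * Tensor powers *)

Section TensorPower.
Variable R : realType.
Local Notation C := R[i].

Lemma sum_tpow (K : comPzSemiRingType) (n : nat) (I : finType) (F : 'I_n -> I -> K) :
  \sum_(a : tpow n I) \prod_k F k (a k) = \prod_k \sum_x F k x.
Proof. by rewrite bigA_distr_bigA. Qed.

Lemma sum_tpow2 (K : comPzSemiRingType) (n : nat) (I J : finType) (F : 'I_n -> I -> J -> K) :
  \sum_(a : tpow n I) \sum_(b : tpow n J) \prod_k F k (a k) (b k) =
  \prod_k \sum_x \sum_y F k x y.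
Proof.
rewrite -(sum_tpow (fun k x => \sum_y F k x y)); apply: eq_bigr => a _.
exact: (sum_tpow (fun k y => F k (a k) y)).
Qed.

Lemma sum_tpow_add (K : comPzSemiRingType) (n1 n2 : nat) (I : finType)
    (F : 'I_n1 -> I -> K) (G : 'I_n2 -> I -> K) :
  \sum_(a : tpow (n1 + n2) I) (\prod_k F k (a (lshift n2 k))) * (\prod_k G k (a (rshift n1 k))) =
  (\prod_k \sum_x F k x) * (\prod_k \sum_x G k x).
Proof.
pose H (k : 'I_(n1 + n2)) x := match fintype.split k with inl j => F j x | inr j => G j x end.
have Hl j x : H (lshift n2 j) x = F j x by rewrite /H (unsplitK (inl _ j)).
have Hr j x : H (rshift n1 j) x = G j x by rewrite /H (unsplitK (inr _ j)).
transitivity (\sum_(a : tpow (n1 + n2) I) \prod_k H k (a k)).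
  apply: eq_bigr => a _; rewrite big_split_ord; congr (_ * _);
  by apply: eq_bigr => k _; rewrite ?Hl ?Hr.
rewrite sum_tpow big_split_ord; congr (_ * _); apply: eq_bigr => k _;
by apply: eq_bigr => x _; rewrite ?Hl ?Hr.
Qed.

Lemma prod_delta (K : comPzSemiRingType) (n : nat) (I : finType) (a b : tpow n I) (f : 'I_n -> K) :
  \prod_k (f k *+ (a k == b k)) = (\prod_k f k) *+ (a == b).
Proof.
have [->|ab] := eqVneq a b; first by apply: eq_bigr => k _; rewrite eqxx.
have [k nk] : exists k, a k != b k.
  by apply/existsP; rewrite -negb_forall; apply: contra ab => /forallP h; apply/eqP/ffunP => k; exact/eqP.
by rewrite mulr0n (bigD1 k)//= (negbTE nk) mulr0n mul0r.
Qed.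

Lemma prod_deltaR (K : comPzSemiRingType) (n : nat) (I : finType) (a b : tpow n I) :
  \prod_k ((a k == b k)%:R : K) = (a == b)%:R.
Proof. by rewrite (prod_delta a b (fun=> 1)) big1_eq. Qed.

Definition tensT n (X Y Z : finType) (T : X -> Y -> Z -> C) (x : tpow n X) (y : tpow n Y) (z : tpow n Z) : C :=
  \prod_k T (x k) (y k) (z k).

Definition tensp n (X : finType) (p : X -> R) (x : tpow n X) : R := \prod_k p (x k).

Lemma tensp_ge0 n (X : finType) (p : X -> R) (x : tpow n X) :
  (forall x, 0 <= p x) -> 0 <= tensp p x.
Proof. by move=> p0; apply: prodr_ge0 => k _. Qed.

Lemma tensp_sum n (X : finType) (p : X -> R) : \sum_x p x = 1 ->
  \sum_(x : tpow n X) tensp p x = 1.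
Proof. by move=> p1; rewrite (sum_tpow (fun=> p)) big1. Qed.

Lemma rc_prod n (f : 'I_n -> R) : (\prod_k f k)%:C = \prod_k (f k)%:C :> C.
Proof. by rewrite rmorph_prod. Qed.

Lemma tripartite_pow n (X Y Z : finType) (T : X -> Y -> Z -> C) p q r :
  tripartite T p q r -> tripartite (@tensT n X Y Z T) (tensp p) (tensp q) (tensp r).
Proof.
move=> tT; have [hp hq hr h1] := tT; split; last exact: tensp_sum.
- move=> x x'; rewrite inner_pair /tensp rc_prod -prod_delta.
  under [RHS]eq_bigr do rewrite -hp inner_pair.
  rewrite -(sum_tpow2 (fun k b c => (T (x k) b c)^* * T (x' k) b c)).
  apply: eq_bigr => y _; apply: eq_bigr => z _.
  by rewrite /tensT /= rmorph_prod -big_split.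
- move=> y y'; rewrite inner_pair /tensp rc_prod -prod_delta.
  under [RHS]eq_bigr do rewrite -hq inner_pair.
  rewrite -(sum_tpow2 (fun k a c => (T a (y k) c)^* * T a (y' k) c)).
  apply: eq_bigr => x _; apply: eq_bigr => z _.
  by rewrite /tensT /= rmorph_prod -big_split.
- move=> z z'; rewrite inner_pair /tensp rc_prod -prod_delta.
  under [RHS]eq_bigr do rewrite -hr inner_pair.
  rewrite -(sum_tpow2 (fun k a b => (T a b (z k))^* * T a b (z' k))).
  apply: eq_bigr => x _; apply: eq_bigr => y _.
  by rewrite /tensT /= rmorph_prod -big_split.
Qed.

(** The two blocks may carry different input states, hence different eigenbases. *)
Definition tens2 n1 n2 (I J : finType) (V V' : op R I J) :
    op R (tpow (n1 + n2) I) (tpow n1 J * tpow n2 J)%type :=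
  fun a x => (\prod_k V (a (lshift n2 k)) (x.1 k)) * (\prod_k V' (a (rshift n1 k)) (x.2 k)).

Lemma tens2_isometry n1 n2 (I J : finType) (V V' : op R I J) :
  is_isometry V -> is_isometry V' -> is_isometry (@tens2 n1 n2 I J V V').
Proof.
move=> iV iV' [x1 x2] [y1 y2]; rewrite /tens2 /=.
transitivity (\sum_(a : tpow (n1 + n2) I)
   (\prod_k ((V (a (lshift n2 k)) (x1 k))^* * V (a (lshift n2 k)) (y1 k))) *
   (\prod_k ((V' (a (rshift n1 k)) (x2 k))^* * V' (a (rshift n1 k)) (y2 k)))).
  by apply: eq_bigr => a _; rewrite !big_split rmorphM !rmorph_prod /=; ring.
rewrite (sum_tpow_add (fun k a => (V a (x1 k))^* * V a (y1 k))
   (fun k a => (V' a (x2 k))^* * V' a (y2 k))).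
under eq_bigr do rewrite iV; under [X in _ * X]eq_bigr do rewrite iV'.
by rewrite /idop !prod_deltaR -natrM mulnb xpair_eqE.
Qed.

Lemma tpow_eq_split n1 n2 (I : finType) (a b : tpow (n1 + n2) I) :
  (a == b) = [forall k, a (lshift n2 k) == b (lshift n2 k)] &&
             [forall k, a (rshift n1 k) == b (rshift n1 k)].
Proof.
apply/eqP/andP => [->|[/forallP h1 /forallP h2]]; first by split; apply/forallP.
apply/ffunP => k; rewrite -(splitK k); case: (fintype.split k) => j /=.
  exact/eqP/h1.
exact/eqP/h2.
Qed.

Lemma tens2_unitary n1 n2 (I J : finType) (V V' : op R I J) :
  unitary V -> unitary V' -> unitary (@tens2 n1 n2 I J V V').
Proof.
move=> [iV cV] [iV' cV']; split; first exact: tens2_isometry.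
move=> a b; rewrite /adjointop /tens2 sum_pair /=.
transitivity (\sum_(x1 : tpow n1 J) \sum_(x2 : tpow n2 J)
  (\prod_k (V (a (lshift n2 k)) (x1 k) * (V (b (lshift n2 k)) (x1 k))^*)) *
  (\prod_k (V' (a (rshift n1 k)) (x2 k) * (V' (b (rshift n1 k)) (x2 k))^*))).
  apply: eq_bigr => x1 _; apply: eq_bigr => x2 _.
  by rewrite conjCK rmorphM !big_split !rmorph_prod /=; ring.
under eq_bigr do rewrite -mulr_sumr.
rewrite -mulr_suml (sum_tpow (fun k x => V (a (lshift n2 k)) x * (V (b (lshift n2 k)) x)^*)).
rewrite (sum_tpow (fun k x => V' (a (rshift n1 k)) x * (V' (b (rshift n1 k)) x)^*)).
have cE (W : op R I J) (cW : is_isometry (adjointop W)) x y :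
    \sum_j W x j * (W y j)^* = (x == y)%:R.
  by rewrite -[(x == y)%:R]/(idop R x y) -cW; apply: eq_bigr => j _; rewrite /adjointop conjCK.
under eq_bigr do rewrite (cE _ cV); under [X in _ * X]eq_bigr do rewrite (cE _ cV').
have fE m (f : 'I_m -> bool) : \prod_k ((f k)%:R : C) = [forall k, f k]%:R.
  case: (boolP [forall k, f k]) => [/forallP h|].
    by rewrite big1// => k _; rewrite h.
  rewrite negb_forall => /existsP[k nk].
  by rewrite (bigD1 k)//= (negbTE nk) mul0r.
by rewrite !fE -natrM mulnb /idop tpow_eq_split.
Qed.

Lemma Utens_add (A B E : finType) (U : op R (B * E)%type A) n1 n2 y z a :
  Utens U (y, z) a = (\prod_(k < n1) U (y (lshift n2 k), z (lshift n2 k)) (a (lshift n2 k))) *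
    (\prod_(k < n2) U (y (rshift n1 k), z (rshift n1 k)) (a (rshift n1 k))).
Proof. by rewrite /Utens big_split_ord. Qed.

(** [u] is the Stinespring isometry written in the bases [V], [VY], [VZ]. *)
Definition intertwines (A B E X Y Z : finType) (U : op R (B * E)%type A) (V : op R A X)
    (VY : op R B Y) (VZ : op R E Z) (u : X -> Y -> Z -> C) :=
  forall x b c, \sum_a U (b, c) a * V a x = \sum_y \sum_z VY b y * VZ c z * u x y z.

Lemma intertwines_tens2 (A B E X Y Z : finType) (U : op R (B * E)%type A) n1 n2
    (V V' : op R A X) (VY VY' : op R B Y) (VZ VZ' : op R E Z) u u' :
  intertwines U V VY VZ u -> intertwines U V' VY' VZ' u' ->
  forall x yz, \sum_a Utens U yz a * @tens2 n1 n2 A X V V' a x =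
   \sum_y \sum_z tens2 VY VY' yz.1 y * tens2 VZ VZ' yz.2 z *
      (tensT u x.1 y.1 z.1 * tensT u' x.2 y.2 z.2).
Proof.
move=> h h' [x1 x2] [y z] /=.
transitivity (\sum_(a : tpow (n1 + n2) A)
  (\prod_k (U (y (lshift n2 k), z (lshift n2 k)) (a (lshift n2 k)) * V (a (lshift n2 k)) (x1 k))) *
  (\prod_k (U (y (rshift n1 k), z (rshift n1 k)) (a (rshift n1 k)) * V' (a (rshift n1 k)) (x2 k)))).
  by apply: eq_bigr => a _; rewrite Utens_add !big_split /tens2 /=; ring.
rewrite (sum_tpow_add (fun k a => U (y (lshift n2 k), z (lshift n2 k)) a * V a (x1 k))
   (fun k a => U (y (rshift n1 k), z (rshift n1 k)) a * V' a (x2 k))).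
under eq_bigr do rewrite h; under [X in _ * X]eq_bigr do rewrite h'.
rewrite -(sum_tpow2 (fun k b c => VY (y (lshift n2 k)) b * VZ (z (lshift n2 k)) c * u (x1 k) b c)).
rewrite -(sum_tpow2 (fun k b c => VY' (y (rshift n1 k)) b * VZ' (z (rshift n1 k)) c * u' (x2 k) b c)).
rewrite [RHS]sum_pair mulr_suml; apply: eq_bigr => b1 _.
under [RHS]eq_bigr do rewrite sum_pair.
rewrite [RHS]exchange_big mulr_suml; apply: eq_bigr => c1 _.
rewrite mulr_sumr; apply: eq_bigr => b2 _; rewrite mulr_sumr; apply: eq_bigr => c2 _.
by rewrite !big_split /tens2 /tensT /=; ring.
Qed.

End TensorPower.

(** * Diagonalisation of the marginals *)

Section Diagonalisation.
Variable R : realType.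
Local Notation C := R[i].

Lemma chan_psd (A B E : finType) (U : op R (B * E)%type A) (rho : op R A A) :
  psd rho -> psd (chan U rho).
Proof.
move=> prho; apply: (@psd_sum R E B predT (fun c => conjop (fun b a => U (b, c) a) rho)) => c _.
exact: psd_conjop.
Qed.

Lemma chanc_psd (A B E : finType) (U : op R (B * E)%type A) (rho : op R A A) :
  psd rho -> psd (chanc U rho).
Proof. exact: (chan_psd (fun x a => U (x.2, x.1) a)). Qed.

Lemma inner_adjointop (I : finType) (V : op R I I) (f h : vec R I) : is_isometry V ->
  inner (applyop (adjointop V) f) (applyop (adjointop V) h) = inner f h.
Proof.
move=> iV; have cV := isometry_adjoint iV.
rewrite /inner /applyop /adjointop.
transitivity (\sum_x \sum_y (f x)^* * h y * \sum_k V x k * (V y k)^*).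
  under [RHS]eq_bigr do under eq_bigr do rewrite mulr_sumr.
  under [RHS]eq_bigr do rewrite exchange_big.
  rewrite [RHS]exchange_big; apply: eq_bigr => k _ /=; rewrite conj_sum mulr_suml.
  apply: eq_bigr => x _; rewrite mulr_sumr; apply: eq_bigr => y _.
  by rewrite rmorphM /= conjCK; ring.
apply: eq_bigr => x _; under eq_bigr do rewrite cV mulrC.
by rewrite sum_delta.
Qed.

Lemma adjointop_unitary (I : finType) (V : op R I I) : is_isometry V -> unitary V.
Proof.
move=> iV; split=> // x y; rewrite /adjointop.
by under eq_bigr do rewrite conjCK; rewrite (isometry_adjoint iV).
Qed.

Lemma diagonal_marginal (J I : finType) (S : J -> vec R I) (V : op R I I) (q : I -> R) :
  is_isometry V ->
  (forall b b', \sum_j S j b * (S j b')^* = \sum_k V b k * (q k)%:C * (V b' k)^*) ->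
  forall y y', \sum_j (applyop (adjointop V) (S j) y)^* * applyop (adjointop V) (S j) y'
    = (q y)%:C *+ (y == y').
Proof.
move=> iV dec y y'; rewrite /applyop /adjointop.
transitivity (\sum_b \sum_b' V b y * (V b' y')^* * \sum_j S j b' * (S j b)^*).
  under [RHS]eq_bigr do under eq_bigr do rewrite mulr_sumr.
  under [RHS]eq_bigr do rewrite exchange_big.
  rewrite [RHS]exchange_big; apply: eq_bigr => j _ /=; rewrite conj_sum mulr_suml.
  apply: eq_bigr => b _; rewrite mulr_sumr; apply: eq_bigr => b' _.
  by rewrite rmorphM /= conjCK; ring.
transitivity (\sum_k (k == y)%:R * ((q k)%:C * (y' == k)%:R) : C); last first.
  by rewrite sum_deltaC mulr_natr eq_sym.
transitivity (\sum_k (\sum_b (V b k)^* * V b y) * (q k)%:C * (\sum_b' (V b' y')^* * V b' k)); last first.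
  by apply: eq_bigr => k _; rewrite !iV /idop mulrA.
under [RHS]eq_bigr do rewrite !mulr_suml.
rewrite [RHS]exchange_big; apply: eq_bigr => b _ /=.
under [RHS]eq_bigr do rewrite mulr_sumr.
rewrite [RHS]exchange_big; apply: eq_bigr => b' _ /=.
by rewrite dec mulr_sumr; apply: eq_bigr => k _; ring.
Qed.

Section Purification.
Variables (A B E : finType) (U : op R (B * E)%type A).
Variables (rho : op R A A) (V : op R A A) (p : A -> R).
Hypothesis p0 : forall x, 0 <= p x.
Hypothesis dec : forall a a', rho a a' = \sum_k V a k * (p k)%:C * (V a' k)^*.

Definition rotated (VY : op R B B) (VZ : op R E E) (x : A) (y : B) (z : E) : C :=
  \sum_b \sum_c (VY b y)^* * (VZ c z)^* * \sum_a U (b, c) a * V a x.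

Lemma rotated_marginal (VY : op R B B) (VZ : op R E E) (q : B -> R) :
  is_isometry VY -> is_isometry VZ ->
  (forall b b', chan U rho b b' = \sum_k VY b k * (q k)%:C * (VY b' k)^*) ->
  forall y y', inner (fun c : A * E => (Num.sqrt (p c.1))%:C * rotated VY VZ c.1 y c.2)
      (fun c => (Num.sqrt (p c.1))%:C * rotated VY VZ c.1 y' c.2) = (q y)%:C *+ (y == y').
Proof.
move=> iY iZ decB y y'.
pose w x b : vec R E := fun c => \sum_a U (b, c) a * V a x.
pose S (j : A * E) : vec R B := fun b => (Num.sqrt (p j.1))%:C * applyop (adjointop VZ) (w j.1 b) j.2.
have TE y0 (c : A * E) : (Num.sqrt (p c.1))%:C * rotated VY VZ c.1 y0 c.2 =
    applyop (adjointop VY) (S c) y0.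
  rewrite /applyop /adjointop /S /rotated mulr_sumr; apply: eq_bigr => b _.
  rewrite /applyop [RHS]mulrCA; congr (_ * _); rewrite mulr_sumr.
  by apply: eq_bigr => e _; rewrite /w mulrA.
rewrite /inner; under eq_bigr do rewrite !TE.
apply: (diagonal_marginal iY) => b b'; rewrite -decB sum_pair /chan /=.
transitivity (\sum_x (p x)%:C * inner (w x b') (w x b)).
  apply: eq_bigr => x _.
  rewrite -(inner_adjointop _ _ iZ) /inner mulr_sumr; apply: eq_bigr => z _.
  rewrite /S /= rmorphM /= conj_rc -{3}(sqr_sqrtr (p0 x)) rmorphXn /=; ring.
transitivity (\sum_x \sum_c (p x)%:C * ((w x b' c)^* * w x b c)).
  by apply: eq_bigr => x _; rewrite /inner mulr_sumr.
rewrite exchange_big; apply: eq_bigr => c _ /=.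
transitivity (\sum_a \sum_a' \sum_x (p x)%:C * (U (b, c) a * V a x * (U (b', c) a' * V a' x)^*)).
  under [RHS]eq_bigr do rewrite exchange_big /=.
  rewrite [RHS]exchange_big; apply: eq_bigr => x _ /=.
  rewrite /w conj_sum [X in _ * X = _]mulrC mulr_suml mulr_sumr; apply: eq_bigr => a _.
  by rewrite !mulr_sumr.
apply: eq_bigr => a _; apply: eq_bigr => a' _.
rewrite dec mulr_sumr mulr_suml; apply: eq_bigr => x _.
by rewrite rmorphM /=; ring.
Qed.

Hypothesis iU : is_isometry U.
Hypothesis iV : is_isometry V.
Hypothesis sum_p : \sum_x p x = 1.

Lemma rotated_orthonormal (VY : op R B B) (VZ : op R E E) x x' :
  is_isometry VY -> is_isometry VZ ->
  inner (fun c : B * E => rotated VY VZ x c.1 c.2) (fun c => rotated VY VZ x' c.1 c.2) = (x == x')%:R.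
Proof.
move=> iY iZ.
pose VV : op R (B * E)%type (B * E)%type := fun x y => VY x.1 y.1 * VZ x.2 y.2.
pose w x : vec R (B * E)%type := applyop U (V^~ x).
have e x0 : (fun c : B * E => rotated VY VZ x0 c.1 c.2) = applyop (adjointop VV) (w x0).
  apply/boolp.funext => -[y z]; rewrite /applyop sum_pair; apply: eq_bigr => b _.
  by apply: eq_bigr => c _; rewrite /adjointop /VV rmorphM.
rewrite !e inner_adjointop; last exact: tensor_isometry.
rewrite /w -(applyop_adjoint (V^~ x') iU).
have adj (f : vec R A) h : inner (applyop U f) h = inner f (applyop (adjointop U) h).
  rewrite /inner /applyop /adjointop.
  under eq_bigr do rewrite conj_sum mulr_suml.
  rewrite exchange_big; apply: eq_bigr => a _ /=; rewrite mulr_sumr.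
  by apply: eq_bigr => b _; rewrite rmorphM /=; ring.
by rewrite adj !(applyop_adjoint _ iU); exact: iV.
Qed.

End Purification.

(** The complementary channel is the channel of [U] with its outputs exchanged, so Charlie's
    marginal follows from the computation of Bob's. *)
Lemma rotated_swap (A B E : finType) (U : op R (B * E)%type A) (V : op R A A) (VY : op R B B) (VZ : op R E E) x y z :
  rotated U V VY VZ x y z = rotated (fun a => U (a.2, a.1)) V VZ VY x z y.
Proof.
rewrite /rotated exchange_big; apply: eq_bigr => c _; apply: eq_bigr => b _.
by rewrite [_ * (VY b y)^*]mulrC.
Qed.

Lemma purification_tripartite (A B E : finType) (U : op R (B * E)%type A) (rho V : op R A A)
    (p : A -> R) (VY : op R B B) (VZ : op R E E) (q : B -> R) (r : E -> R) :
  (forall x, 0 <= p x) -> (forall a a', rho a a' = \sum_k V a k * (p k)%:C * (V a' k)^*) ->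
  is_isometry U -> is_isometry V -> \sum_x p x = 1 -> is_isometry VY -> is_isometry VZ ->
  (forall b b', chan U rho b b' = \sum_k VY b k * (q k)%:C * (VY b' k)^*) ->
  (forall c c', chanc U rho c c' = \sum_k VZ c k * (r k)%:C * (VZ c' k)^*) ->
  tripartite (fun x y z => (Num.sqrt (p x))%:C * rotated U V VY VZ x y z) p q r.
Proof.
move=> p0 dec iU iV sum_p iY iZ decB decE; split=> //.
- move=> x x'.
  transitivity ((Num.sqrt (p x))%:C * (Num.sqrt (p x'))%:C *
      inner (fun c : B * E => rotated U V VY VZ x c.1 c.2) (fun c => rotated U V VY VZ x' c.1 c.2)).
    by rewrite /inner mulr_sumr; apply: eq_bigr => c _; rewrite rmorphM /= conj_rc; ring.
  rewrite (rotated_orthonormal iU iV)//; have [<-|] := eqVneq x x'; last by rewrite mulr0.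
  by rewrite mulr1 -rmorphM /= -expr2 sqr_sqrtr.
- exact: (rotated_marginal p0 dec).
- move=> z z'.
  have := @rotated_marginal A E B (fun a => U (a.2, a.1)) rho V p p0 dec VZ VY r iZ iY decE z z'.
  move=> <-; congr inner; apply/boolp.funext => c; by rewrite rotated_swap.
Qed.

Lemma spectrum_ge0 (I : finType) (A : op R I I) lam : psd A -> spectrum_of A lam ->
  forall k, 0 <= lam k.
Proof.
move=> pA [V [iV dec]] k.
pose D : op R I I := fun a b => (a == b)%:R * (lam a)%:C.
have AE : A = conjop V D.
  apply/boolp.funext => x; apply/boolp.funext => y; rewrite dec /conjop.
  apply: eq_bigr => a _.
  transitivity (\sum_b (a == b)%:R * (V x a * (lam a)%:C * (V y b)^*)); first by rewrite sum_delta.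
  by apply: eq_bigr => b _; rewrite /D; ring.
pose d : vec R I := fun a => (a == k)%:R.
have := pA (applyop V d); rewrite AE inner_conjop applyop_adjoint// quad_form.
have -> : \sum_i \sum_j (d i)^* * D i j * d j = (lam k)%:C.
  transitivity (\sum_i (i == k)%:R * \sum_j (j == k)%:R * D i j).
    apply: eq_bigr => i _; rewrite mulr_sumr; apply: eq_bigr => j _.
    by rewrite /d conj_bool; ring.
  by rewrite !sum_deltaC /D eqxx mul1r.
by rewrite ler0c.
Qed.

Lemma spectrum_sum (I : finType) (A : op R I I) lam : trace A = 1 -> spectrum_of A lam ->
  \sum_k lam k = 1.
Proof.
move=> tA [V [iV dec]]; apply: rc_inj; rewrite rc_sum -[RHS]tA /trace.
under [RHS]eq_bigr do rewrite dec.
rewrite exchange_big; apply: eq_bigr => k _ /=.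
transitivity (\sum_i (lam k)%:C * ((V i k)^* * V i k)).
  by rewrite -mulr_sumr iV /idop eqxx mulr1.
by apply: eq_bigr => i _; ring.
Qed.

(** The index [x] plays the purifying system. The weights are the lists [spec] themselves, so that
    [entropy] unfolds to [shannon] of a marginal. *)
Lemma state_diagonal (A B E : finType) (U : op R (B * E)%type A) (rho : op R A A) :
  is_isometry U -> is_state rho ->
  exists (V : op R A A) (VY : op R B B) (VZ : op R E E) (u : A -> B -> E -> C),
  [/\ unitary V, unitary VY, unitary VZ, intertwines U V VY VZ u &
   tripartite (fun x y z => (Num.sqrt (spec rho x))%:C * u x y z)
     (spec rho) (spec (chan U rho)) (spec (chanc U rho))].
Proof.
move=> iU [prho trho].
have specr := psd_spectrum prho.
have p0 := spectrum_ge0 prho specr; have p1 := spectrum_sum trho specr.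
have [V [iV dec]] := specr.
have [VY [iY decB]] := psd_spectrum (chan_psd U prho).
have [VZ [iZ decE]] := psd_spectrum (chanc_psd U prho).
exists V, VY, VZ, (rotated U V VY VZ); split; try exact: adjointop_unitary.
  move=> x b c.
  pose VV : op R (B * E)%type (B * E)%type := fun x y => VY x.1 y.1 * VZ x.2 y.2.
  pose w : vec R (B * E)%type := applyop U (V^~ x).
  have [_ iVV] : unitary VV by apply: adjointop_unitary; exact: tensor_isometry.
  have e : adjointop (adjointop VV) = VV.
    by do 2 (apply/boolp.funext => ?); rewrite /adjointop conjCK.
  have := applyop_adjoint w iVV; rewrite e => /(congr1 (fun f => f (b, c))).
  move=> /= h; rewrite -[LHS]/(w (b, c)) -h {1}/applyop sum_pair; apply: eq_bigr => y _; apply: eq_bigr => z _.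
  rewrite /VV /=; congr (_ * _); rewrite /applyop sum_pair /rotated.
  by apply: eq_bigr => b' _; apply: eq_bigr => c' _; rewrite /adjointop /= rmorphM.
exact: (purification_tripartite p0 dec iU iV p1 iY iZ decB decE).
Qed.

End Diagonalisation.

(** * Typical sequences *)

Section Typicality.
Variable R : realType.

Definition pow2 (y : R) : R := expR (y * ln 2).

Let ln2 : 0 < ln (2 : R). Proof. by rewrite ln_gt0// ltr1n. Qed.

Lemma pow2_gt0 y : 0 < pow2 y. Proof. exact: expR_gt0. Qed.

Lemma pow2D x y : pow2 (x + y) = pow2 x * pow2 y.
Proof. by rewrite /pow2 mulrDl expRD. Qed.

Lemma pow2N x : pow2 (- x) = (pow2 x)^-1.
Proof. by rewrite /pow2 mulNr expRN. Qed.

Lemma pow2_0 : pow2 0 = 1. Proof. by rewrite /pow2 mul0r expR0. Qed.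

Lemma ler_pow2 x y : (pow2 x <= pow2 y) = (x <= y).
Proof. by rewrite ler_expR ler_pM2r. Qed.

Lemma pow2_log2 (x : R) : 0 < x -> pow2 (log2 x) = x.
Proof. by move=> x0; rewrite /pow2 /log2 divfK ?gt_eqF// lnK. Qed.

Variables (X : finType) (p : X -> R).
Hypothesis p0 : forall x, 0 <= p x.
Hypothesis p1 : \sum_x p x = 1.

(* Junk value: the surprisal is [0] where [p x = 0]. *)
Definition surprisal x : R := - log2 (p x).

Definition shannon : R := - \sum_x xlog2 (p x).

Lemma shannonE : shannon = \sum_x p x * surprisal x.
Proof.
rewrite /shannon -sumrN; apply: eq_bigr => x _; rewrite /xlog2 /surprisal.
by case: eqP => [->|_]; rewrite ?mul0r ?oppr0// mulrN.
Qed.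

Lemma prob_le1 x : p x <= 1.
Proof. by rewrite -p1 (bigD1 x)//= lerDl sumr_ge0. Qed.

Lemma surprisal_ge0 x : 0 <= surprisal x.
Proof.
rewrite /surprisal oppr_ge0 /log2 pmulr_lle0 ?invr_gt0//.
by rewrite ln_le0// prob_le1.
Qed.

Lemma shannon_ge0 : 0 <= shannon.
Proof. by rewrite shannonE sumr_ge0// => x _; rewrite mulr_ge0// surprisal_ge0. Qed.

Definition varentropy : R := \sum_x p x * (surprisal x - shannon) ^+ 2.

Lemma varentropy_ge0 : 0 <= varentropy.
Proof. by rewrite sumr_ge0// => x _; rewrite mulr_ge0// sqr_ge0. Qed.

(** The letters are independent and centred, so the mixed terms vanish. *)
Lemma variance_tensor n (Y : X -> R) : \sum_x p x * Y x = 0 ->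
  \sum_(x : tpow n X) tensp p x * (\sum_k Y (x k)) ^+ 2 = n%:R * \sum_x p x * Y x ^+ 2.
Proof.
move=> Y0.
transitivity (\sum_k \sum_l \sum_(x : tpow n X) tensp p x * (Y (x k) * Y (x l))).
  under [RHS]eq_bigr do rewrite exchange_big /=.
  rewrite [RHS]exchange_big; apply: eq_bigr => x _ /=.
  rewrite expr2 mulr_suml mulr_sumr; apply: eq_bigr => k _.
  by rewrite mulr_sumr mulr_sumr.
have E k l : \sum_(x : tpow n X) tensp p x * (Y (x k) * Y (x l)) =
    \prod_j \sum_a p a * ((if j == k then Y a else 1) * (if j == l then Y a else 1)).
  rewrite -(sum_tpow (fun j a => p a * ((if j == k then Y a else 1) * (if j == l then Y a else 1)))).
  apply: eq_bigr => x _; rewrite !big_split /=; congr (_ * (_ * _));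
  by rewrite -big_mkcond big_pred1_eq.
transitivity (\sum_(k < n) \sum_x p x * Y x ^+ 2); last first.
  by rewrite sumr_const card_ord -[_ *+ n]mulr_natl.
apply: eq_bigr => k _; rewrite (bigD1 k)//= [X in _ + X]big1 ?addr0 => [|l lk].
  rewrite E (bigD1 k)//= eqxx [X in _ * X]big1 => [|j jk].
    by rewrite mulr1; apply: eq_bigr => a _; rewrite expr2.
  by rewrite (negbTE jk); under eq_bigr do rewrite !mulr1.
rewrite E (bigD1 k)//= eqxx eq_sym (negbTE lk).
by under eq_bigr do rewrite mulr1; rewrite Y0 mul0r.
Qed.

(** [d] bounds the total deviation, not that per letter. A sequence with a letter of probability 0
    may count as typical; its probability is 0, and both bounds on typical probabilities hold for
    it, as [0^-1 = 0]. *)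
Definition typical n (d : R) (x : tpow n X) : bool :=
  `|\sum_k surprisal (x k) - n%:R * shannon| <= d.

(** Chebyshev's inequality. *)
Lemma atypical_mass n d : 0 < d ->
  \sum_(x : tpow n X) (~~ typical d x)%:R * tensp p x <= n%:R * varentropy / d ^+ 2.
Proof.
move=> d0; rewrite /varentropy -(variance_tensor n (Y := fun x => surprisal x - shannon)); last first.
  under eq_bigr do rewrite mulrBr.
  by rewrite sumrB -mulr_suml p1 mul1r -shannonE subrr.
rewrite mulr_suml; apply: ler_sum => x _.
have t0 := tensp_ge0 x p0.
rewrite sumrB sumr_const card_ord -[_ *+ n]mulr_natl.
rewrite /typical -ltNge; case: ltP => h; rewrite ?mul0r ?mul1r; last first.
  by rewrite divr_ge0// ?sqr_ge0// mulr_ge0// sqr_ge0.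
rewrite -mulrA ler_peMr// ler_pdivlMr ?exprn_gt0// mul1r -[leRHS]real_normK ?num_real//.
by rewrite ler_sqr ?nnegrE ?(ltW d0)//; exact: ltW.
Qed.

Lemma tensp_pow2 n (x : tpow n X) : tensp p x = 0 \/ tensp p x = pow2 (- \sum_k surprisal (x k)).
Proof.
have [/existsP[k /eqP pk]|] := boolP [exists k, p (x k) == 0].
  by left; rewrite /tensp (bigD1 k)//= pk mul0r.
rewrite negb_exists => /forallP h; right.
rewrite -sumrN /pow2 mulr_suml expR_sum; apply: eq_bigr => k _.
by rewrite opprK -/(pow2 _) pow2_log2// lt_def h p0.
Qed.

Lemma typical_le n d (x : tpow n X) : typical d x -> tensp p x <= pow2 (- (n%:R * shannon - d)).
Proof.
rewrite /typical ler_norml => /andP[h1 h2].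
have [->|->] := tensp_pow2 x; first exact/ltW/pow2_gt0.
by rewrite ler_pow2; lra.
Qed.

Lemma typical_inv_le n d (x : tpow n X) : typical d x -> (tensp p x)^-1 <= pow2 (n%:R * shannon + d).
Proof.
rewrite /typical ler_norml => /andP[h1 h2].
have [->|->] := tensp_pow2 x; first by rewrite invr0; exact/ltW/pow2_gt0.
by rewrite -pow2N ler_pow2; lra.
Qed.

End Typicality.

Section TypicalMass.
Variable R : realType.
Local Notation C := R[i].

(** The cutoffs act on different systems and are diagonal in the chosen bases, so for each amplitude
    this is an inequality between indicators. *)
Lemma union_bound (X Y Z : finType) (T : X -> Y -> Z -> C) p q r (P : Y -> bool) (Q : Z -> bool) :
  tripartite T p q r ->
  1 - (\sum_y (~~ P y)%:R * q y + \sum_z (~~ Q z)%:R * r z) <=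
  \sum_x \sum_y \sum_z (P y)%:R * (Q z)%:R * sqn (T x y z).
Proof.
move=> tT; rewrite -{1}(tri_total tT).
have -> : \sum_y (~~ P y)%:R * q y = \sum_x \sum_y \sum_z (~~ P y)%:R * sqn (T x y z).
  rewrite exchange_big; apply: eq_bigr => y _; rewrite (tri_q tT) mulr_sumr.
  by apply: eq_bigr => x _; rewrite mulr_sumr.
have -> : \sum_z (~~ Q z)%:R * r z = \sum_x \sum_y \sum_z (~~ Q z)%:R * sqn (T x y z).
  under [RHS]eq_bigr do rewrite exchange_big.
  rewrite [RHS]exchange_big; apply: eq_bigr => z _; rewrite (tri_r tT) mulr_sumr.
  by apply: eq_bigr => x _; rewrite mulr_sumr.
rewrite -big_split -sumrB /=; apply: ler_sum => x _.
rewrite -big_split -sumrB /=; apply: ler_sum => y _.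
rewrite -big_split -sumrB /=; apply: ler_sum => z _.
have s0 := sqn_ge0 (T x y z).
by case: (P y); case: (Q z); rewrite /= ?(mul0r, mul1r, mulr0, add0r, addr0); lra.
Qed.

End TypicalMass.

(** * Codes on typical sequences *)

Section Blocks.
Variable R : realType.
Local Notation C := R[i].
Variables (X Y Z : finType) (T : X -> Y -> Z -> C) (p : X -> R) (q : Y -> R) (r : Z -> R).
Hypothesis tT : tripartite T p q r.

Let p0 := tri_p_ge0 tT.
Let q0 := tri_q_ge0 tT.
Let r0 := tri_r_ge0 tT.
Let p1 := tri_sum_p tT.
Let q1 := tri_sum_q tT.
Let r1 := tri_sum_r tT.

Lemma codeword_unit n N (w : phases ('I_N * tpow n X)%type) m :
  \sum_y \sum_z sqn (codeword (@tensT R n X Y Z T) w m y z) = 1.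
Proof. by rewrite -(codeword_nrm (tripartite_pow n tT) w m) nrm_pair. Qed.

Lemma identifiable_typical n N (d : R) : (0 < N)%N -> 0 < d ->
  exists w : phases ('I_N * tpow n X)%type,
   identifiable (fun y : tpow n Y => (typical q d y)%:R * tensp q y)
    (codeword (@tensT R n X Y Z T) w)
    (3 * ((n%:R * varentropy q + n%:R * varentropy r) / d ^+ 2) +
       N%:R * pow2 (n%:R * (shannon q - shannon r) + 2 * d)).
Proof.
move=> N0 d0; have tT' := tripartite_pow n tT.
have heta : 1 - (n%:R * varentropy q + n%:R * varentropy r) / d ^+ 2 <=
    \sum_(x : tpow n X) \sum_(y : tpow n Y) \sum_(z : tpow n Z) (typical q d y)%:R * (typical r d z)%:R * sqn (tensT T x y z).
  apply: le_trans (union_bound (typical q d) (typical r d) tT'); rewrite lerD2l lerN2 mulrDl.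
  by rewrite lerD ?atypical_mass.
have [w [W [cW hW]]] := random_code_identifiable tT' (N := N) (ltW (pow2_gt0 _)) (ltW (pow2_gt0 _))
  (fun y => typical_inv_le q0 (d := d) (x := y))
  (fun z => typical_le r0 (d := d) (x := z)) heta N0.
exists w, W; split=> //; apply: le_trans hW _; rewrite ler_wpM2l// lerD2l -mulrA -pow2D.
by rewrite ler_wpM2l// ler_pow2; lra.
Qed.

(** An empty first block with one message makes a code on the second block alone an instance of
    [compose]. *)
Lemma identifiable_trivial :
  exists w : phases ('I_1 * tpow 0 X)%type,
   identifiable (fun _ : tpow 0 Y => 1 : R) (codeword (@tensT R 0 X Y Z T) w) 0.
Proof.
have card0 (I : finType) : #|{: tpow 0 I}| = 1 by rewrite card_ffun card_ord expn0.
pose e (I : finType) : tpow 0 I := ffun0 (card_ord 0).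
have tp1 (I : finType) (a : tpow 0 I) : a = e I by apply/ffunP => -[].
have s1 (K : nmodType) (I : finType) (F : tpow 0 I -> K) : \sum_a F a = F (e I).
  rewrite (big_pred1 (e I))// => a; rewrite [a]tp1; symmetry; apply/eqP; exact: tp1.
exists [ffun=> ord0], (fun _ _ => 1); split=> [v|].
  rewrite nrm_pair big_ord1 s1 s1 /nrm !s1 conjC1 mul1r.
  by [].
rewrite big_ord1 nrm_pair s1 sum_pair big_ord1 s1 s1 /= eqxx mul1r sqrtr1 conjC1 mul1r.
rewrite /codeword s1 /phase ffunE expr0 mul1r /tensT big_ord0 subrr sqn0 mulr0.
by [].
Qed.

Lemma decodable_typical n N (d t : R) (V : finType) (g : V -> R) (gmax etag : R) :
  (0 < N)%N -> 0 < d -> 0 < t -> (forall v, 0 <= g v) -> \sum_v g v <= 1 ->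
  1 - etag <= \sum_v g v -> (forall v, g v <= gmax) -> 0 <= gmax <= 1 ->
  let eta := (n%:R * varentropy p + n%:R * varentropy q) / d ^+ 2 in
  exists w : phases ('I_N * tpow n X)%type,
   decodable g (codeword (@tensT R n X Y Z T) w)
    (3 * etag + 3 * eta + gmax * eta ^+ 2 +
     N%:R * (pow2 (- (n%:R * shannon p - d)) + gmax * pow2 (- (n%:R * shannon q - d))) + t + eta / t).
Proof.
move=> N0 d0 t0 g0 g1 geta ggmax gmax1 eta; have tT' := tripartite_pow n tT.
have heta : 1 - eta <=
    \sum_(x : tpow n X) \sum_(y : tpow n Y) \sum_(z : tpow n Z) (typical p d x && typical q d y)%:R * sqn (tensT T x y z).
  (* Two rotations move the systems to be cut off, the first and the second, to the last two
     places. *)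
  have := union_bound (typical p d) (typical q d) (tripartite_rot (tripartite_rot tT')).
  under [X in _ <= X -> _]eq_bigr do under eq_bigr do under eq_bigr do rewrite -natrM mulnb.
  rewrite exchange_big; under [X in _ <= X -> _]eq_bigr do rewrite exchange_big.
  apply: le_trans; rewrite lerD2l lerN2 /eta mulrDl.
  by rewrite lerD ?atypical_mass.
have [w [W [cW hW]]] := random_code_decodable tT' g0 g1 geta ggmax gmax1 (ltW (pow2_gt0 _)) (ltW (pow2_gt0 _)) t0
  (fun x => typical_le p0 (d := d) (x := x)) (fun y => typical_le q0 (d := d) (x := y)) heta N0.
exists w.
have hF th := coisometric_povm (Ordinal N0) (cW th).
have [F hF'] := boolp.choice hF.
exists F; split=> [th|]; first by case: (hF' th).
apply: le_trans hW; apply: ler_sum => i _; rewrite lerD2l lerN2; apply: ler_avg => th.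
have [_ /(_ i)[Q [pQ hQ]]] := hF' th.
have -> : F th i = fun x y => rank1 ((W th)^~ i) x y + Q x y.
  by do 2 (apply/boolp.funext => ?).
rewrite qform_add -[leLHS]addr0 lerD ?qform_ge0// qform_rank1.
by rewrite /inner.
Qed.

(** With one message the only loss is the mass missing from [g]; this closes a code decoded by
    Charlie alone. *)
Lemma decodable_trivial n (V : finType) (g : V -> R) (etag : R) :
  (forall v, 0 <= g v) -> 1 - etag <= \sum_v g v ->
  exists w : phases ('I_1 * tpow n X)%type,
   decodable g (codeword (@tensT R n X Y Z T) w) etag.
Proof.
move=> g0 geta; exists [ffun=> ord0], (fun _ _ => @idop R _); split=> [th|].
  by split=> [k|x y]; [exact: psd_idop|rewrite big_ord1].
rewrite big_ord1; under eq_avg do rewrite qform_id.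
rewrite steered_nrm// codeword_unit; lra.
Qed.

End Blocks.

Section Assembly.
Variable R : realType.
Local Notation C := R[i].

Lemma EA_code_of_blocks (A B E : finType) (U : op R (B * E)%type A)
    (V V' : op R A A) (VY VY' : op R B B) (VZ VZ' : op R E E) (u u' : A -> B -> E -> C)
    (p p' : A -> R) (q q' : B -> R) (r r' : E -> R)
    (n1 n2 N1 N2 N : nat) (g : tpow n1 B -> R) (w1 : phases ('I_N1 * tpow n1 A)%type)
    (w2 : phases ('I_N2 * tpow n2 A)%type) (e1 e2 t eps : R) :
  let T := fun x y z => (Num.sqrt (p x))%:C * u x y z in
  let T' := fun x y z => (Num.sqrt (p' x))%:C * u' x y z in
  unitary V -> unitary V' -> unitary VY -> unitary VY' -> unitary VZ -> unitary VZ' ->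
  intertwines U V VY VZ u -> intertwines U V' VY' VZ' u' ->
  tripartite T p q r -> tripartite T' p' q' r' ->
  (forall v, 0 <= g v) -> \sum_v g v <= 1 ->
  identifiable g (codeword (tensT T) w1) e1 -> decodable g (codeword (tensT T') w2) e2 ->
  0 < t -> 0 < eps -> e2 + t + e1 / t <= eps / 2 -> (0 < N)%N -> (N.*2 <= N1 * N2)%N ->
  EA_code U (n1 + n2) N eps.
Proof.
move=> T T' uV uV' uY uY' uZ uZ' iU iU' tT tT' g0 g1 id1 de2 t0 eps0 he N0 hN.
have [m0] : exists m0 : 'I_N1, true.
  have N10 : (0 < N1)%N by case: (N1) hN N0 => // ; case: (N).
  by exists (Ordinal N10).
move=> _.
have [f [df sf]] := compose g0 g1 (codeword_unit tT' w2) m0 t0 id1 de2.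
have unitj mi : nrm (joint_state (codeword (tensT T) w1) (codeword (tensT T') w2) mi) = 1.
  rewrite nrm_pair sum_pair.
  transitivity ((\sum_y \sum_z sqn (codeword (tensT T) w1 mi.1 y z)) *
     (\sum_y \sum_z sqn (codeword (tensT T') w2 mi.2 y z))); last by rewrite (codeword_unit tT) (codeword_unit tT') mulr1.
  rewrite mulr_suml; apply: eq_bigr => y1 _; rewrite mulr_sumr; apply: eq_bigr => y2 _.
  rewrite sum_pair mulr_suml; apply: eq_bigr => z1 _; rewrite mulr_sumr; apply: eq_bigr => z2 _.
  by rewrite /joint_state /= sqnM.
have cardM : #|{: 'I_N1 * 'I_N2}| = (N1 * N2)%N by rewrite card_prod !card_ord.
have hsum : \sum_mi (1 - f mi) <= #|{: 'I_N1 * 'I_N2}|%:R * (eps / 2).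
  by rewrite cardM; apply: le_trans sf _; rewrite ler_wpM2l.
have [h dh] := expurgate unitj df eps0 hsum N0 (eq_ind_r (fun k => (N.*2 <= k)%N) hN cardM).
pose psi (j : 'I_N) : vec R (tpow n1 A * tpow n2 A)%type := fun x =>
  (phase R w1 ((h j).1, x.1) * \prod_k (Num.sqrt (p (x.1 k)))%:C) *
  (phase R w2 ((h j).2, x.2) * \prod_k (Num.sqrt (p' (x.2 k)))%:C).
have amp (n : nat) (P : A -> R) (x : tpow n A) (c : C) : (forall x, 0 <= P x) -> c^* * c = 1 ->
    sqn (c * \prod_k (Num.sqrt (P (x k)))%:C) = tensp P x.
  move=> P0 c1; rewrite sqnM sqn_Re c1 mul1r -rc_prod sqn_rc expr2 -big_split.
  by apply: eq_bigr => k _; rewrite /= -expr2 sqr_sqrtr.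
apply: (@EA_code_transport R A B E U (n1 + n2) N eps _ _ _
   (fun x y z => tensT u x.1 y.1 z.1 * tensT u' x.2 y.2 z.2)
   (tens2 V V') (tens2 VY VY') (tens2 VZ VZ') psi).
- by apply: tens2_isometry; [case: uV|case: uV'].
- exact: tens2_unitary.
- exact: tens2_unitary.
- exact: intertwines_tens2.
- move=> j; rewrite nrm_pair.
  rewrite -[RHS]mulr1 -{1}(tensp_sum n1 (tri_sum_p tT)) -(tensp_sum n2 (tri_sum_p tT')).
  rewrite mulr_suml; apply: eq_bigr => x1 _; rewrite mulr_sumr; apply: eq_bigr => x2 _.
  rewrite /psi /= sqnM (amp n1 p)//; [rewrite (amp n2 p')//|exact: tri_p_ge0 tT|exact: phase_norm].
    exact: tri_p_ge0 tT'.
  exact: phase_norm.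
- have -> : (fun i (a : (tpow n1 B * tpow n2 B) * (tpow n1 E * tpow n2 E)) =>
      \sum_x psi i x * (tensT u x.1 a.1.1 a.2.1 * tensT u' x.2 a.1.2 a.2.2)) =
      joint_state (codeword (tensT T) w1) (codeword (tensT T') w2) \o h.
    apply/boolp.funext => j; apply/boolp.funext => a; rewrite /joint_state /= /codeword sum_pair mulr_suml.
    apply: eq_bigr => x1 _; rewrite mulr_sumr; apply: eq_bigr => x2 _.
    by rewrite /psi /tensT /T /T' !big_split /=; ring.
  exact: dh.
Qed.

End Assembly.

(** * Entropy inequality and capacity bounds *)

Section Subadditivity.
Variable R : realType.
Local Notation C := R[i].

Lemma ln_le_subr1 (x : R) : 0 < x -> ln x <= x - 1.
Proof. by move=> x0; have := @le_ln1Dx R (x - 1); rewrite [1 + _]addrC subrK; apply; lra. Qed.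

Lemma shannon_ln2 (X : finType) (p : X -> R) :
  shannon p * ln 2 = - \sum_x p x * ln (p x).
Proof.
have ln2 : 0 < ln (2 : R) by rewrite ln_gt0// ltr1n.
rewrite shannonE mulr_suml -sumrN; apply: eq_bigr => x _.
by rewrite /surprisal /log2; field; rewrite gt_eqF.
Qed.

(* With the overlaps [sqn (T x y z) / q y], whose sum over [y] is at most [1] by
   Bessel, this is the nonnegativity of a relative entropy. *)
Lemma shannon_subadditive (X Y Z : finType) (T : X -> Y -> Z -> C) p q r :
  tripartite T p q r -> shannon q <= shannon p + shannon r.
Proof.
move=> tT; have ln2 : 0 < ln (2 : R) by rewrite ln_gt0// ltr1n.
have p0 := tri_p_ge0 tT; have q0 := tri_q_ge0 tT; have r0 := tri_r_ge0 tT.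
rewrite -(ler_pM2r ln2) mulrDl !shannon_ln2 -subr_ge0.
pose P x y z := sqn (T x y z).
have P0 x y z : 0 <= P x y z by exact: sqn_ge0.
have Pp x y z : P x y z <= p x.
  rewrite (tri_p tT) (bigD1 y)//= (bigD1 z)//= -addrA lerDl addr_ge0 ?sumr_ge0// => *.
    exact: sqn_ge0.
  by apply: sumr_ge0 => *; exact: sqn_ge0.
have Pq x y z : P x y z <= q y.
  rewrite (tri_q tT) (bigD1 x)//= (bigD1 z)//= -addrA lerDl addr_ge0 ?sumr_ge0// => *.
    exact: sqn_ge0.
  by apply: sumr_ge0 => *; exact: sqn_ge0.
have Pr x y z : P x y z <= r z.
  rewrite (tri_r tT) (bigD1 x)//= (bigD1 y)//= -addrA lerDl addr_ge0 ?sumr_ge0// => *.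
    exact: sqn_ge0.
  by apply: sumr_ge0 => *; exact: sqn_ge0.
have -> : \sum_x p x * ln (p x) = \sum_x \sum_y \sum_z P x y z * ln (p x).
  apply: eq_bigr => x _; rewrite (tri_p tT) mulr_suml.
  by apply: eq_bigr => y _; rewrite mulr_suml.
have -> : \sum_y q y * ln (q y) = \sum_x \sum_y \sum_z P x y z * ln (q y).
  rewrite exchange_big; apply: eq_bigr => y _; rewrite (tri_q tT) mulr_suml.
  by apply: eq_bigr => x _; rewrite mulr_suml.
have -> : \sum_z r z * ln (r z) = \sum_x \sum_y \sum_z P x y z * ln (r z).
  under [RHS]eq_bigr do rewrite exchange_big.
  rewrite [RHS]exchange_big; apply: eq_bigr => z _; rewrite (tri_r tT) mulr_suml.
  by apply: eq_bigr => x _; rewrite mulr_suml.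
(* [ln s <= s - 1] at [s = p x * r z / q y]; where the amplitude is nonzero, all three weights are
   positive. *)
have pt x y z : P x y z * ln (p x) + P x y z * ln (r z) - P x y z * ln (q y) <=
    p x * r z * (P x y z / q y) - P x y z.
  have [e|n] := eqVneq (P x y z) 0; first by rewrite e !(mul0r, mulr0); lra.
  have Pgt : 0 < P x y z by rewrite lt_def n P0.
  have pp := lt_le_trans Pgt (Pp x y z); have qp := lt_le_trans Pgt (Pq x y z).
  have rp := lt_le_trans Pgt (Pr x y z).
  have := ln_le_subr1 (divr_gt0 (mulr_gt0 pp rp) qp).
  rewrite ln_div ?posrE ?mulr_gt0// lnM ?posrE// => h.
  have := ler_wpM2l (P0 x y z) h.
  have -> : P x y z * (p x * r z / q y - 1) = p x * r z * (P x y z / q y) - P x y z by ring.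
  by move=> h2; lra.
have bes x z : \sum_y P x y z / q y <= 1.
  have [_ ortho _ _] := tT.
  pose d : vec R (X * Z)%type := fun a => (a == (x, z))%:R.
  have dn : nrm d = 1.
    rewrite /nrm /d; under eq_bigr do rewrite sqn_bool -[_%:R]mulr1.
    by rewrite sum_deltaC.
  rewrite -dn; apply: le_trans (bessel d ortho); rewrite le_eqVlt; apply/orP; left; apply/eqP.
  apply: eq_bigr => y _; congr (_ / _); rewrite /P -sqn_conj; congr sqn.
  by rewrite /inner /d; under eq_bigr do rewrite mulrC; rewrite sum_deltaC.
have S : \sum_x \sum_y \sum_z (p x * r z * (P x y z / q y) - P x y z) <= 0.
  under eq_bigr do under eq_bigr do rewrite sumrB.
  under eq_bigr do rewrite sumrB.
  rewrite sumrB (tri_total tT) subr_le0.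
  apply: (@le_trans _ _ (\sum_x \sum_z p x * r z)).
    apply: ler_sum => x _; rewrite exchange_big; apply: ler_sum => z _ /=.
    by rewrite -mulr_sumr ler_piMr// mulr_ge0.
  under eq_bigr do rewrite -mulr_sumr (tri_sum_r tT) mulr1.
  by rewrite (tri_sum_p tT).
have : \sum_x \sum_y \sum_z (P x y z * ln (p x) + P x y z * ln (r z) - P x y z * ln (q y)) <= 0.
  apply: le_trans S; apply: ler_sum => x _; apply: ler_sum => y _; apply: ler_sum => z _.
  exact: pt.
under eq_bigr do under eq_bigr do rewrite sumrB big_split.
under eq_bigr do rewrite sumrB big_split.
by rewrite sumrB big_split /=; lra.
Qed.

End Subadditivity.

Section Capacity.
Variable R : realType.
Local Notation C := R[i].

(** Unfolds the infimum over [eps] and the lower limit: codes of rate [c - d] at all large lengths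
    suffice. *)
Lemma capacity_ge (A B E : finType) (U : op R (B * E)%type A) (c : R) :
  (forall eps d : R, 0 < eps -> 0 < d -> \forall n \near \oo%classic,
     exists N, EA_code U n N eps /\ pow2 (n%:R * (c - d)) <= N%:R) ->
  (c%:E <= capacity_EA U)%E.
Proof.
move=> h; apply/ereal_infP => _ [eps /= eps0 <-].
rewrite /limn_einf /limn_esup limf_esupN oppeK limf_einfE.
apply/lee_addgt0Pr => d d0; rewrite -leeBlDr//.
have ev : \forall n \near \oo%classic,
  ((c - d)%:E <= (n%:R^-1)%:E * elog2 (NA U n eps))%E.
  have h1 := h eps d eps0 d0; have h2 := nbhs_infty_ge 1.
  near=> n.
  have [N [cN hN]] : exists N, EA_code U n N eps /\ pow2 (n%:R * (c - d)) <= N%:R by near: n.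
  have n0 : (0 < n)%N by near: n.
  have le1 : ((N%:R)%:E <= NA U n eps)%E by apply: ereal_sup_ubound; exists N.
  have N0 : 0 < N%:R :> R by apply: lt_le_trans hN; exact: pow2_gt0.
  have nr : 0 < n%:R :> R by rewrite ltr0n.
  move: le1; case: (NA U n eps) => [x| |]//=.
  - rewrite lee_fin => le1; rewrite -EFinM lee_fin mulrC ler_pdivlMr//.
    rewrite -ler_pow2 mulrC pow2_log2 ?(lt_le_trans N0)//.
    exact: le_trans le1.
  - by move=> _; rewrite mulry gtr0_sg ?invr_gt0// mul1e leey.
apply: le_trans (ereal_sup_ubound _); last first.
  exists [set n | ((c - d)%:E <= (n%:R^-1)%:E * elog2 (NA U n eps))%E]%classic; first exact: ev.
  reflexivity.
by apply/ereal_infP => _ [n /= hn <-].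
Unshelve. all: by end_near. Qed.

(** Makes the capacity nonnegative, which settles lower bounds that are at most 0. *)
Lemma EA_code_one (A B E : finType) (U : op R (B * E)%type A) (n : nat) (eps : R) (a : A) :
  is_isometry U -> 0 < eps -> EA_code U n 1 eps.
Proof.
move=> iU eps0.
have iUn : is_isometry (@Utens R A B E U n).
  move=> x x'; rewrite sum_pair /Utens /=.
  rewrite /idop -prod_deltaR -(eq_bigr _ (fun k _ => iU (x k) (x' k))).
  under [RHS]eq_bigr do rewrite sum_pair.
  rewrite -(sum_tpow2 (fun k b c => (U (b, c) (x k))^* * U (b, c) (x' k))).
  apply: eq_bigr => y _; apply: eq_bigr => z _.
  by rewrite rmorph_prod -big_split.
pose psi : vec R (tpow n A) := fun x => (x == [ffun=> a])%:R.
have psi1 : nrm psi = 1.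
  rewrite /nrm /psi; under eq_bigr do rewrite sqn_bool -[_%:R]mulr1.
  by rewrite sum_deltaC.
have povm1 (I : finType) : is_povm (fun _ : 'I_1 => @idop R I).
  by split=> [k|x y]; [exact: psd_idop|rewrite big_ord1].
exists (fun=> applyop (@Utens R A B E U n) psi), (fun=> @idop R _); split=> [_|].
  by exists psi; split=> //; exact/unit_nrm.
split; first exact: povm1.
split.
  exists 1, (fun=> @idop R _), (fun=> fun=> @idop R _); split; first exact: povm1.
  split=> [_|_ x y]; first exact: povm1.
  by case: x y => ? ? [? ?]; rewrite big_ord1 /idop -natrM mulnb xpair_eqE.
move=> _; have /psd_qform/(_ (applyop (@Utens R A B E U n) psi))[-> _] := @psd_idop R (tpow n B * tpow n E)%type.
by rewrite lecR qform_id nrm_isometry// psi1; lra.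
Qed.

End Capacity.

(** * Message counts and error parameters of the two blocks *)

Section Rates.
Variable R : realType.
Local Notation C := R[i].

(** The successor gives at least [pow2 x] messages, and at least 2 when [0 <= x], so that the
    halving by expurgation leaves a code. *)
Definition messages (x : R) : nat := (Num.truncn (pow2 x)).+1.

Lemma messages_ge x : pow2 x <= (messages x)%:R.
Proof. by have /andP[_ /ltW] := truncn_itv (ltW (pow2_gt0 x)). Qed.

Lemma pow2_ge1 (x : R) : 0 <= x -> 1 <= pow2 x.
Proof. by move=> x0; rewrite -(pow2_0 R) ler_pow2. Qed.

Lemma messages_le x : 0 <= x -> (messages x)%:R <= 2 * pow2 x.
Proof.
move=> /pow2_ge1 h; have /andP[h1 _] := truncn_itv (ltW (pow2_gt0 x)).
by rewrite /messages -natr1; lra.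
Qed.

Lemma messages_ge2 x : 0 <= x -> (2 <= messages x)%N.
Proof.
move=> /pow2_ge1 h; rewrite -(ltr_nat R); apply: le_lt_trans h _.
by have /andP[] := truncn_itv (ltW (pow2_gt0 x)).
Qed.

Lemma pow2_small (x nu : R) : 0 < nu -> - log2 nu <= x -> pow2 (- x) <= nu.
Proof. by move=> nu0 h; rewrite -[leRHS]pow2_log2// ler_pow2; lra. Qed.

(** Deviations are measured against the total length [n], even in a shorter block, so Chebyshev's
    bound decays like [1 / n] whatever [n1] is. *)
Lemma mass_small n1 n (v d nu : R) : (n1 <= n)%N -> (0 < n)%N -> 0 <= v -> 0 < d -> 0 < nu ->
  v / (d ^+ 2 * nu) <= n%:R -> n1%:R * v / (d * n%:R) ^+ 2 <= nu.
Proof.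
move=> n1n n0 v0 d0 nu0 h.
have nr : 0 < n%:R :> R by rewrite ltr0n.
have d2 : 0 < d ^+ 2 * nu by rewrite mulr_gt0// exprn_gt0.
rewrite ler_pdivrMr// in h.
rewrite ler_pdivrMr ?exprn_gt0 ?mulr_gt0// exprMn.
apply: (@le_trans _ _ (n%:R * v)); first by rewrite ler_wpM2r// ler_nat.
have -> : nu * (d ^+ 2 * n%:R ^+ 2) = n%:R * (n%:R * (d ^+ 2 * nu)) by ring.
by rewrite ler_wpM2l.
Qed.

Variables (A B E : finType) (U : op R (B * E)%type A).
Variables (V V' : op R A A) (VY VY' : op R B B) (VZ VZ' : op R E E) (u u' : A -> B -> E -> C).
Variables (p p' : A -> R) (q q' : B -> R) (r r' : E -> R).
Let T x y z := (Num.sqrt (p x))%:C * u x y z.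
Let T' x y z := (Num.sqrt (p' x))%:C * u' x y z.
Hypotheses (uV : unitary V) (uV' : unitary V') (uY : unitary VY) (uY' : unitary VY').
Hypotheses (uZ : unitary VZ) (uZ' : unitary VZ').
Hypotheses (iU : intertwines U V VY VZ u) (iU' : intertwines U V' VY' VZ' u').
Hypotheses (tT : tripartite T p q r) (tT' : tripartite T' p' q' r').

Lemma codes_of_blocks n1 n2 N1 N2 (g : tpow n1 B -> R) w1 w2 (e1 e2 e eps : R) :
  (forall v, 0 <= g v) -> \sum_v g v <= 1 ->
  identifiable g (@codeword R (tpow n1 A) (tpow n1 B) (tpow n1 E) (tensT T) N1 w1) e1 ->
  decodable g (@codeword R (tpow n2 A) (tpow n2 B) (tpow n2 E) (tensT T') N2 w2) e2 ->
  0 < e -> e <= eps -> e1 <= e ^+ 2 / 256 -> e2 <= e / 4 -> (2 <= N1 * N2)%N ->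
  exists N, EA_code U (n1 + n2) N eps /\ (N1 * N2)%:R / 4 <= N%:R :> R.
Proof.
move=> g0 g1 id1 de2 e0 eeps he1 he2 hN.
(* With [t = e / 16] the bound on [e1] gives [e1 / t <= e / 16], in total
   [e / 4 + e / 8 <= eps / 2]. Rounding half of [N1 * N2 >= 2] down leaves at least a quarter. *)
have t0 : 0 < e / 16 by lra.
exists (N1 * N2)./2; split; last first.
  rewrite ler_pdivrMr// -natrM ler_nat.
  by have := odd_double_half (N1 * N2); lia.
apply: (EA_code_of_blocks uV uV' uY uY' uZ uZ' iU iU' tT tT' g0 g1 id1 de2 t0); [lra| |lia|lia].
have : e1 / (e / 16) <= e / 16.
  by rewrite ler_pdivrMr//; apply: le_trans he1 _; rewrite le_eqVlt; apply/orP; left; apply/eqP; field.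
by move=> h; lra.
Qed.

(** What the second block requires of the entanglement left by the first: mass near 1, and weights
    that certify about [n1 * S(B)] bits. *)
Definition block_weights (n1 n : nat) (g : tpow n1 B -> R) (gmax d nu : R) :=
  [/\ forall v, 0 <= g v, \sum_v g v <= 1, 1 - nu <= \sum_v g v, forall v, g v <= gmax &
   0 <= gmax <= 1 /\ gmax <= pow2 (- (n1%:R * shannon q - d * n%:R))].

Lemma first_block n1 n (a d nu : R) : (n1 <= n)%N -> (0 < n)%N -> 0 < d -> 0 < nu ->
  0 <= a -> n%:R * a <= n1%:R * (shannon r - shannon q) - 3 * d * n%:R ->
  (varentropy q + varentropy r) / (d ^+ 2 * (nu / 12)) <= n%:R ->
  - log2 (nu / 4) / d <= n%:R ->
  exists (g : tpow n1 B -> R) gmax w,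
    block_weights n g gmax d nu /\
    identifiable g (@codeword R (tpow n1 A) (tpow n1 B) (tpow n1 E) (tensT T) (messages (n%:R * a)) w) nu.
Proof.
move=> n1n n0 d0 nu0 a0 ha hm hp.
have nr : 0 < n%:R :> R by rewrite ltr0n.
have dn : 0 < d * n%:R by rewrite mulr_gt0.
have p0 := tri_q_ge0 tT; have p1 := tri_sum_q tT.
have [w hw] := identifiable_typical tT n1 (N := messages (n%:R * a)) (ltn0Sn _) dn.
have vq := varentropy_ge0 p0; have vr := varentropy_ge0 (tri_r_ge0 tT).
(* The bound [nu / 12] compensates the factor 3 in [identifiable_typical]. *)
have mass : (n1%:R * varentropy q + n1%:R * varentropy r) / (d * n%:R) ^+ 2 <= nu / 12.
  by rewrite -mulrDr; apply: mass_small => //; [lra|lra].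
have gE : \sum_(v : tpow n1 B) (typical q (d * n%:R) v)%:R * tensp q v =
    1 - \sum_(v : tpow n1 B) (~~ typical q (d * n%:R) v)%:R * tensp q v.
  transitivity (\sum_(v : tpow n1 B) tensp q v -
    \sum_(v : tpow n1 B) (~~ typical q (d * n%:R) v)%:R * tensp q v); last by rewrite tensp_sum.
  rewrite -sumrB; apply: eq_bigr => v _.
  by case: typical; rewrite /= ?mul1r ?mul0r ?subr0 ?subrr.
have at0 : 0 <= \sum_(v : tpow n1 B) (~~ typical q (d * n%:R) v)%:R * tensp q v.
  by apply: sumr_ge0 => v _; rewrite mulr_ge0// tensp_ge0.
have at1 : \sum_(v : tpow n1 B) (~~ typical q (d * n%:R) v)%:R * tensp q v <= nu.
  apply: le_trans (atypical_mass p0 p1 n1 dn) _; apply: le_trans (le_trans mass _); last by lra.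
  by rewrite ler_wpM2r ?invr_ge0 ?sqr_ge0// lerDl mulr_ge0.
(* The cap at 1 matters when [n1 * S(B) < d * n], where the power of 2 exceeds 1. *)
exists (fun y => (typical q (d * n%:R) y)%:R * tensp q y),
  (Num.min 1 (pow2 (- (n1%:R * shannon q - d * n%:R)))), w; split.
  split=> [v| | |v|].
  - by rewrite mulr_ge0// tensp_ge0.
  - by rewrite gE; lra.
  - by rewrite gE; lra.
  - rewrite le_min; apply/andP; split.
      by case: typical; rewrite ?mul1r ?mul0r// -(tensp_sum n1 p1) (bigD1 v)//= lerDl sumr_ge0// => *; exact: tensp_ge0.
    case: (boolP (typical q (d * n%:R) v)) => [/(typical_le p0)|_]; first by rewrite mul1r.
    by rewrite mul0r ltW// pow2_gt0.
  - by rewrite le_min ler01 ltW ?pow2_gt0//= !ge_min !lexx orbT.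
have [W [cW hW]] := hw; exists W; split=> //; apply: le_trans hW _; rewrite ler_wpM2l//.
have hM := messages_le (mulr_ge0 (ltW nr) a0).
(* Of the [3 d n] conceded by the rate, two pay for typicality at Bob and Charlie; the third makes
   the product small. *)
have : (messages (n%:R * a))%:R * pow2 (n1%:R * (shannon q - shannon r) + 2 * (d * n%:R)) <= 2 * (nu / 4).
  apply: le_trans (ler_wpM2r (ltW (pow2_gt0 _)) hM) _; rewrite -mulrA -pow2D ler_wpM2l//.
  have small : pow2 (- (d * n%:R)) <= nu / 4.
    by apply: pow2_small; [lra|rewrite [leRHS]mulrC -ler_pdivrMr].
  apply: le_trans small.
  by rewrite ler_pow2; lra.
by move=> h; lra.
Qed.

Lemma second_block n1 n2 n (g : tpow n1 B -> R) (b d nu gmax e : R) : (n2 <= n)%N -> (0 < n)%N ->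
  0 < d -> 0 < nu -> nu <= 1 -> 0 < e -> nu <= e ^+ 2 / 512 -> e <= 1 -> 0 <= b ->
  block_weights n g gmax d nu ->
  n%:R * b <= n2%:R * shannon p' - 2 * d * n%:R ->
  n%:R * b <= n1%:R * shannon q + n2%:R * shannon q' - 3 * d * n%:R ->
  (varentropy p' + varentropy q') / (d ^+ 2 * nu) <= n%:R ->
  - log2 (nu / 4) / d <= n%:R ->
  exists w, decodable g (@codeword R (tpow n2 A) (tpow n2 B) (tpow n2 E) (tensT T') (messages (n%:R * b)) w) (e / 4).
Proof.
move=> n2n n0 d0 nu0 nu1 e0 nue e1 b0 [g0 g1 geta ggmax [gmax1 gmaxp]] hb1 hb2 hm hp.
have nr : 0 < n%:R :> R by rewrite ltr0n.
have dn : 0 < d * n%:R by rewrite mulr_gt0.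
have t0 : 0 < e / 16 by lra.
have [w [F [pF hF]]] := decodable_typical tT' n2 (N := messages (n%:R * b)) (ltn0Sn _) dn t0 g0 g1 geta ggmax gmax1.
exists w, F; split=> //; apply: le_trans hF _; rewrite ler_wpM2l//.
have vp := varentropy_ge0 (tri_p_ge0 tT'); have vq := varentropy_ge0 (tri_q_ge0 tT').
set eta := (_ / (d * n%:R) ^+ 2).
have eta0 : 0 <= eta by rewrite divr_ge0 ?sqr_ge0// addr_ge0// mulr_ge0.
have mass : eta <= nu by rewrite /eta -mulrDr; apply: mass_small => //; lra.
have hM := messages_le (mulr_ge0 (ltW nr) b0).
have small : pow2 (- (d * n%:R)) <= nu / 4.
  by apply: pow2_small; [lra|rewrite [leRHS]mulrC -ler_pdivrMr].
have h1 : (messages (n%:R * b))%:R * (pow2 (- (n2%:R * shannon p' - d * n%:R)) +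
    gmax * pow2 (- (n2%:R * shannon q' - d * n%:R))) <= nu.
  apply: le_trans (ler_wpM2r _ hM) _.
    apply: addr_ge0; first exact/ltW/pow2_gt0.
    by apply: mulr_ge0; [case/andP: gmax1|exact/ltW/pow2_gt0].
  (* Overlaps limit the rate by [S(A')], fluctuations by Bob's entropy plus that of the shared
     state. Each typicality estimate costs one [d n], and one more is the margin. *)
  have k1 : pow2 (n%:R * b) * pow2 (- (n2%:R * shannon p' - d * n%:R)) <= pow2 (- (d * n%:R)).
    by rewrite -pow2D ler_pow2; lra.
  have k2 : pow2 (n%:R * b) * (gmax * pow2 (- (n2%:R * shannon q' - d * n%:R))) <= pow2 (- (d * n%:R)).
    apply: (@le_trans _ _ (pow2 (n%:R * b) * (pow2 (- (n1%:R * shannon q - d * n%:R)) * pow2 (- (n2%:R * shannon q' - d * n%:R))))).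
      apply: ler_wpM2l; first exact/ltW/pow2_gt0.
      by apply: ler_wpM2r => //; exact/ltW/pow2_gt0.
    by rewrite -!pow2D ler_pow2; lra.
  by rewrite -mulrA mulrDr; lra.
(* Origin of 512: [e ^+ 2 / 512] is the product of [e / 32] and [e / 16]. *)
have h2 : eta / (e / 16) <= e / 32.
  rewrite ler_pdivrMr//; apply: le_trans mass _; apply: le_trans nue _.
  by rewrite le_eqVlt; apply/orP; left; apply/eqP; field.
have h3 : gmax * eta ^+ 2 <= nu.
  case/andP: gmax1 => gm0 gm1; apply: le_trans (_ : eta ^+ 2 <= _); first by rewrite ler_piMl// sqr_ge0.
  by rewrite expr2; apply: (le_trans _ mass); rewrite ler_piMl//; lra.
have h4 : e ^+ 2 <= e by rewrite expr2 ler_piMl// ltW.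
(* The total is at most [8 nu + 3 e / 32], and [8 nu <= e / 64]. *)
lra.
Qed.

End Rates.

(** * The rates *)

Section MainTheorem.
Variable R : realType.
Local Notation C := R[i].

(** The factor 4 lost to expurgation is two bits, covered by [n * d / 2]. *)
Lemma messages_pow2_ge (n N1 N2 : nat) (a b c d : R) : 4 / d <= n%:R -> 0 < d ->
  pow2 (n%:R * a) <= N1%:R -> pow2 (n%:R * b) <= N2%:R -> c - d / 2 <= a + b ->
  pow2 (n%:R * (c - d)) <= (N1 * N2)%:R / 4.
Proof.
move=> hn d0 h1 h2 hc.
have nd : 4 <= n%:R * d by rewrite -ler_pdivrMr.
have e4 : pow2 (2 : R) = 4.
  by rewrite -[2]/(1 + 1) pow2D /pow2 mul1r lnK ?posrE//; ring.
rewrite ler_pdivlMr// -e4 -pow2D natrM; apply: le_trans (_ : pow2 (n%:R * a) * pow2 (n%:R * b) <= _).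
  rewrite -pow2D ler_pow2 -mulrDr.
  have : n%:R * (c - d / 2) <= n%:R * (a + b) by rewrite ler_wpM2l.
  by rewrite !mulrBr => h; lra.
by apply: ler_pM => //; exact/ltW/pow2_gt0.
Qed.

Lemma error_budget (eps : R) : 0 < eps ->
  exists e, [/\ 0 < e, e <= 1, e <= eps & 0 < e ^+ 2 / 512 <= 1].
Proof.
move=> eps0; have e0 : 0 < Num.min eps 1 by rewrite lt_min eps0 ltr01.
have e1 : Num.min eps 1 <= 1 by rewrite ge_min lexx orbT.
exists (Num.min eps 1); split=> //; first by rewrite ge_min lexx.
have e2 : 0 < Num.min eps 1 ^+ 2 by rewrite exprn_gt0.
have : Num.min eps 1 ^+ 2 <= 1 by rewrite expr_le1// ltW.
by move=> h; apply/andP; split; lra.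
Qed.

Lemma entropy_subadditive (A B E : finType) (U : op R (B * E)%type A) (rho : op R A A) :
  is_isometry U -> is_state rho ->
  [/\ entropy rho <= entropy (chan U rho) + entropy (chanc U rho),
      entropy (chan U rho) <= entropy rho + entropy (chanc U rho),
      0 <= entropy rho & 0 <= entropy (chan U rho)].
Proof.
move=> iU sr; have [V [VY [VZ [u [_ _ _ _ tT]]]]] := state_diagonal iU sr; split.
- have := shannon_subadditive (tripartite_rot (tripartite_rot tT)).
  by rewrite addrC.
- exact: shannon_subadditive tT.
- exact: shannon_ge0 (tri_p_ge0 tT) (tri_sum_p tT).
- exact: shannon_ge0 (tri_q_ge0 tT) (tri_sum_q tT).
Qed.

Variables (A B E : finType) (U : op R (B * E)%type A).
Hypothesis iU : is_isometry U.

Lemma state_inhabited (rho : op R A A) : is_state rho -> exists a : A, true.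
Proof.
move=> [_ tr]; case: (pickP (fun _ : A => true)) => [a _|h]; first by exists a.
move: tr; rewrite /trace big_pred0 => [/eqP|a]; last by have := h a.
by rewrite eq_sym oner_eq0.
Qed.

Lemma capacity_ge0 (rho : op R A A) : is_state rho -> (0%:E <= capacity_EA U)%E.
Proof.
move=> /state_inhabited[a _]; apply: capacity_ge => eps d eps0 d0.
apply: nearW => n; exists 1%N; split; first exact: EA_code_one.
by rewrite -[leRHS](pow2_0 R) ler_pow2 sub0r mulrN oppr_le0 mulr_ge0// ltW.
Qed.

(** The first block is empty, so nothing relaxes the constraint by Bob's entropy. *)
Lemma capacity_ge_min (rho : op R A A) : is_state rho ->
  ((Num.min (entropy rho) (entropy (chan U rho)))%:E <= capacity_EA U)%E.
Proof.
move=> sr; set c := Num.min _ _.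
have [c0|c0] := leP c 0; first by apply: le_trans (capacity_ge0 sr); rewrite lee_fin.
have [V [VY [VZ [u [uV uY uZ iu tT]]]]] := state_diagonal iU sr.
apply: capacity_ge => eps d eps0 d0.
have [e [e0 e1 eeps /andP[nu0 nu1]]] := error_budget eps0.
set nu := e ^+ 2 / 512 in nu0 nu1.
(* The rate loss [4 dl] stays below [d / 2], and [dl <= c / 8] keeps the remaining rate
   nonnegative. *)
pose dl := Num.min (d / 8) (c / 8).
have dl0 : 0 < dl by rewrite lt_min !divr_gt0.
have dld : dl <= d / 8 by rewrite ge_min lexx.
have dlc : dl <= c / 8 by rewrite ge_min lexx orbT.
have cA : c <= entropy rho by rewrite ge_min lexx.
have cB : c <= entropy (chan U rho) by rewrite ge_min lexx orbT.
near=> n.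
have n0 : (0 < n)%N by near: n; exact: nbhs_infty_ge.
have nr : 0 < n%:R :> R by rewrite ltr0n.
have nd : 0 < dl * n%:R by rewrite mulr_gt0.
have h1 : (varentropy (spec rho) + varentropy (spec (chan U rho))) / (dl ^+ 2 * nu) <= n%:R.
  by near: n; exact: nbhs_infty_ger.
have h2 : - log2 (nu / 4) / dl <= n%:R by near: n; exact: nbhs_infty_ger.
have h3 : 4 / d <= n%:R by near: n; exact: nbhs_infty_ger.
have [w1 id1] := identifiable_trivial (fun x y z => (Num.sqrt (spec rho x))%:C * u x y z).
have bw : @block_weights R B (spec (chan U rho)) 0 n (fun=> 1) 1 dl nu.
  have s1 : \sum_(v : tpow 0 B) (1 : R) = 1.
    by rewrite sumr_const card_ffun card_ord expn0.
  split=> //; rewrite ?s1//; first lra.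
  by rewrite ler01 lexx; split=> //; rewrite mul0r sub0r opprK pow2_ge1// ltW.
have hb : n%:R * (c - 4 * dl) <= n%:R * c - 4 * dl * n%:R by rewrite mulrBr; lra.
have nA : n%:R * c <= n%:R * entropy rho by rewrite ler_wpM2l.
have nB : n%:R * c <= n%:R * entropy (chan U rho) by rewrite ler_wpM2l.
have b0 : 0 <= c - 4 * dl by lra.
have hb1 : n%:R * (c - 4 * dl) <= n%:R * entropy rho - 2 * dl * n%:R by lra.
have hb2 : n%:R * (c - 4 * dl) <= 0%:R * entropy (chan U rho) + n%:R * entropy (chan U rho) - 3 * dl * n%:R.
  by rewrite mul0r; lra.
have [w2 de2] := second_block tT (leqnn n) n0 dl0 nu0 nu1 e0 (lexx _) e1 b0 bw hb1 hb2 h1 h2.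
have m2 := messages_ge2 (mulr_ge0 (ltW nr) b0).
have g1 : \sum_(v : tpow 0 B) (1 : R) <= 1 by case: bw.
have id0 : 0 <= e ^+ 2 / 256 by rewrite divr_ge0 ?sqr_ge0.
have hN2 : (2 <= 1 * messages (n%:R * (c - 4 * dl)))%N by rewrite mul1n.
have [N [cN hN]] := codes_of_blocks uV uV uY uY uZ uZ iu iu tT tT
  (fun=> ler01) g1 id1 de2 e0 eeps id0 (lexx _) hN2.
exists N; split=> //; apply: le_trans hN.
apply: (@messages_pow2_ge n 1 _ 0 (c - 4 * dl)) => //.
- by rewrite mulr0 pow2_0.
- exact: messages_ge.
- by rewrite add0r; lra.
Unshelve. all: by end_near. Qed.

(** Here the second block is empty. This serves (ii) when [S(B) = 0]. *)
Lemma capacity_ge_helper (rho : op R A A) : is_state rho ->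
  entropy (chan U rho) < entropy (chanc U rho) ->
  ((entropy (chanc U rho) - entropy (chan U rho))%:E <= capacity_EA U)%E.
Proof.
move=> sr hlt; set c := _ - _.
have c0 : 0 < c by rewrite subr_gt0.
have [V [VY [VZ [u [uV uY uZ iu tT]]]]] := state_diagonal iU sr.
apply: capacity_ge => eps d eps0 d0.
have [e [e0 e1 eeps /andP[nu0 nu1]]] := error_budget eps0.
set nu := e ^+ 2 / 512 in nu0 nu1.
pose dl := Num.min (d / 8) (c / 8).
have dl0 : 0 < dl by rewrite lt_min !divr_gt0.
have dld : dl <= d / 8 by rewrite ge_min lexx.
have dlc : dl <= c / 8 by rewrite ge_min lexx orbT.
near=> n.
have n0 : (0 < n)%N by near: n; exact: nbhs_infty_ge.
have nr : 0 < n%:R :> R by rewrite ltr0n.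
have nd : 0 < dl * n%:R by rewrite mulr_gt0.
have h1 : (varentropy (spec (chan U rho)) + varentropy (spec (chanc U rho))) /
    (dl ^+ 2 * (nu / 12)) <= n%:R by near: n; exact: nbhs_infty_ger.
have h2 : - log2 (nu / 4) / dl <= n%:R by near: n; exact: nbhs_infty_ger.
have h3 : 4 / d <= n%:R by near: n; exact: nbhs_infty_ger.
have ha : n%:R * (c - 4 * dl) <= n%:R * c - 3 * dl * n%:R by rewrite mulrBr; lra.
have a0 : 0 <= c - 4 * dl by lra.
have [g [gmax [w1 [bw id1]]]] := first_block tT (leqnn n) n0 dl0 nu0 a0 ha h1 h2.
have [g0 g1 geta _ _] := bw.
have [w2 de2] := @decodable_trivial R A B E _ _ _ _ tT 0 _ g nu g0 geta.
have m1 := messages_ge2 (mulr_ge0 (ltW nr) a0).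
have he1 : nu <= e ^+ 2 / 256 by rewrite /nu; have := sqr_ge0 e; lra.
have he2 : nu <= e / 4.
  have : e ^+ 2 <= e by rewrite expr2 ler_piMl// ltW.
  by rewrite /nu; lra.
have hN2 : (2 <= messages (n%:R * (c - 4 * dl)) * 1)%N by rewrite muln1.
have [N [cN hN]] := codes_of_blocks uV uV uY uY uZ uZ iu iu tT tT
  g0 g1 id1 de2 e0 eeps he1 he2 hN2.
exists N; rewrite addn0 in cN; split=> //; apply: le_trans hN.
apply: (@messages_pow2_ge n _ 1 (c - 4 * dl) 0) => //.
- exact: messages_ge.
- by rewrite mulr0 pow2_0.
- by rewrite addr0; lra.
Unshelve. all: by end_near. Qed.

(** [l] is the share of the first block. The balance equation says that its entanglement just fills
    Bob's deficit on the second, where both constraints then give the rate [S(A')]. *)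
Lemma capacity_ge_mix (rho rho' : op R A A) (l : R) : is_state rho -> is_state rho' ->
  0 < l < 1 -> entropy (chan U rho) < entropy (chanc U rho) -> 0 < entropy rho' ->
  l * entropy (chan U rho) + (1 - l) * entropy (chan U rho') = (1 - l) * entropy rho' ->
  ((l * (entropy (chanc U rho) - entropy (chan U rho)) + (1 - l) * entropy rho')%:E <= capacity_EA U)%E.
Proof.
move=> sr sr' /andP[l0 l1] hlt hA hbal; set c := _ + _.
have [V [VY [VZ [u [uV uY uZ iu tT]]]]] := state_diagonal iU sr.
have [V' [VY' [VZ' [u' [uV' uY' uZ' iu' tT']]]]] := state_diagonal iU sr'.
have [_ _ _ SB0] := entropy_subadditive iU sr.
have [_ _ _ SB0'] := entropy_subadditive iU sr'.
pose SB := entropy (chan U rho); pose SC := entropy (chanc U rho).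
pose SA' := entropy rho'; pose SB' := entropy (chan U rho').
rewrite -/SB -/SC -/SA' -/SB' in hlt hA hbal SB0 SB0' c *.
pose ca := l * (SC - SB); pose cb := (1 - l) * SA'.
have ca0 : 0 < ca by rewrite mulr_gt0// subr_gt0.
have cb0 : 0 < cb by rewrite mulr_gt0// subr_gt0.
apply: capacity_ge => eps d eps0 d0.
have [e [e0 e1 eeps /andP[nu0 nu1]]] := error_budget eps0.
set nu := e ^+ 2 / 512 in nu0 nu1.
(* The blocks lose [4 dl] and [5 dl], together at most [d / 2]. *)
pose dl := Num.min (d / 18) (Num.min (ca / 8) (cb / 8)).
have dl0 : 0 < dl by rewrite !lt_min !divr_gt0.
have dld : dl <= d / 18 by rewrite ge_min lexx.
have dla : dl <= ca / 8 by rewrite !ge_min lexx orbT.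
have dlb : dl <= cb / 8 by rewrite !ge_min lexx !orbT.
near=> n.
have n0 : (0 < n)%N by near: n; exact: nbhs_infty_ge.
have nr : 0 < n%:R :> R by rewrite ltr0n.
have nd : 0 < dl * n%:R by rewrite mulr_gt0.
have h1 : (varentropy (spec (chan U rho)) + varentropy (spec (chanc U rho))) /
    (dl ^+ 2 * (nu / 12)) <= n%:R by near: n; exact: nbhs_infty_ger.
have h1' : (varentropy (spec rho') + varentropy (spec (chan U rho'))) /
    (dl ^+ 2 * nu) <= n%:R by near: n; exact: nbhs_infty_ger.
have h2 : - log2 (nu / 4) / dl <= n%:R by near: n; exact: nbhs_infty_ger.
have h3 : 4 / d <= n%:R by near: n; exact: nbhs_infty_ger.
have h4 : (SC - SB) / dl <= n%:R by near: n; exact: nbhs_infty_ger.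
have h5 : SB / dl <= n%:R by near: n; exact: nbhs_infty_ger.
rewrite ler_pdivrMr// mulrC in h4; rewrite ler_pdivrMr// mulrC in h5.
(* Rounding [l * n] down loses at most one letter, whose contributions [h4] and [h5] bound by
   [dl * n]. *)
pose n1 := Num.truncn (l * n%:R).
have /andP[n1l n1u] : n1%:R <= l * n%:R < n1.+1%:R by apply: truncn_itv; rewrite mulr_ge0// ltW.
have n1n : (n1 <= n)%N.
  by rewrite -(ler_nat R); apply: le_trans n1l _; rewrite ler_piMl// ltW.
pose n2 := (n - n1)%N.
have n2n : (n2 <= n)%N by rewrite leq_subr.
have n12 : (n1 + n2)%N = n by rewrite subnKC.
have n2E : n2%:R = n%:R - n1%:R :> R by rewrite natrB.
rewrite -natr1 in n1u.
have ha : n%:R * (ca - 4 * dl) <= n1%:R * (SC - SB) - 3 * dl * n%:R.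
  have : (l * n%:R - 1) * (SC - SB) <= n1%:R * (SC - SB).
    by rewrite ler_wpM2r ?subr_ge0 ?ltW//; lra.
  by rewrite /ca; lra.
have a0 : 0 <= ca - 4 * dl by lra.
have [g [gmax [w1 [bw id1]]]] := first_block tT n1n n0 dl0 nu0 a0 ha h1 h2.
have [g0 g1 geta _ _] := bw.
have b0 : 0 <= cb - 5 * dl by lra.
have n2l : (1 - l) * n%:R <= n2%:R by rewrite n2E; lra.
have hb1 : n%:R * (cb - 5 * dl) <= n2%:R * SA' - 2 * dl * n%:R.
  have : (1 - l) * n%:R * SA' <= n2%:R * SA' by rewrite ler_wpM2r// ltW.
  by rewrite /cb; lra.
have hb2 : n%:R * (cb - 5 * dl) <= n1%:R * SB + n2%:R * SB' - 3 * dl * n%:R.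
  have k1 : (l * n%:R - 1) * SB <= n1%:R * SB by rewrite ler_wpM2r//; lra.
  have k2 : (1 - l) * n%:R * SB' <= n2%:R * SB' by rewrite ler_wpM2r.
  have k3 : n%:R * cb = n%:R * (l * SB + (1 - l) * SB') by rewrite hbal.
  by rewrite mulrBr k3; lra.
have [w2 de2] := second_block tT' n2n n0 dl0 nu0 nu1 e0 (lexx _) e1 b0 bw hb1 hb2 h1' h2.
have m1 := messages_ge2 (mulr_ge0 (ltW nr) a0).
have m2 := messages_ge2 (mulr_ge0 (ltW nr) b0).
have he1 : nu <= e ^+ 2 / 256 by rewrite /nu; have := sqr_ge0 e; lra.
have hN2 : (2 <= messages (n%:R * (ca - 4 * dl)) * messages (n%:R * (cb - 5 * dl)))%N.
  by apply: leq_trans m1 _; rewrite leq_pmulr// ltnW.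
have [N [cN hN]] := codes_of_blocks uV uV' uY uY' uZ uZ' iu iu' tT tT'
  g0 g1 id1 de2 e0 eeps he1 (lexx _) hN2.
exists N; rewrite n12 in cN; split=> //; apply: le_trans hN.
apply: (@messages_pow2_ge n _ _ (ca - 4 * dl) (cb - 5 * dl)) => //.
- exact: messages_ge.
- exact: messages_ge.
- by rewrite /c -/ca -/cb; lra.
Unshelve. all: by end_near. Qed.

End MainTheorem.

Unset Implicit Arguments.

Theorem mainTheorem1 (R : realType) (A B E : finType)
    (U : op R (B * E)%type A) (hU : is_isometry U) :
  let SA := fun rho : op R A A => entropy rho in
  let SB := fun rho : op R A A => entropy (chan U rho) in
  let SC := fun rho : op R A A => entropy (chanc U rho) in
  let IAB := fun rho : op R A A => SA rho + SB rho - SC rho in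
  (forall rho : op R A A, is_state rho ->
     (SA rho <= SB rho -> ((SA rho)%:E <= capacity_EA U)%E) /\
     ((IAB rho / 2)%:E <= capacity_EA U)%E) /\
  (forall rho rho' : op R A A, is_state rho -> is_state rho' ->
     SB rho < SC rho -> SB rho' < SA rho' ->
     (((SC rho - SB rho + SB rho / (SA rho' - SB rho') * SA rho')
        / (1 + SB rho / (SA rho' - SB rho')))%:E <= capacity_EA U)%E) /\
  (forall rho : op R A A, is_state rho ->
     SB rho < SC rho -> SB rho < SA rho ->
     (((1 - SB rho / SA rho) * SC rho + SB rho / SA rho * SB rho)%:E
        <= capacity_EA U)%E).
Proof.
move=> SA SB SC IAB.
have mix (rho rho' : op R A A) : is_state rho -> is_state rho' ->
     SB rho < SC rho -> SB rho' < SA rho' ->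
     (((SC rho - SB rho + SB rho / (SA rho' - SB rho') * SA rho')
        / (1 + SB rho / (SA rho' - SB rho')))%:E <= capacity_EA U)%E.
  move=> sr sr' hBC hBA.
  have [_ _ _ SB0] := entropy_subadditive hU sr; rewrite -/(SB rho) in SB0.
  have [_ _ _ SB0'] := entropy_subadditive hU sr'; rewrite -/(SB rho') in SB0'.
  have dpos : 0 < SA rho' - SB rho' by rewrite subr_gt0.
  (* With [S(B) = 0] the first block would take the whole share, [l = 1], which [capacity_ge_mix]
     excludes. *)
  have [z|z] := eqVneq (SB rho) 0.
    apply: le_trans (capacity_ge_helper hU sr hBC); rewrite lee_fin.
    by rewrite z !mul0r !addr0 divr1 -/(SB rho) z.
  have SBp : 0 < SB rho by rewrite lt_def z.
  set x := SB rho / _; have x0 : 0 < x by rewrite divr_gt0.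
  (* Block lengths in the ratio [1 : x] give the first block the share [1 / (1 + x)]. *)
  have l01 : 0 < (1 + x)^-1 < 1.
    by rewrite invr_gt0 addr_gt0//= invf_lt1 ?addr_gt0// ltrDl.
  have bal : (1 + x)^-1 * SB rho + (1 - (1 + x)^-1) * SB rho' = (1 - (1 + x)^-1) * SA rho'.
    have e : SB rho = x * (SA rho' - SB rho') by rewrite /x divfK// gt_eqF.
    by rewrite e; field; lra.
  have := capacity_ge_mix hU sr sr' l01 hBC (le_lt_trans SB0' hBA) bal.
  apply: le_trans; rewrite lee_fin le_eqVlt; apply/orP; left; apply/eqP.
  by rewrite -/(SA rho') -/(SB rho) -/(SC rho); field; lra.
split; [|split]; last 2 first.
- exact: mix.
- move=> rho sr hBC hBA; apply: le_trans (mix rho rho sr sr hBC hBA).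
  have [_ _ _ SB0] := entropy_subadditive hU sr; rewrite -/(SB rho) in SB0.
  (* For [rho' = rho] the denominator [1 + x] is [S(A) / (S(A) - S(B))]. *)
  rewrite lee_fin le_eqVlt; apply/orP; left; apply/eqP; field.
  by repeat (apply/andP; split); lra.
move=> rho sr; have [h1 h2 _ _] := entropy_subadditive hU sr.
have hmin := capacity_ge_min hU sr.
split=> [hAB|].
  by apply: le_trans hmin; rewrite lee_fin le_min lexx.
apply: le_trans hmin; rewrite lee_fin le_min /IAB /SA /SB /SC.
(* [I(A:B) / 2 <= S(A)] amounts to [S(B) <= S(A) + S(C)], and [I(A:B) / 2 <= S(B)] to
   [S(A) <= S(B) + S(C)]. *)
by apply/andP; split; lra.
Qed.
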